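(* Let $R$ be a noetherian integral domain that is an $\mathbb{F}_q$-algebra, and let $\mathcal{M}$ be an $F_{\mathfrak p}$-isocrystal over $R$. There exists an element $\xi\in R\smallsetminus\{0\}$ such that $\mathcal{M}$ acquires a slope filtration over $R[\xi^{-1}]$, i.e. the base change of $\mathcal{M}$ to $R[\xi^{-1}]$ possesses a slope filtration.
   Context: $F_{\mathfrak p}$ is a nonarchimedean local field containing the finite field $\mathbb{F}_q$, with ring of integers $A_{\mathfrak p}$, uniformizer $z_{\mathfrak p}$, and residue field $k_{\mathfrak p}$ of degree $d_{\mathfrak p}$ over $\mathbb{F}_q$. For a commutative $\mathbb{F}_q$-algebra $R$ with discrete topology let $\mathcal{E}_{F_{\mathfrak p},R}:=F_{\mathfrak p}\widehat\otimes_{\mathbb{F}_q}R\cong(k_{\mathfrak p}\otimes_{\mathbb{F}_q}R)((z_{\mathfrak p}))$ and $\mathcal{E}_{A_{\mathfrak p},R}:=A_{\mathfrak p}\widehat\otimes_{\mathbb{F}_q}R$, with $\sigma(a\widehat\otimes\xi):=a\widehat\otimes\xi^q$. An $F_{\mathfrak p}$-isocrystal over $R$ is a finitely generated projective $\mathcal{E}_{F_{\mathfrak p},R}$-module $\mathcal{M}$ with an additive map $\tau:\mathcal{M}\to\mathcal{M}$, $\tau(em)=\sigma(e)\tau(m)$, whose linearization $\sigma^*\mathcal{M}\to\mathcal{M}$ is an isomorphism. Base change along $R\to R'$ is $\mathcal{E}_{F_{\mathfrak p},R'}\otimes_{\mathcal{E}_{F_{\mathfrak p},R}}\mathcal{M}$.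 A lattice in $\mathcal{M}$ is a finitely generated projective $\mathcal{E}_{A_{\mathfrak p},R}$-submodule $\mathcal{L}$ with $\mathcal{L}[z_{\mathfrak p}^{-1}]=\mathcal{M}$. $\mathcal{M}$ is pure of slope $\alpha\in\mathbb{Q}$ if there exist an integer $n>0$ with $n\alpha\in\mathbb{Z}$ and a lattice $\mathcal{L}\subset\mathcal{M}$ such that $\tau^{nd_{\mathfrak p}}\mathcal{L}$ generates the lattice $z_{\mathfrak p}^{n\alpha}\mathcal{L}$. A slope filtration of $\mathcal{M}$ is a separated exhaustive right continuous ascending filtration by $F_{\mathfrak p}$-isocrystals $\mathcal{M}_{\le\alpha}$ over $R$ indexed by all $\alpha\in\mathbb{Q}$, such that every subquotient $\mathcal{M}_\alpha:=\mathcal{M}_{\le\alpha}/\mathcal{M}_{<\alpha}$ with $\mathcal{M}_{<\alpha}:=\bigcup_{\beta<\alpha}\mathcal{M}_{\le\beta}$ is an $F_{\mathfrak p}$-isocrystal that is pure of slope $\alpha$. *)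

(* Defs.v *)
From HB Require Import structures.
From mathcomp Require Import all_boot all_order all_algebra all_field.
From mathcomp Require Import mathcomp_extra boolp classical_sets functions.
From mathcomp Require Import cardinality fsbigop.
From mathcomp Require Import zify.

Set Implicit Arguments.
Unset Strict Implicit.
Unset Printing Implicit Defensive.

Import Order.TTheory GRing.Theory Num.Theory.
Local Open Scope ring_scope.
Local Open Scope quotient_scope.

(* [ext f M] is the A-module A (x)_S M, for f : S -> A: finite formal sums of
   pairs (a, m), written as lists, modulo the relations of the tensor product. *)
Section ExtDef.
Context (S A : comPzRingType) (f : {rmorphism S -> A}) (M : lmodType S).
Implicit Types s t u : seq (A * M).

Inductive ext_rel : seq (A * M) -> seq (A * M) -> Prop :=
| ext_refl s : ext_rel s s
| ext_sym s t : ext_rel s t -> ext_rel t s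
| ext_trans s t u : ext_rel s t -> ext_rel t u -> ext_rel s u
| ext_cat s s' t t' : ext_rel s s' -> ext_rel t t' -> ext_rel (s ++ t) (s' ++ t')
| ext_catC s t : ext_rel (s ++ t) (t ++ s)
| ext_zero m : ext_rel [:: (0, m)] [::]
| ext_addl a b m : ext_rel [:: (a + b, m)] [:: (a, m); (b, m)]
| ext_addr a m n : ext_rel [:: (a, m + n)] [:: (a, m); (a, n)]
| ext_bal a c m : ext_rel [:: (a * f c, m)] [:: (a, c *: m)].

Definition ext_relb s t : bool := `[< ext_rel s t >].

Lemma ext_relb_equiv : equiv_class_of ext_relb.
Proof.
split.
- by move=> s; apply/asboolP; exact: ext_refl.
- by move=> s t; apply: asbool_equiv_eq; split; exact: ext_sym.
- by move=> t s u /asboolP st /asboolP tu; apply/asboolP; exact: ext_trans tu.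
Qed.

Canonical ext_relb_equiv_rel := EquivRelPack ext_relb_equiv.

Definition ext := {eq_quot ext_relb}.

HB.instance Definition _ := Choice.on ext.
HB.instance Definition _ : EqQuotient _ ext_relb ext := EqQuotient.on ext.

Definition ext_cls s : ext := \pi_ext s.

Lemma ext_clsP s t : ext_rel s t -> ext_cls s = ext_cls t.
Proof. by move=> st; apply/eqmodP/asboolP. Qed.

Lemma ext_cls_rel s t : ext_cls s = ext_cls t -> ext_rel s t.
Proof. by move=> /eqmodP/asboolP. Qed.

Lemma ext_cls_repr (x : ext) : ext_cls (repr x) = x.
Proof. exact: reprK. Qed.

Lemma ext_repr_cls s : ext_rel (repr (ext_cls s)) s.
Proof. by apply: ext_cls_rel; rewrite ext_cls_repr. Qed.

Definition ext_scale_seq a s := [seq (a * x.1, x.2) | x <- s].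

Lemma ext_scale_rel a s t :
  ext_rel s t -> ext_rel (ext_scale_seq a s) (ext_scale_seq a t).
Proof.
elim=> {s t} /=.
- by move=> s; exact: ext_refl.
- by move=> s t _; exact: ext_sym.
- by move=> s t u _ st _; exact: ext_trans st.
- by move=> s s' t t' _ ? _ ?; rewrite /ext_scale_seq !map_cat; exact: ext_cat.
- by move=> s t; rewrite /ext_scale_seq !map_cat; exact: ext_catC.
- by move=> m; rewrite /= mulr0; exact: ext_zero.
- by move=> b c m; rewrite mulrDr; exact: ext_addl.
- by move=> b m n; exact: ext_addr.
- by move=> b c m; rewrite mulrA; exact: ext_bal.
Qed.

Definition ext_zero_el : ext := ext_cls [::].
Definition ext_add (x y : ext) : ext := ext_cls (repr x ++ repr y).
Definition ext_scale a (x : ext) : ext := ext_cls (ext_scale_seq a (repr x)).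
Definition ext_opp (x : ext) : ext := ext_scale (-1) x.

Lemma ext_add_cls s t : ext_add (ext_cls s) (ext_cls t) = ext_cls (s ++ t).
Proof. by apply: ext_clsP; apply: ext_cat; exact: ext_repr_cls. Qed.

Lemma ext_scale_cls a s : ext_scale a (ext_cls s) = ext_cls (ext_scale_seq a s).
Proof. by apply: ext_clsP; apply: ext_scale_rel; exact: ext_repr_cls. Qed.

Lemma ext_addA : associative ext_add.
Proof.
move=> x y z; rewrite -(ext_cls_repr x) -(ext_cls_repr y) -(ext_cls_repr z).
by rewrite !ext_add_cls catA.
Qed.

Lemma ext_addC : commutative ext_add.
Proof.
move=> x y; rewrite -(ext_cls_repr x) -(ext_cls_repr y).
by rewrite !ext_add_cls; apply: ext_clsP; exact: ext_catC.
Qed.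

Lemma ext_add0 : left_id ext_zero_el ext_add.
Proof. by move=> x; rewrite -(ext_cls_repr x) ext_add_cls. Qed.

Lemma ext_scaleDl_seq a b s :
  ext_rel (ext_scale_seq (a + b) s) (ext_scale_seq a s ++ ext_scale_seq b s).
Proof.
elim: s => [|[c m] s IHs] /=; first exact: ext_refl.
apply: (@ext_trans _ ([:: (a * c, m); (b * c, m)] ++
                      (ext_scale_seq a s ++ ext_scale_seq b s))).
  rewrite mulrDl -[_ :: _]/([:: (a * c + b * c, m)] ++ ext_scale_seq (a + b) s).
  by apply: ext_cat IHs; exact: ext_addl.
rewrite -[(a * c, m) :: _ in X in ext_rel _ X]/([:: (a * c, m)] ++ (ext_scale_seq a s ++ _)).
rewrite -[_ ++ _]/([:: (a * c, m)] ++
  (([:: (b * c, m)] ++ ext_scale_seq a s) ++ ext_scale_seq b s)).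
apply: ext_cat; first exact: ext_refl.
rewrite -[_ :: ext_scale_seq b s]/([:: (b * c, m)] ++ ext_scale_seq b s).
by rewrite catA; apply: ext_cat; [exact: ext_catC | exact: ext_refl].
Qed.

Lemma ext_scaleDl x : {morph ext_scale^~ x : a b / a + b >-> ext_add a b}.
Proof.
move=> a b; rewrite -(ext_cls_repr x) !ext_scale_cls ext_add_cls.
by apply: ext_clsP; exact: ext_scaleDl_seq.
Qed.

Lemma ext_scaleDr : right_distributive ext_scale ext_add.
Proof.
move=> a x y; rewrite -(ext_cls_repr x) -(ext_cls_repr y).
by rewrite !(ext_add_cls, ext_scale_cls) /ext_scale_seq map_cat.
Qed.

Lemma ext_scaleA a b x : ext_scale a (ext_scale b x) = ext_scale (a * b) x.
Proof.
rewrite -(ext_cls_repr x) !ext_scale_cls; congr ext_cls.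
by rewrite /ext_scale_seq -map_comp; apply: eq_map => y /=; rewrite mulrA.
Qed.

Lemma ext_scale1 : left_id 1 ext_scale.
Proof.
move=> x; rewrite -(ext_cls_repr x) ext_scale_cls; congr ext_cls.
by rewrite -[RHS]map_id; apply: eq_map => -[a m] /=; rewrite mul1r.
Qed.

Lemma ext_scale0 x : ext_scale 0 x = ext_zero_el.
Proof.
rewrite -(ext_cls_repr x) ext_scale_cls; apply: ext_clsP.
elim: (repr x) => [|[a m] s IHs] /=; first exact: ext_refl.
rewrite mul0r; apply: (ext_cat (s := [:: _]) (s' := [::])) IHs.
exact: ext_zero.
Qed.

Lemma ext_addN : left_inverse ext_zero_el ext_opp ext_add.
Proof.
move=> x; rewrite /ext_opp -[x in ext_add _ x]ext_scale1 -ext_scaleDl addNr.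
exact: ext_scale0.
Qed.

HB.instance Definition _ :=
  GRing.isZmodule.Build ext ext_addA ext_addC ext_add0 ext_addN.
HB.instance Definition _ := GRing.Zmodule_isLmodule.Build A ext
  ext_scaleA ext_scale1 ext_scaleDr ext_scaleDl.

Definition ptensor (a : A) (m : M) : ext := ext_cls [:: (a, m)].

Lemma pureDl m : {morph ptensor^~ m : a b / a + b}.
Proof.
by move=> a b; rewrite [RHS]ext_add_cls; apply: ext_clsP; exact: ext_addl.
Qed.

Lemma pureDr a : {morph ptensor a : m n / m + n}.
Proof.
by move=> m n; rewrite [RHS]ext_add_cls; apply: ext_clsP; exact: ext_addr.
Qed.

Lemma pureZ a c m : ptensor a (c *: m) = ptensor (a * f c) m.
Proof. by apply/esym/ext_clsP; exact: ext_bal. Qed.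

Lemma scale_pure a b m : a *: ptensor b m = ptensor (a * b) m.
Proof. exact: ext_scale_cls. Qed.

Lemma pure0 a : ptensor a 0 = 0.
Proof. by apply: (addIr (ptensor a 0)); rewrite -pureDr !add0r. Qed.

Lemma ext_ind (P : ext -> Prop) :
  (forall a m, P (ptensor a m)) -> P 0 -> (forall x y, P x -> P y -> P (x + y)) ->
  forall x, P x.
Proof.
move=> Pp P0 PD x; rewrite -(ext_cls_repr x).
elim: (repr x) => [//|[a m] s IHs].
have -> : ext_cls ((a, m) :: s) = ptensor a m + ext_cls s by rewrite [RHS]ext_add_cls.
exact: PD.
Qed.

(* The A-linear map A (x)_S M -> N, a (x) m |-> a h(m), attached to an
   f-semilinear map h : M -> N. *)
Section Lift.
Context (N : lmodType A) (h : {linear M -> N | f \; *:%R}).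

Definition ext_lift_seq s : N := \sum_(x <- s) x.1 *: h x.2.

Lemma ext_lift_rel s t : ext_rel s t -> ext_lift_seq s = ext_lift_seq t.
Proof.
rewrite /ext_lift_seq; elim=> {s t} //=.
- by move=> s t u _ -> _ ->.
- by move=> s s' t t' _ es _ et; rewrite !big_cat /= es et.
- by move=> s t; rewrite !big_cat /= addrC.
- by move=> m; rewrite big_seq1 big_nil /= scale0r.
- by move=> a b m; rewrite !big_cons !big_nil /= !addr0 scalerDl.
- by move=> a m n; rewrite !big_cons !big_nil /= !addr0 linearD scalerDr.
- by move=> a c m; rewrite !big_cons !big_nil /= !addr0 linearZ /= scalerA.
Qed.

Definition ext_lift (x : ext) : N := ext_lift_seq (repr x).

Lemma ext_lift_cls s : ext_lift (ext_cls s) = ext_lift_seq s.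
Proof. exact/ext_lift_rel/ext_repr_cls. Qed.

Lemma ext_lift_pure a m : ext_lift (ptensor a m) = a *: h m.
Proof. by rewrite ext_lift_cls /ext_lift_seq big_seq1. Qed.

Lemma ext_lift_is_linear : linear ext_lift.
Proof.
move=> a x y; rewrite -(ext_cls_repr x) -(ext_cls_repr y).
have -> : a *: ext_cls (repr x) + ext_cls (repr y) =
          ext_cls (ext_scale_seq a (repr x) ++ repr y).
  by rewrite -ext_add_cls -ext_scale_cls.
rewrite !ext_lift_cls /ext_lift_seq big_cat big_map /= scaler_sumr.
by congr (_ + _); apply: eq_bigr => z _; rewrite scalerA.
Qed.

HB.instance Definition _ :=
  GRing.isLinear.Build A ext N *:%R ext_lift ext_lift_is_linear.

End Lift.

End ExtDef.

Definition restr (S B : pzRingType) (g : {rmorphism S -> B}) (N : lmodType B) :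
  Type := N.

Section Restr.
Context (S B : pzRingType) (g : {rmorphism S -> B}) (N : lmodType B).

HB.instance Definition _ := GRing.Zmodule.on (restr g N).

Definition restr_scale (c : S) (x : restr g N) : restr g N := g c *: (x : N).

Lemma restr_scaleA a b x : restr_scale a (restr_scale b x) = restr_scale (a * b) x.
Proof. by rewrite /restr_scale scalerA rmorphM. Qed.
Lemma restr_scale1 : left_id 1 restr_scale.
Proof. by move=> x; rewrite /restr_scale rmorph1 scale1r. Qed.
Lemma restr_scaleDr : right_distributive restr_scale +%R.
Proof. by move=> a x y; rewrite /restr_scale scalerDr. Qed.
Lemma restr_scaleDl x : {morph restr_scale^~ x : a b / a + b}.
Proof. by move=> a b; rewrite /restr_scale rmorphD scalerDl. Qed.

HB.instance Definition _ := GRing.Zmodule_isLmodule.Build S (restr g N)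
  restr_scaleA restr_scale1 restr_scaleDr restr_scaleDl.

End Restr.

(* The S-algebra A (x)_S B. *)
Section TensDef.
Context (S A B : comPzRingType) (f : {rmorphism S -> A}) (g : {rmorphism S -> B}).

Definition tens := ext f (restr g B^o).

HB.instance Definition _ := GRing.Lmodule.on tens.

Definition tpure (a : A) (b : B) : tens := ptensor f a (b : restr g B^o).

Lemma tpure_bal a c b : tpure a (g c * b) = tpure (a * f c) b.
Proof. by rewrite /tpure -pureZ. Qed.

Definition tens_mulr_fun (b : B) (b' : restr g B^o) : tens := tpure 1 (b * b').

Lemma tens_mulr_fun_linear b : linear_for (f \; *:%R) (tens_mulr_fun b).
Proof.
move=> c x y; rewrite /tens_mulr_fun /=.
rewrite -[c *: x]/(g c * (x : B)) mulrDr mulrCA.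
by rewrite [LHS]pureDr -/(tpure _ _) tpure_bal mul1r [in RHS]scale_pure mulr1.
Qed.

HB.instance Definition _ b := GRing.isLinear.Build S (restr g B^o) tens
  (f \; *:%R) (tens_mulr_fun b) (tens_mulr_fun_linear b).

Definition tens_mulr (b : B) (y : tens) : tens := ext_lift (tens_mulr_fun b) y.

Lemma tens_mulr_pure b a' b' : tens_mulr b (tpure a' b') = tpure a' (b * b').
Proof. by rewrite /tens_mulr ext_lift_pure scale_pure mulr1. Qed.

Lemma tens_mulr_is_linear b : linear (tens_mulr b).
Proof. by move=> a x y; rewrite /tens_mulr linearP. Qed.

HB.instance Definition _ b := GRing.isLinear.Build A tens tens
  *:%R (tens_mulr b) (tens_mulr_is_linear b).

Lemma tens_mulrD b x y : tens_mulr b (x + y) = tens_mulr b x + tens_mulr b y.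
Proof. exact: linearD. Qed.

Definition tens_mul_fun (y : tens) (b : restr g B^o) : tens := tens_mulr b y.

Lemma tens_mul_fun_linear y : linear_for (f \; *:%R) (tens_mul_fun y).
Proof.
move=> c b b'; rewrite /tens_mul_fun /= -[c *: b]/(g c * (b : B)).
elim/ext_ind: y => [a m|/=|x y IHx IHy].
- rewrite -[ptensor _ _ _]/(tpure a m) !tens_mulr_pure mulrDl [LHS]pureDr.
  by rewrite -/(tpure _ _) -mulrA tpure_bal [in RHS]scale_pure mulrC.
- by rewrite !linear0 addr0.
- by rewrite !tens_mulrD IHx IHy scalerDr addrACA.
Qed.

HB.instance Definition _ y := GRing.isLinear.Build S (restr g B^o) tens
  (f \; *:%R) (tens_mul_fun y) (tens_mul_fun_linear y).

Definition tens_mul (x y : tens) : tens := ext_lift (tens_mul_fun y) x.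
Definition tens_one : tens := tpure 1 1.

Lemma tens_mul_pure a b a' b' :
  tens_mul (tpure a b) (tpure a' b') = tpure (a * a') (b * b').
Proof.
by rewrite /tens_mul ext_lift_pure /= /tens_mul_fun tens_mulr_pure scale_pure.
Qed.

Lemma tens_mulDl : left_distributive tens_mul +%R.
Proof. by move=> x y z; rewrite /tens_mul linearD. Qed.

Lemma tens_mul0l y : tens_mul 0 y = 0.
Proof. by rewrite /tens_mul linear0. Qed.

Lemma tens_mulDr : right_distributive tens_mul +%R.
Proof.
move=> x y z; elim/ext_ind: x => [a b||x x' IHx IHx'].
- by rewrite /tens_mul !ext_lift_pure /= /tens_mul_fun tens_mulrD scalerDr.
- by rewrite !tens_mul0l addr0.
- by rewrite !tens_mulDl IHx IHx' addrACA.
Qed.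

Lemma tens_mulC : commutative tens_mul.
Proof.
have mul0r' x : tens_mul x 0 = 0.
  by apply: (addIr (tens_mul x 0)); rewrite -tens_mulDr !add0r.
move=> x y; elim/ext_ind: x => [a b||x x' IHx IHx'].
- elim/ext_ind: y => [a' b'||y y' IHy IHy'].
  + by rewrite -!/(tpure _ _) !tens_mul_pure mulrC [b * _]mulrC.
  + by rewrite tens_mul0l mul0r'.
  + by rewrite tens_mulDl tens_mulDr IHy IHy'.
- by rewrite tens_mul0l mul0r'.
- by rewrite tens_mulDl tens_mulDr IHx IHx'.
Qed.

Lemma tens_mulA : associative tens_mul.
Proof.
have mul0r' x : tens_mul x 0 = 0 by rewrite tens_mulC tens_mul0l.
move=> x y z; elim/ext_ind: x => [a b||x x' IHx IHx'].
- elim/ext_ind: y => [a' b'||y y' IHy IHy'].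
  + elim/ext_ind: z => [a'' b''||z z' IHz IHz'].
    * by rewrite -!/(tpure _ _) !tens_mul_pure !mulrA.
    * by rewrite !mul0r'.
    * by rewrite !tens_mulDr IHz IHz'.
  + by rewrite tens_mul0l mul0r' tens_mul0l.
  + by rewrite tens_mulDl !tens_mulDr tens_mulDl IHy IHy'.
- by rewrite !tens_mul0l.
- by rewrite !tens_mulDl IHx IHx'.
Qed.

Lemma tens_mul1 : left_id tens_one tens_mul.
Proof.
move=> x; elim/ext_ind: x => [a b||x x' IHx IHx'].
- by rewrite -!/(tpure _ _) tens_mul_pure !mul1r.
- by rewrite tens_mulC tens_mul0l.
- by rewrite tens_mulDr IHx IHx'.
Qed.

HB.instance Definition _ := GRing.Zmodule_isComPzRing.Build tens
  tens_mulA tens_mulC tens_mul1 tens_mulDl.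

Lemma tpureDr a : {morph tpure a : b b' / b + b'}.
Proof. by move=> b b'; apply: (@pureDr _ _ f (restr g B^o)). Qed.

Lemma tpureM a b a' b' : tpure a b * tpure a' b' = tpure (a * a') (b * b').
Proof. exact: tens_mul_pure. Qed.

Lemma tens_ind (P : tens -> Prop) :
  (forall a b, P (tpure a b)) -> P 0 -> (forall x y, P x -> P y -> P (x + y)) ->
  forall x, P x.
Proof. by move=> Pp P0 PD x; elim/ext_ind: x. Qed.

End TensDef.

(* The ring homomorphism id (x) h : A (x)_S B -> A (x)_S B'. *)
Section TensMap.
Context (S A B B' : comPzRingType).
Context (f : {rmorphism S -> A}) (g : {rmorphism S -> B}) (g' : {rmorphism S -> B'}).
Context (h : {rmorphism B -> B'}) (hg : forall c, h (g c) = g' c).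

Definition tens_map_fun of (forall c, h (g c) = g' c) :=
  fun b : restr g B^o => tpure f g' 1 (h b).

Lemma tens_map_fun_linear : linear_for (f \; *:%R) (tens_map_fun hg).
Proof.
move=> c b b'; rewrite /tens_map_fun /= -[c *: b]/(g c * (b : B)).
rewrite rmorphD rmorphM hg tpureDr tpure_bal mul1r.
by rewrite [in RHS]scale_pure mulr1.
Qed.

HB.instance Definition _ := GRing.isLinear.Build S (restr g B^o) (tens f g')
  (f \; *:%R) (tens_map_fun hg) tens_map_fun_linear.

Definition tens_map (x : tens f g) : tens f g' := ext_lift (tens_map_fun hg) x.

Lemma tens_map_pure a b : tens_map (tpure f g a b) = tpure f g' a (h b).
Proof. by rewrite /tens_map ext_lift_pure /= scale_pure mulr1. Qed.

Lemma tens_map_zmod : zmod_morphism tens_map.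
Proof. by move=> x y; rewrite /tens_map linearB. Qed.

HB.instance Definition _ :=
  GRing.isZmodMorphism.Build (tens f g) (tens f g') tens_map tens_map_zmod.

Lemma tens_mapD x y : tens_map (x + y) = tens_map x + tens_map y.
Proof. exact: raddfD. Qed.

Lemma tens_map0 : tens_map 0 = 0.
Proof. exact: raddf0. Qed.

Lemma tens_map_monoid : monoid_morphism tens_map.
Proof.
split=> [|x y]; first by rewrite tens_map_pure rmorph1.
elim/tens_ind: x => [a b||x x' IHx IHx'].
- elim/tens_ind: y => [a' b'||y y' IHy IHy'].
  + by rewrite tpureM !tens_map_pure tpureM rmorphM.
  + by rewrite mulr0 !tens_map0 mulr0.
  + by rewrite mulrDr !tens_mapD mulrDr IHy IHy'.
- by rewrite mul0r !tens_map0 mul0r.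
- by rewrite mulrDl !tens_mapD mulrDl IHx IHx'.
Qed.

HB.instance Definition _ :=
  GRing.isMonoidMorphism.Build (tens f g) (tens f g') tens_map tens_map_monoid.

End TensMap.

(* K((z)), a Laurent series being given by its coefficients. *)
Record laurent (K : comPzRingType) := Laurent {
  lcoef :> int -> K;
  lcoef_bounded : exists N : int, forall n : int, n < N -> lcoef n = 0
}.

HB.instance Definition _ (K : comPzRingType) := gen_eqMixin (laurent K).
HB.instance Definition _ (K : comPzRingType) := gen_choiceMixin (laurent K).

Section LaurentRing.
Context (K : comPzRingType).
Implicit Types x y t : laurent K.

Lemma laurent_eq x y : (forall n, x n = y n) -> x = y.
Proof.
case: x y => [x xP] [y yP] /= /funext exy; case: y / exy yP => yP.
by rewrite (Prop_irrelevance xP yP).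
Qed.

Lemma laurent_bound x y : exists N : nat,
  forall n : int, n < - N%:Z -> x n = 0 /\ y n = 0.
Proof.
case: (lcoef_bounded x) (lcoef_bounded y) => [N xN] [N' yN'].
exists (`|N| + `|N'|)%N => n nN; split; [apply: xN | apply: yN']; lia.
Qed.

Lemma ladd_bounded x y : exists N : int, forall n, n < N -> x n + y n = 0.
Proof.
by have [N xyN] := laurent_bound x y; exists (- N%:Z) => n /xyN[-> ->]; rewrite addr0.
Qed.

Lemma lopp_bounded x : exists N : int, forall n, n < N -> - x n = 0.
Proof. by case: (lcoef_bounded x) => N xN; exists N => n /xN->; rewrite oppr0. Qed.

Lemma lconst_bounded (c : K) (k : int) :
  exists N : int, forall n : int, n < N -> (if n == k then c else 0) = 0.
Proof. by exists k => n nk; rewrite lt_eqF. Qed.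

Lemma lmul_bounded x y : exists N : int, forall n : int, n < N ->
  \sum_(i \in [set: int]) x i * y (n - i) = 0.
Proof.
have [N xyN] := laurent_bound x y; exists (- (N + N)%N%:Z) => n nN.
apply: fsbig1 => i _; have [iN|iN] := ltP i (- N%:Z).
  by rewrite (xyN i iN).1 mul0r.
by rewrite (xyN (n - i) _).2 ?mulr0 //; lia.
Qed.

Definition ladd x y := Laurent (ladd_bounded x y).
Definition lopp x := Laurent (lopp_bounded x).
Definition lmul x y := Laurent (lmul_bounded x y).
(* c z^k *)
Definition lmonom (c : K) (k : int) := Laurent (lconst_bounded c k).

Lemma lmul_window (x y : int -> K) (n a : int) (m : nat) :
  (forall i : int, i < a -> x i = 0) ->
  (forall i : int, a + m%:Z <= i -> y (n - i) = 0) ->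
  \sum_(i \in [set: int]) x i * y (n - i) =
  \sum_(j < m) x (a + j%:Z) * y (n - (a + j%:Z)).
Proof.
move=> xa ya; pose r := [seq a + j%:Z | j <- iota 0 m].
rewrite (fsbigE r) //; last first.
- move=> i _ ir; have [/xa->|ai] := ltP i a; first by rewrite mul0r.
  have [/ya->|im] := leP (a + m%:Z) i; first by rewrite mulr0.
  case/negP: ir; apply/mapP; exists `|i - a|%N; last lia.
  by rewrite mem_iota; lia.
- rewrite map_inj_uniq ?iota_uniq // => j j'; lia.
rewrite big_map -[in RHS](big_mkord xpredT (fun j => x (a + j%:Z) * y (n - (a + j%:Z)))).
by rewrite /index_iota subn0; apply: eq_bigl => j; rewrite in_setT.
Qed.

Lemma laddA : associative ladd.
Proof. by move=> x y t; apply: laurent_eq => n /=; rewrite addrA. Qed.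
Lemma laddC : commutative ladd.
Proof. by move=> x y; apply: laurent_eq => n /=; rewrite addrC. Qed.
Lemma ladd0 : left_id (lmonom 0 0) ladd.
Proof. by move=> x; apply: laurent_eq => n /=; rewrite if_same add0r. Qed.
Lemma laddN : left_inverse (lmonom 0 0) lopp ladd.
Proof. by move=> x; apply: laurent_eq => n /=; rewrite if_same addNr. Qed.

HB.instance Definition _ :=
  GRing.isZmodule.Build (laurent K) laddA laddC ladd0 laddN.

Lemma lmulC : commutative lmul.
Proof.
move=> x y; apply: laurent_eq => n /=.
have [N xyN] := laurent_bound x y.
pose m := absz (n + (N + N)%N%:Z + 1).
have [nN|nN] := ltP n (- (N + N)%N%:Z).
  rewrite !fsbig1 // => i _; have [iN|iN] := ltP i (- N%:Z).
  - by rewrite (xyN i iN).2 mul0r.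
  - by rewrite (xyN (n - i) _).1 ?mulr0 //; lia.
  - by rewrite (xyN i iN).1 mul0r.
  - by rewrite (xyN (n - i) _).2 ?mulr0 //; lia.
rewrite (@lmul_window _ _ _ (- N%:Z) m); first last.
- by move=> i im; apply: (xyN _ _).2; rewrite /m in im; lia.
- by move=> i /xyN[].
rewrite (@lmul_window _ _ _ (- N%:Z) m); first last.
- by move=> i im; apply: (xyN _ _).1; rewrite /m in im; lia.
- by move=> i /xyN[].
rewrite (reindex_inj rev_ord_inj) /=; apply: eq_bigr => j _.
have jm := ltn_ord j; rewrite mulrC; congr (_ * _); congr lcoef; rewrite /m in jm *; lia.
Qed.

Lemma lmulDl : left_distributive lmul ladd.
Proof.
move=> x y t; apply: laurent_eq => n /=.
have [N xyN] := laurent_bound x y; have [N' tN'] := laurent_bound t t.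
pose m := absz (n + (N + N')%N%:Z + 1).
have tm i : - N%:Z + m%:Z <= i -> t (n - i) = 0.
  by move=> im; apply: (tN' _ _).1; rewrite /m in im; lia.
rewrite !(@lmul_window _ _ _ (- N%:Z) m) //; first last.
- by move=> i /xyN[->->]; rewrite addr0.
- by move=> i /xyN[].
- by move=> i /xyN[].
by rewrite -big_split /=; apply: eq_bigr => j _; rewrite mulrDl.
Qed.

Lemma lmonomM (c : K) k x n : lmul (lmonom c k) x n = c * x (n - k).
Proof.
rewrite /= (fsbigE [:: k]) //=; last first.
  by move=> i _; rewrite inE => /negPf->; rewrite mul0r.
by rewrite big_cons big_nil in_setT addr0 eqxx.
Qed.

Lemma lmul1 : left_id (lmonom 1 0) lmul.
Proof. by move=> x; apply: laurent_eq => n; rewrite lmonomM mul1r subr0. Qed.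

Lemma lmulA : associative lmul.
Proof.
move=> x y t; apply: laurent_eq => n /=.
have [N xyN] := laurent_bound x y; have [N' tN'] := laurent_bound t t.
pose m := absz (n + (N + N + N')%N%:Z + 1).
have mE : n + (N + N + N')%N%:Z < m%:Z by rewrite /m; lia.
have yt0 k : k < - (N + N')%N%:Z -> lmul y t k = 0.
  move=> kN; rewrite /= fsbig1 // => i _; have [iN|iN] := ltP i (- N%:Z).
    by rewrite (xyN i iN).2 mul0r.
  by rewrite (tN' (k - i) _).1 ?mulr0 //; lia.
have xy0 k : k < - (N + N)%N%:Z -> lmul x y k = 0.
  move=> kN; rewrite /= fsbig1 // => i _; have [iN|iN] := ltP i (- N%:Z).
    by rewrite (xyN i iN).1 mul0r.
  by rewrite (xyN (k - i) _).2 ?mulr0 //; lia.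
rewrite -[LHS]/(\sum_(i \in [set: int]) x i * lmul y t (n - i)).
rewrite -[RHS]/(\sum_(i \in [set: int]) lmul x y i * t (n - i)).
rewrite (@lmul_window _ (lmul y t) _ (- N%:Z) m); first last.
- by move=> i im; apply: yt0; lia.
- by move=> i /xyN[].
rewrite (@lmul_window (lmul x y) _ _ (- (N + N)%N%:Z) m); first last.
- by move=> i im; apply: (tN' _ _).1; lia.
- exact: xy0.
transitivity (\sum_(i < m) \sum_(j < m) x (- N%:Z + i%:Z) *
   (y (- (N + N)%N%:Z + j%:Z - (- N%:Z + i%:Z)) * t (n - (- (N + N)%N%:Z + j%:Z)))).
  apply: eq_bigr => i _; rewrite -mulr_sumr; congr (_ * _).
  rewrite /= (@lmul_window _ _ _ (- N%:Z - i%:Z) m); first last.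
  - by move=> j jm; apply: (tN' _ _).1; lia.
  - by move=> j jm; apply: (xyN _ _).2; lia.
  by apply: eq_bigr => j _; congr (y _ * t _); lia.
rewrite exchange_big /=; apply: eq_bigr => j _.
rewrite (@lmul_window _ _ _ (- N%:Z) m); first last.
- by move=> i im; apply: (xyN _ _).2; have := ltn_ord j; lia.
- by move=> i /xyN[].
by rewrite mulr_suml; apply: eq_bigr => i _; rewrite mulrA.
Qed.

HB.instance Definition _ := GRing.Zmodule_isComPzRing.Build (laurent K)
  lmulA lmulC lmul1 lmulDl.

Lemma lcoefD x y n : (x + y) n = x n + y n. Proof. by []. Qed.
Lemma lcoefN x n : (- x) n = - x n. Proof. by []. Qed.
Lemma lcoef0 n : (0 : laurent K) n = 0. Proof. by rewrite /= if_same. Qed.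
Lemma lcoef1 n : (1 : laurent K) n = if n == 0 then 1 else 0. Proof. by []. Qed.
Lemma lcoefM x y n : (x * y) n = \sum_(i \in [set: int]) x i * y (n - i).
Proof. by []. Qed.

(* The subring K[[z]] of K((z)). *)
Definition integral : pred (laurent K) :=
  fun x => `[< forall n : int, n < 0 -> x n = 0 >].

Lemma integral_subring : subring_closed integral.
Proof.
split.
- by apply/asboolP => n n0; rewrite lcoef1 lt_eqF.
- move=> x y /asboolP x0 /asboolP y0; apply/asboolP => n n0.
  by rewrite lcoefD lcoefN x0 // y0 // subr0.
- move=> x y /asboolP x0 /asboolP y0; apply/asboolP => n n0.
  rewrite lcoefM fsbig1 // => i _; have [i0|i0] := ltP i 0.
    by rewrite x0 // mul0r.
  by rewrite (y0 (n - i)) ?mulr0 //; lia.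
Qed.

Record powser := PowSer { psval :> laurent K; _ : psval \in integral }.

HB.instance Definition _ := [isSub for psval].
HB.instance Definition _ := [Choice of powser by <:].
HB.instance Definition _ := 
  GRing.SubChoice_isSubComPzRing.Build (laurent K) integral powser integral_subring.
HB.instance Definition _ := GRing.RMorphism.copy psval (val : powser -> laurent K).
End LaurentRing.

Section LaurentMap.
Context (K K' : comPzRingType) (h : {rmorphism K -> K'}).

Lemma laurent_map_bounded (x : laurent K) :
  exists N : int, forall n : int, n < N -> h (x n) = 0.
Proof. by case: (lcoef_bounded x) => N xN; exists N => n /xN->; rewrite rmorph0. Qed.

Definition laurent_map (x : laurent K) := Laurent (laurent_map_bounded x).

Lemma laurent_map_zmod : zmod_morphism laurent_map.
Proof. by move=> x y; apply: laurent_eq => n; rewrite /= rmorphB. Qed.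

HB.instance Definition _ := GRing.isZmodMorphism.Build (laurent K) (laurent K')
  laurent_map laurent_map_zmod.

Lemma laurent_map_monoid : monoid_morphism laurent_map.
Proof.
split=> [|x y]; apply: laurent_eq => n.
  by rewrite /= (fun_if h) rmorph1 rmorph0.
have [N xyN] := laurent_bound x y.
pose m := absz (n + (N + N)%N%:Z + 1).
rewrite -[LHS]/(h (\sum_(i \in [set: int]) x i * y (n - i))).
rewrite -[RHS]/(\sum_(i \in [set: int]) laurent_map x i * laurent_map y (n - i)).
rewrite (@lmul_window K x y n (- N%:Z) m); first last.
- by move=> i im; apply: (xyN _ _).2; rewrite /m in im; lia.
- by move=> i /xyN[].
rewrite (@lmul_window K' (laurent_map x) (laurent_map y) n (- N%:Z) m); first last.
- by move=> i im /=; rewrite (xyN _ _).2 ?rmorph0 //; rewrite /m in im; lia.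
- by move=> i /xyN[/= -> _]; rewrite rmorph0.
by rewrite rmorph_sum /=; apply: eq_bigr => j _; rewrite rmorphM.
Qed.

HB.instance Definition _ := GRing.isMonoidMorphism.Build (laurent K) (laurent K')
  laurent_map laurent_map_monoid.

End LaurentMap.

Local Open Scope classical_set_scope.

Definition is_ideal (R : comPzRingType) (I : set R) : Prop :=
  [/\ I 0, forall x y, I x -> I y -> I (x + y) & forall a x, I x -> I (a * x)].

Definition noetherian (R : comPzRingType) : Prop :=
  forall I : set R, is_ideal I -> exists (n : nat) (g : 'I_n -> R),
    I = [set x | exists a : 'I_n -> R, x = \sum_i a i * g i].

(* R[xi^-1], as a subring of the fraction field of R. *)
Section Away.
Context (R : idomainType) (xi : R).

Definition away_pred : pred {fraction R} :=
  fun x => `[< exists (a : R) (n : nat), x = tofrac a / tofrac xi ^+ n >].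

Lemma away_pred_tofrac a : away_pred (tofrac a).
Proof. by apply/asboolP; exists a, 0%N; rewrite expr0 divr1. Qed.

Lemma away_pred_subring : subring_closed away_pred.
Proof.
have [xi0|xi0] := eqVneq xi 0.
  have awayP x : x \in away_pred -> exists a, x = tofrac a.
    move=> /asboolP[a [[|n] ->]]; first by exists a; rewrite expr0 divr1.
    by exists 0; rewrite xi0 tofrac0 expr0n invr0 mulr0.
  split; first by rewrite -tofrac1; exact: away_pred_tofrac.
  - by move=> _ _ /awayP[a ->] /awayP[b ->]; rewrite -tofracB; exact: away_pred_tofrac.
  - by move=> _ _ /awayP[a ->] /awayP[b ->]; rewrite -tofracM; exact: away_pred_tofrac.
have xiF n : tofrac xi ^+ n != 0 by rewrite expf_neq0 // tofrac_eq0.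
split; first by rewrite -tofrac1; exact: away_pred_tofrac.
- move=> _ _ /asboolP[a [n ->]] /asboolP[b [m ->]]; apply/asboolP.
  exists (a * xi ^+ m - b * xi ^+ n), (n + m)%N.
  rewrite tofracB !tofracM !tofracXn exprD mulrBl; congr (_ - _).
    by rewrite -mulf_div divff ?mulr1.
  by rewrite [X in _ = _ / X]mulrC -mulf_div divff ?mulr1.
- move=> _ _ /asboolP[a [n ->]] /asboolP[b [m ->]]; apply/asboolP.
  by exists (a * b), (n + m)%N; rewrite tofracM exprD mulf_div.
Qed.

Record away := Away { away_val :> {fraction R}; _ : away_val \in away_pred }.

HB.instance Definition _ := [isSub for away_val].
HB.instance Definition _ := [Choice of away by <:].
HB.instance Definition _ := GRing.SubChoice_isSubComNzRing.Build
  {fraction R} away_pred away away_pred_subring.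

Definition to_away (a : R) : away := Away (away_pred_tofrac a).

Lemma to_away_zmod : zmod_morphism to_away.
Proof. by move=> a b; apply: val_inj; rewrite /= tofracB. Qed.
Lemma to_away_monoid : monoid_morphism to_away.
Proof. by split=> [|a b]; apply: val_inj; rewrite /= ?tofrac1 ?tofracM. Qed.

HB.instance Definition _ := GRing.isZmodMorphism.Build R away to_away to_away_zmod.
HB.instance Definition _ := GRing.isMonoidMorphism.Build R away to_away to_away_monoid.

End Away.

(* The Frobenius x |-> x^q of an F_q-algebra, given by its structure map. *)
Section Frobenius.
Context (Fq : finFieldType) (R : comNzRingType) (iota : {rmorphism Fq -> R}).

Definition frobq_of of {rmorphism Fq -> R} := fun x : R => x ^+ #|Fq|.
Local Notation frobq := (frobq_of iota).

Lemma frobq_monoid : monoid_morphism frobq.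
Proof. by split=> [|x y]; rewrite /frobq_of ?expr1n // exprMn. Qed.

Lemma card_pchar : [pchar R].-nat #|Fq|.
Proof.
have [p p_pr pFq] := finPcharP Fq.
by rewrite (card_pprimeChar pFq) pnatX pnatE // (rmorph_pchar iota pFq).
Qed.

Lemma frobq_zmod : zmod_morphism frobq.
Proof.
move=> x y; apply: (addIr (frobq y)); rewrite /frobq_of.
by rewrite -(exprDn_pchar _ _ card_pchar) !subrK.
Qed.

HB.instance Definition _ := GRing.isZmodMorphism.Build R R frobq frobq_zmod.
HB.instance Definition _ := GRing.isMonoidMorphism.Build R R frobq frobq_monoid.

Lemma frobq_iota c : frobq (iota c) = iota c.
Proof. by rewrite /frobq_of -rmorphXn expf_card. Qed.

End Frobenius.

Section Modules.
Context (E : comPzRingType).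

Definition finitely_generated (M : lmodType E) : Prop :=
  exists (n : nat) (g : 'I_n -> M),
    forall x : M, exists a : 'I_n -> E, x = \sum_i a i *: g i.

Definition projective (M : lmodType E) : Prop :=
  forall (N P : lmodType E) (p : {linear N -> P}) (f : {linear M -> P}),
    (forall y, exists x, p x = y) ->
    exists h : {linear M -> N}, forall x, p (h x) = f x.

End Modules.

Record taumod (E : comPzRingType) (s : {rmorphism E -> E}) := TauMod {
  taumod_car :> lmodType E;
  tau : {linear taumod_car -> taumod_car | s \; *:%R}
}.
Arguments tau {E s} M : rename.

(* The linearization s^*M -> M, e (x) m |-> e tau(m). *)
Definition linearization (E : comPzRingType) (s : {rmorphism E -> E})
  (M : taumod s) (x : ext s M) : M := ext_lift (tau M) x.
Arguments linearization {E s} M x.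

Record isocrystal (E : comPzRingType) (s : {rmorphism E -> E}) := Isocrystal {
  isocrystal_taumod :> taumod s;
  isocrystal_fg : finitely_generated isocrystal_taumod;
  isocrystal_proj : projective isocrystal_taumod;
  isocrystal_lin : bijective (linearization isocrystal_taumod)
}.

(* The base change E' (x)_E M, with tau(e (x) m) = s'(e) (x) tau(m). *)
Section BaseChange.
Context (E E' : comPzRingType).
Context (s : {rmorphism E -> E}) (s' : {rmorphism E' -> E'}).
Context (phi : {rmorphism E -> E'}) (phis : forall e, s' (phi e) = phi (s e)).

Section Tau.
Context (M : taumod s).
Local Notation M' := (ext phi M).

Definition bc_tau0 of (forall e, s' (phi e) = phi (s e)) :=
  fun m : M => ptensor phi 1 (tau M m) : restr s' M'.

Lemma bc_tau0_linear : linear_for (phi \; *:%R) (bc_tau0 phis).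
Proof.
move=> c x y; rewrite /bc_tau0 linearP pureDr pureZ mul1r /=.
by rewrite -[_ *: (_ : restr _ _)]/(s' (phi c) *: ptensor phi 1 (tau M x)) scale_pure mulr1 phis.
Qed.

HB.instance Definition _ := GRing.isLinear.Build E M (restr s' M')
  (phi \; *:%R) (bc_tau0 phis) bc_tau0_linear.

Definition bc_tau of (forall e, s' (phi e) = phi (s e)) :=
  fun x : M' => ext_lift (bc_tau0 phis) x : M'.

Lemma bc_tau_linear : linear_for (s' \; *:%R) (bc_tau phis).
Proof. by move=> a x y; rewrite /bc_tau linearP. Qed.

HB.instance Definition _ := GRing.isLinear.Build E' M' M'
  (s' \; *:%R) (bc_tau phis) bc_tau_linear.

Definition bc_taumod : taumod s' := TauMod (bc_tau phis).

Lemma bc_tau_pure e m : tau bc_taumod (ptensor phi e m) = ptensor phi (s' e) (tau M m).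
Proof.
rewrite /= /bc_tau ext_lift_pure /bc_tau0.
by rewrite -[LHS]/(s' e *: ptensor phi 1 (tau M m)) scale_pure mulr1.
Qed.

End Tau.

Section Module.
Context (M : lmodType E).

Lemma bc_fg : finitely_generated M -> finitely_generated (ext phi M).
Proof.
move=> [n [g gP]]; exists n, (fun i => ptensor phi 1 (g i)) => x.
elim/ext_ind: x => [e m||x y [a ->] [b ->]].
- have [a ->] := gP m; exists (fun i => e * phi (a i)).
  rewrite (big_morph (ptensor phi e) (pureDr phi e) (pure0 phi _ e)).
  by apply: eq_bigr => i _; rewrite pureZ scale_pure mulr1.
- by exists (fun=> 0); rewrite big1 // => i _; rewrite scale0r.
- exists (fun i => a i + b i); rewrite -big_split /=.
  by apply: eq_bigr => i _; rewrite scalerDl.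
Qed.

Section Adjunct.
Context (N : lmodType E') (h : {linear ext phi M -> N}).
Definition adjunct (m : M) : restr phi N := h (ptensor phi 1 m).
Lemma adjunct_linear : linear adjunct.
Proof.
by move=> c x y; rewrite /adjunct pureDr linearD pureZ mul1r -[phi c]mulr1 -scale_pure linearZ.
Qed.
HB.instance Definition _ :=
  GRing.isLinear.Build E M (restr phi N) *:%R adjunct adjunct_linear.
End Adjunct.

Section Unadjunct.
Context (N : lmodType E') (h : {linear M -> restr phi N}).
Definition unadjunct (m : M) : N := h m.
Lemma unadjunct_linear : linear_for (phi \; *:%R) unadjunct.
Proof. by move=> c x y; rewrite /unadjunct linearP. Qed.
HB.instance Definition _ :=
  GRing.isLinear.Build E M N (phi \; *:%R) unadjunct unadjunct_linear.
End Unadjunct.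

Section RestrMap.
Context (N P : lmodType E') (p : {linear N -> P}).
Definition restr_map (x : restr phi N) : restr phi P := p x.
Lemma restr_map_linear : linear restr_map.
Proof. by move=> c x y; rewrite /restr_map linearP. Qed.
HB.instance Definition _ := GRing.isLinear.Build E (restr phi N) (restr phi P)
  *:%R restr_map restr_map_linear.
End RestrMap.

Lemma bc_proj : projective M -> projective (ext phi M).
Proof.
move=> Mproj N P p f p_surj.
have [|h hP] := Mproj (restr phi N) (restr phi P) (restr_map p) (adjunct f).
  exact: p_surj.
exists (ext_lift (unadjunct h)) => x; elim/ext_ind: x => [e m||x y IHx IHy].
- rewrite /= ext_lift_pure linearZ /=.
  rewrite -[p _]/(restr_map p (h m)) hP.
  by rewrite -[RHS]/(f (ptensor phi e m)) -[e in RHS]mulr1 -scale_pure linearZ.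
- by rewrite !linear0.
- by rewrite !linearD IHx IHy.
Qed.

End Module.

Section Lin.
Context (M : taumod s).
Local Notation M' := (ext phi M).
Local Notation ssM' := (ext s' M').

Definition bc_lin_inv00 of (forall e, s' (phi e) = phi (s e)) :=
  fun m : M => ptensor s' 1 (ptensor phi 1 m) : restr phi ssM'.

Lemma bc_lin_inv00_linear : linear_for (s \; *:%R) (bc_lin_inv00 phis).
Proof.
move=> c x y; rewrite /bc_lin_inv00 2!pureDr; congr (_ + _).
rewrite -[RHS]/(phi (s c) *: ptensor s' 1 (ptensor phi 1 x)).
by rewrite pureZ mul1r -[phi c]mulr1 -(scale_pure phi) pureZ mul1r scale_pure mulr1 phis.
Qed.

HB.instance Definition _ := GRing.isLinear.Build E M (restr phi ssM')
  (s \; *:%R) (bc_lin_inv00 phis) bc_lin_inv00_linear.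

Lemma bc_lin : bijective (linearization M) -> bijective (linearization (bc_taumod M)).
Proof.
move=> [v vK Kv].
pose c (x : ext s M) : ssM' := ext_lift (bc_lin_inv00 phis) x.
have cZ a x : c (a *: x) = phi a *: c x by rewrite /c linearZ.
have cD x y : c (x + y) = c x + c y by rewrite /c linearD.
have cp m : c (ptensor s 1 m) = ptensor s' 1 (ptensor phi 1 m).
  by rewrite /c ext_lift_pure scale1r.
have linD x y : linearization M (x + y) = linearization M x + linearization M y.
  exact: linearD.
have linZ a x : linearization M (a *: x) = a *: linearization M x by exact: linearZ.
have vD x y : v (x + y) = v x + v y by rewrite -[RHS]vK linD !Kv.
have vZ a x : v (a *: x) = a *: v x by rewrite -[RHS]vK linZ Kv.
pose cv (m : M) : ssM' := c (v m).
have cv_lin : linear_for (phi \; *:%R) cv.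
  by move=> a x y; rewrite /cv vD vZ cD cZ.
pose cvM := GRing.isLinear.Build E M ssM' (phi \; *:%R) cv cv_lin.
pose cvL : {linear M -> ssM' | phi \; *:%R} := HB.pack cv cvM.
have lin'p e x : linearization (bc_taumod M) (ptensor s' e x) = e *: tau (bc_taumod M) x.
  by rewrite /linearization ext_lift_pure.
have lin'D x y : linearization (bc_taumod M) (x + y) =
    linearization (bc_taumod M) x + linearization (bc_taumod M) y.
  exact: linearD.
have lin'Z a x : linearization (bc_taumod M) (a *: x) =
    a *: linearization (bc_taumod M) x.
  exact: linearZ.
have vtau m : v (tau M m) = ptensor s 1 m.
  by rewrite -[RHS]vK /linearization ext_lift_pure scale1r.
pose w (x : M') : ssM' := ext_lift cvL x.
have wD x y : w (x + y) = w x + w y by exact: linearD.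
have wZ a x : w (a *: x) = a *: w x by exact: linearZ.
have w0 : w 0 = 0 by exact: linear0.
have wp e m : w (ptensor phi e m) = e *: c (v m) by rewrite /w ext_lift_pure.
pose t (x : M') : M' := tau (bc_taumod M) x.
have tD x y : t (x + y) = t x + t y by exact: linearD.
have t0 : t 0 = 0 by exact: linear0.
have tp e m : t (ptensor phi e m) = ptensor phi (s' e) (tau M m) by exact: bc_tau_pure.
have lin'0 : linearization (bc_taumod M) 0 = 0 by exact: linear0.
exists w.
- move=> x; elim/ext_ind: x => [e' x||x y IHx IHy].
  + rewrite lin'p wZ -/(t x); elim/ext_ind: x => [e m||x y IHx IHy].
    * rewrite tp wp vtau cp !scale_pure mulr1.
      by rewrite -pureZ scale_pure mulr1.
    * by rewrite t0 w0 scaler0 pure0.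
    * by rewrite tD wD scalerDr IHx IHy -pureDr.
  + by rewrite lin'0 w0.
  + by rewrite lin'D wD IHx IHy.
- move=> x; elim/ext_ind: x => [e m||x y IHx IHy].
  + rewrite wp lin'Z.
    suff cE z : linearization (bc_taumod M) (c z) = ptensor phi 1 (linearization M z).
      by rewrite cE Kv scale_pure mulr1.
    elim/ext_ind: z => [a n||z u IHz IHu].
    * rewrite -[a]mulr1 -scale_pure cZ lin'Z cp lin'p scale1r -/(t _) tp rmorph1.
      by rewrite linZ /linearization ext_lift_pure scale1r pureZ scale_pure mul1r mulr1.
    * have -> : linearization M 0 = 0 by exact: linear0.
      have -> : c 0 = 0 by rewrite -(scale0r (0 : ext s M)) cZ rmorph0 scale0r.
      by rewrite lin'0 pure0.
    * by rewrite cD lin'D linD pureDr IHz IHu.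
  + by rewrite w0 lin'0.
  + by rewrite wD lin'D IHx IHy.
Qed.

End Lin.

Definition base_change (M : isocrystal s) : isocrystal s' :=
  @Isocrystal E' s' (bc_taumod M) (bc_fg (isocrystal_fg M))
    (bc_proj (@isocrystal_proj E s M)) (bc_lin (isocrystal_lin M)).

End BaseChange.

(* Isocrystals over E_F = K((z)), where E_A = K[[z]]. *)
Section Slopes.
Context (K : comPzRingType) (s : {rmorphism laurent K -> laurent K}).

(* An E_A-submodule of M is given by an E_A-module with an injective E_A-linear
   map to M. *)
Record lattice (M : lmodType (laurent K)) := Lattice {
  lattice_car :> lmodType (powser K);
  lattice_emb : {linear lattice_car -> M | @psval K \; *:%R};
  lattice_emb_inj : injective lattice_emb;
  lattice_fg : finitely_generated lattice_car;
  lattice_proj : projective lattice_car;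
  lattice_gen : forall m : M, exists (n : nat) (l : lattice_car),
    m = lmonom 1 (- n%:Z) *: lattice_emb l
}.
Arguments lattice_emb {M} L : rename.

Definition lattice_set (M : lmodType (laurent K)) (L : lattice M) : set M :=
  range (lattice_emb L).

(* The E_A-submodule of M generated by S. *)
Definition powser_span (M : lmodType (laurent K)) (S : set M) : set M :=
  [set x | exists (n : nat) (a : 'I_n -> powser K) (y : 'I_n -> M),
     (forall i, S (y i)) /\ x = \sum_i psval (a i) *: y i].

Definition pure_of_slope (d : nat) (M : isocrystal s) (alpha : rat) : Prop :=
  exists (n : nat) (e : int) (L : lattice M),
    [/\ (0 < n)%N, n%:R * alpha = e%:~R &
        powser_span (iter (n * d)%N (tau M) @` lattice_set L) =
        [set lmonom 1 e *: x | x in lattice_set L]].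

(* The steps [filt alpha] and the subquotients are isocrystals of their own,
   the former embedded in M and the latter quotients of the former. *)
Record slope_filtration (d : nat) (M : isocrystal s) := SlopeFiltration {
  sf_le : rat -> isocrystal s;
  sf_emb : forall alpha, {linear sf_le alpha -> M};
  sf_emb_inj : forall alpha, injective (sf_emb alpha);
  sf_emb_tau : forall alpha x,
    sf_emb alpha (tau (sf_le alpha) x) = tau M (sf_emb alpha x);
  filt : rat -> set M := fun alpha => range (sf_emb alpha);
  filt_lt : rat -> set M :=
    fun alpha => \bigcup_(beta in [set beta | beta < alpha]) filt beta;
  sf_ascending : forall alpha beta, alpha <= beta -> filt alpha `<=` filt beta;
  sf_separated : \bigcap_alpha filt alpha = [set 0];
  sf_exhaustive : \bigcup_alpha filt alpha = [set: M];
  sf_right_continuous : forall alpha,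
    filt alpha = \bigcap_(beta in [set beta | alpha < beta]) filt beta;
  sf_gr : rat -> isocrystal s;
  sf_proj : forall alpha, {linear sf_le alpha -> sf_gr alpha};
  sf_proj_surj : forall alpha y, exists x, sf_proj alpha x = y;
  sf_proj_tau : forall alpha x,
    sf_proj alpha (tau (sf_le alpha) x) = tau (sf_gr alpha) (sf_proj alpha x);
  sf_proj_ker : forall alpha x,
    sf_proj alpha x = 0 <-> filt_lt alpha (sf_emb alpha x);
  sf_pure : forall alpha, pure_of_slope d (sf_gr alpha) alpha
}.

End Slopes.

(* A nonarchimedean local field containing F_q is F = k((z)), with ring of
   integers A = k[[z]], where k is its residue field, a finite extension of F_q.
   For an F_q-algebra R with structure map iota, the completed tensor products
   of R with F and with A are (k (x) R)((z)) and (k (x) R)[[z]]. *)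
Section CoefficientRings.
Context (Fq : finFieldType) (k : fieldExtType Fq).

Section Ring.
Context (R : comNzRingType) (iota : {rmorphism Fq -> R}).

Definition k_tens : comPzRingType := tens (in_alg k) iota.
Definition E_F : comPzRingType := laurent k_tens.
Definition E_A : comPzRingType := powser k_tens.

Definition sigma : {rmorphism E_F -> E_F} :=
  laurent_map (tens_map (f := in_alg k) (h := frobq_of iota) (frobq_iota iota)).

Definition isocrystal_over := isocrystal sigma.

End Ring.

Context (R R' : comNzRingType) (iota : {rmorphism Fq -> R}).
Context (h : {rmorphism R -> R'}).

Definition E_F_map : {rmorphism E_F iota -> E_F (h \o iota)} :=
  laurent_map (tens_map (f := in_alg k) (g' := h \o iota) (h := h) (fun=> erefl)).

Lemma sigma_E_F_map e : sigma (h \o iota) (E_F_map e) = E_F_map (sigma iota e).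
Proof.
apply: laurent_eq => n /=; elim/tens_ind: (e n) => [a b||x y IHx IHy].
- by rewrite !tens_map_pure /= /frobq_of rmorphXn.
- by rewrite !rmorph0.
- by rewrite !rmorphD /= IHx IHy.
Qed.

Definition isocrystal_base_change (M : isocrystal_over iota) :
    isocrystal_over (h \o iota) :=
  base_change sigma_E_F_map M.

End CoefficientRings.

(* Main.v *)
(** Over the field G of Laurent series with coefficients in some R[xi^-1], with xi nonzero
    and depending on the series, the slope filtration is constructed by linear algebra.
    A cyclic vector has a Newton polygon, which gives the smallest slope alpha of tau; there
    is a lattice stable under z^(-e) tau^m, where e = m alpha, and under k.  Fitting's lemma
    for the reduction of this operator modulo z, together with a Hensel type fixed point,
    splits off the part on which the operator is bijective on the lattice, and one proceeds
    by induction on the rank.  The result consists of finitely many matrices over G, hence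
    it is already defined over a single R[xi^-1]((z)), where the identities between the
    matrices give the filtration and the lattices.

    The coefficient ring (k (x) R)((z)) is not a domain, so all matrices have entries in the
    Laurent series over R, and k acts by operators commuting with tau; averaging over the
    separability idempotent of k over F_q recovers projectivity over k (x) R. *)

(* Only a filtration can be aimed at. The fraction field of R need not be perfect, so Fitting's
   lemma yields the span of the image of a large power, with nilpotent quotient, but no stable
   complement: that would require inverting Frobenius. Hence the part of smallest slope is a
   subobject and the remaining slopes live on the quotient.

   The obstacle to a single xi is that limits might accumulate infinitely many denominators.
   Divisions are therefore confined to finitely many elements, while each limit is the fixed point
   of a contraction whose data lie in one R[xi^-1]((z)). Frobenius preserves this ring, and the
   fixed point stays in it.

   M need not be free. A dual basis presents it as the image of an idempotent matrix over R((z)),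
   which splits over G; over a suitable R[xi^-1]((z)) the base change of M then has a basis adapted
   to the slopes. Since k is finite, its multiplications form a finite monoid, and one lattice can
   be made stable under all of them. *)
Require Import Defs.
From HB Require Import structures.
From mathcomp Require Import all_boot all_order all_algebra all_field.
From mathcomp Require Import boolp classical_sets fsbigop.
From mathcomp Require Import zify ring lra.

Set Implicit Arguments.
Unset Strict Implicit.
Unset Printing Implicit Defensive.

Import Order.TTheory GRing.Theory Num.Theory.
Local Open Scope ring_scope.

(** * Valuations of Laurent series *)

Section Valuation.
Context (K : comPzRingType).
Implicit Types (x y : laurent K) (a b : rat) (c d : int).

(** Bounds are rational, so that slopes and exponents can be compared directly. They are predicates,
    since the zero series satisfies all of them and leading terms need not multiply when K has zero
    divisors. *)
Definition vge a x : Prop := forall n : int, n%:~R < a -> x n = 0.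
Definition vgt a x : Prop := forall n : int, n%:~R <= a -> x n = 0.
Definition lead c x : Prop := (forall n : int, n < c -> x n = 0) /\ x c <> 0.

Lemma vge_le a b x : a <= b -> vge b x -> vge a x.
Proof. by move=> ab xb n na; apply: xb; apply: lt_le_trans ab. Qed.

Lemma vge_vgt a b x : a < b -> vge b x -> vgt a x.
Proof. by move=> ab xb n na; apply: xb; apply: le_lt_trans ab. Qed.

Lemma vge0 a : vge a (0 : laurent K).
Proof. by move=> n _; rewrite lcoef0. Qed.

Lemma vgt0 a : vgt a (0 : laurent K).
Proof. by move=> n _; rewrite lcoef0. Qed.

Lemma vgeD a x y : vge a x -> vge a y -> vge a (x + y).
Proof. by move=> xa ya n na; rewrite lcoefD xa // ya // addr0. Qed.

Lemma vgtD a x y : vgt a x -> vgt a y -> vgt a (x + y).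
Proof. by move=> xa ya n na; rewrite lcoefD xa // ya // addr0. Qed.

Lemma vgeN a x : vge a x -> vge a (- x).
Proof. by move=> xa n na; rewrite lcoefN xa // oppr0. Qed.

Lemma vgtN a x : vgt a x -> vgt a (- x).
Proof. by move=> xa n na; rewrite lcoefN xa // oppr0. Qed.

Lemma vgeB a x y : vge a x -> vge a y -> vge a (x - y).
Proof. by move=> xa ya; apply/vgeD/vgeN. Qed.

Lemma vgtB a x y : vgt a x -> vgt a y -> vgt a (x - y).
Proof. by move=> xa ya; apply/vgtD/vgtN. Qed.

Lemma vge_sum (I : Type) (r : seq I) (P : pred I) (F : I -> laurent K) a :
  (forall i, P i -> vge a (F i)) -> vge a (\sum_(i <- r | P i) F i).
Proof.
by move=> Fa; elim/big_ind: _ => //; [exact: vge0 | move=> *; exact: vgeD].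
Qed.

Lemma vgt_sum (I : Type) (r : seq I) (P : pred I) (F : I -> laurent K) a :
  (forall i, P i -> vgt a (F i)) -> vgt a (\sum_(i <- r | P i) F i).
Proof.
by move=> Fa; elim/big_ind: _ => //; [exact: vgt0 | move=> *; exact: vgtD].
Qed.

Lemma lcoef_sum (I : Type) (r : seq I) (P : pred I) (F : I -> laurent K) n :
  (\sum_(i <- r | P i) F i) n = \sum_(i <- r | P i) F i n.
Proof.
exact: (big_morph (fun x : laurent K => x n) (fun x y => lcoefD x y n) (lcoef0 K n)).
Qed.

Lemma vgeM a b x y : vge a x -> vge b y -> vge (a + b) (x * y).
Proof.
move=> xa yb n nab; rewrite lcoefM; apply: fsbig1 => i _.
have [ia|ia] := ltP i%:~R a; first by rewrite xa // mul0r.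
by rewrite [y _]yb ?mulr0 // rmorphB /=; lra.
Qed.

Lemma vgtM a b x y : vge a x -> vgt b y -> vgt (a + b) (x * y).
Proof.
move=> xa yb n nab; rewrite lcoefM; apply: fsbig1 => i _.
have [ia|ia] := ltP i%:~R a; first by rewrite xa // mul0r.
by rewrite [y _]yb ?mulr0 // rmorphB /=; lra.
Qed.

Lemma vge_exists x : exists c, vge c%:~R x.
Proof. by have [c xc] := lcoef_bounded x; exists c => n; rewrite ltr_int => /xc. Qed.

Lemma vge_lmonom (u : K) c : vge c%:~R (lmonom u c).
Proof. by move=> n; rewrite ltr_int /= => nc; rewrite lt_eqF. Qed.

Lemma vge_all x : (forall a, vge a x) -> x = 0.
Proof.
move=> xP; apply: laurent_eq => n; rewrite lcoef0.
by apply: (xP (n + 1)%:~R); rewrite ltr_int; lia.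
Qed.

Lemma lmonomD c d : lmonom (1 : K) c * lmonom 1 d = lmonom 1 (c + d).
Proof.
apply: laurent_eq => n; rewrite [LHS]lmonomM mul1r /=.
by rewrite (_ : (n - c == d) = (n == c + d)) //; apply/eqP/eqP; lia.
Qed.

Lemma lmonom0 : lmonom (1 : K) 0 = 1.
Proof. by []. Qed.

Lemma vge0P x : vge 0 x <-> (forall n : int, n < 0 -> x n = 0).
Proof. by split=> xP n n0; apply: xP; [rewrite ltrz0 | rewrite -(ltrz0 rat)]. Qed.

Lemma vge1 : vge 0 (1 : laurent K).
Proof. by apply/vge0P => n n0; rewrite lcoef1 lt_eqF. Qed.

Lemma leadN0 c x : lead c x -> x <> 0.
Proof. by move=> [_ xc] x0; apply: xc; rewrite x0 lcoef0. Qed.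

Lemma lead_exists x : x <> 0 -> exists c, lead c x.
Proof.
move=> x0; have [N xN] := lcoef_bounded x.
have [m xm] : exists m : nat, `[< x (N + m%:Z) <> 0 >].
  apply: contrapT => /forallNP xz; apply: x0; apply: laurent_eq => n.
  rewrite lcoef0; have [/xN //|Nn] := ltP n N.
  have := xz `|n - N|%N; rewrite (_ : N + _ = n); last lia.
  by move=> nz; apply: contrapT => xn; apply: nz; apply/asboolP.
exists (N + (ex_minn (ex_intro (fun m : nat => `[< x (N + m%:Z) <> 0 >]) m xm))%:Z).
case: ex_minnP => k /asboolP xk kmin; split=> // n nk.
have [/xN //|Nn] := ltP n N.
apply: contrapT => xn; have := kmin `|n - N|%N.
rewrite (_ : N + `|n - N|%N = n); last lia.
by move=> /(_ (asboolT xn)); lia.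
Qed.

Lemma lead_vge c x : lead c x -> vge c%:~R x.
Proof. by move=> [xc _] n; rewrite ltr_int => /xc. Qed.

Lemma lead_vgeE c x a : lead c x -> vge a x -> a <= c%:~R.
Proof. by move=> [_ xc] xa; rewrite leNgt; apply/negP => /xa. Qed.

Lemma lead_vgtE c x a : lead c x -> vgt a x -> a < c%:~R.
Proof. by move=> [_ xc] xa; rewrite ltNge; apply/negP => /xa. Qed.

Lemma fsbig_single (F : int -> K) (c : int) :
  (forall i, i != c -> F i = 0) -> \sum_(i \in [set: int]%classic) F i = F c.
Proof.
move=> Fc; rewrite (fsbigE [:: c]) //=; last first.
  by move=> i _; rewrite inE => /negP/negP /Fc.
by rewrite big_cons big_nil in_setT addr0.
Qed.

Lemma coefM_lead c d x y :
  vge c%:~R x -> vge d%:~R y -> (x * y) (c + d) = x c * y d.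
Proof.
move=> xc yd; rewrite lcoefM (@fsbig_single _ c).
  by congr (_ * y _); lia.
move=> i ic; have [i_c|c_i] := ltP i c; first by rewrite xc ?mul0r // ltr_int.
by rewrite [y _]yd ?mulr0 // ltr_int; lia.
Qed.

Lemma coefM0 x y : vge 0 x -> vge 0 y -> (x * y) 0 = x 0 * y 0.
Proof. by move=> x0 y0; have := @coefM_lead 0 0 x y; rewrite addr0 mulr0z => ->. Qed.

Lemma vge_ltz c x : vge c%:~R x <-> (forall n : int, n < c -> x n = 0).
Proof. by split=> xP n n0; apply: xP; [rewrite ltr_int | rewrite -(ltr_int rat)]. Qed.

End Valuation.

Section LaurentMapVal.
Context (K L : comPzRingType) (h : {rmorphism K -> L}).

Lemma laurent_map_vge a x : vge a x -> vge a (laurent_map h x).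
Proof. by move=> xa n na /=; rewrite xa // rmorph0. Qed.

Lemma laurent_map_lmonom c : laurent_map h (lmonom 1 c) = lmonom 1 c.
Proof. by apply: laurent_eq => n /=; case: ifP; rewrite ?rmorph1 ?rmorph0. Qed.
End LaurentMapVal.

(** * The field of Laurent series with coefficients in a localization of [R] *)

Section DefinedOver.
Context (R : idomainType).
Local Notation Q := {fraction R}.
Implicit Types (xi eta : R) (x y : laurent Q).

Lemma away_subring xi : subring_closed (away_pred xi).
Proof. exact: away_pred_subring. Qed.

HB.instance Definition _ xi := GRing.isSubringClosed.Build Q (away_pred xi)
  (away_subring xi).

Lemma away_pred_dvd xi eta q : eta != 0 -> q \in away_pred xi -> q \in away_pred (xi * eta).
Proof.
move=> eta0 /asboolP[a [n ->]]; apply/asboolP; exists (a * eta ^+ n), n.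
rewrite !tofracM exprMn tofracXn -mulf_div divff ?mulr1 //.
by rewrite expf_neq0 // tofrac_eq0.
Qed.

(** The inverse of a / xi^n is xi^(n+1) / (xi a), so it suffices to invert xi a. *)
Lemma away_pred_inv xi q : xi != 0 -> q != 0 -> q \in away_pred xi ->
  exists eta, [/\ eta != 0, {subset away_pred xi <= away_pred eta} & q^-1 \in away_pred eta].
Proof.
move=> xi0 q0 /asboolP[a [n qE]].
have a0 : a != 0 by apply: contra_neq q0 => a0; rewrite qE a0 tofrac0 mul0r.
exists (xi * a); split; first by rewrite mulf_neq0.
  by move=> p; apply: away_pred_dvd.
rewrite qE invf_div; apply/asboolP; exists (xi ^+ n.+1), 1%N.
rewrite expr1 exprS !tofracM tofracXn -mulf_div divff ?mul1r //.
by rewrite tofrac_eq0.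
Qed.

Definition coefs_away xi x : Prop := forall n : int, x n \in away_pred xi.

Lemma coefs_away_dvd xi eta x : eta != 0 -> coefs_away xi x -> coefs_away (xi * eta) x.
Proof. by move=> eta0 xP n; apply: away_pred_dvd. Qed.

Lemma coefs_awayB xi x y : coefs_away xi x -> coefs_away xi y -> coefs_away xi (x - y).
Proof. by move=> xP yP n; rewrite lcoefD lcoefN rpredB. Qed.

Lemma coefs_awayM xi x y : coefs_away xi x -> coefs_away xi y -> coefs_away xi (x * y).
Proof.
move=> xP yP n; rewrite lcoefM.
by apply: rpred_sum => i _; apply: rpredM.
Qed.
End DefinedOver.

Definition gls_pred (R : idomainType) : pred (laurent {fraction R}) :=
  fun x => `[< exists2 xi : R, xi != 0 & coefs_away xi x >].
Arguments gls_pred : clear implicits.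

Section GlsPred.
Context (R : idomainType).
Local Notation Q := {fraction R}.

Lemma gls_pred_subring : subring_closed (gls_pred R).
Proof.
have ex2 (x y : laurent Q) : x \in gls_pred R -> y \in gls_pred R ->
    exists xi : R, [/\ xi != 0, coefs_away xi x & coefs_away xi y].
  move=> /asboolP[xi xi0 xP] /asboolP[eta eta0 yP]; exists (xi * eta).
  split; [exact: mulf_neq0 | exact: coefs_away_dvd |].
  by rewrite mulrC; exact: coefs_away_dvd.
split.
- apply/asboolP; exists 1 => [|n]; first exact: oner_neq0.
  by rewrite lcoef1; case: ifP; rewrite ?rpred1 ?rpred0.
- move=> x y xG yG; have [xi [xi0 xP yP]] := ex2 _ _ xG yG.
  by apply/asboolP; exists xi => //; exact: coefs_awayB.
- move=> x y xG yG; have [xi [xi0 xP yP]] := ex2 _ _ xG yG.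
  by apply/asboolP; exists xi => //; exact: coefs_awayM.
Qed.
End GlsPred.

(* The union over all nonzero [xi] of the rings R[xi^-1]((z)).  Inverting a nonzero
   element of this union only requires inverting its leading coefficient, so that
   it is a field. *)
Record gls (R : idomainType) :=
  Gls { gls_val :> laurent {fraction R}; _ : gls_val \in gls_pred R }.

HB.instance Definition _ R := [isSub for @gls_val R].
HB.instance Definition _ R := [Choice of gls R by <:].
HB.instance Definition _ R := GRing.SubChoice_isSubComPzRing.Build
  (laurent {fraction R}) (gls_pred R) (gls R) (@gls_pred_subring R).
HB.instance Definition _ R := GRing.RMorphism.copy (@gls_val R) (val : gls R -> laurent _).

Section GlsRing.
Context (R : idomainType).
Local Notation Q := {fraction R}.
Local Notation G := (gls R).

Lemma gls_eq (x y : G) : (forall n, x n = y n) -> x = y.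
Proof. by move=> xy; apply: val_inj; apply: laurent_eq. Qed.

Lemma gls_nonzero : (1 : G) != 0.
Proof.
apply/negP => /eqP /(congr1 (fun x : G => x 0)).
by rewrite rmorph1 rmorph0 lcoef0 lcoef1 eqxx => /eqP; rewrite oner_eq0.
Qed.

HB.instance Definition _ := GRing.PzSemiRing_isNonZero.Build G gls_nonzero.

Lemma gls_away (x : G) : exists2 xi : R, xi != 0 & coefs_away xi x.
Proof. by case: x => x /= /asboolP. Qed.

Definition gmk xi (xi0 : xi != 0) (x : laurent Q) (xP : coefs_away xi x) : G :=
  Gls (asboolT (ex_intro2 _ _ xi xi0 xP)).

Lemma gmonom_away k : coefs_away (1 : R) (lmonom 1 k).
Proof. by move=> n /=; case: ifP; rewrite ?rpred1 ?rpred0. Qed.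

Definition gmonom (k : int) : G := gmk (oner_neq0 R) (gmonom_away k).

(* Banach's fixed point theorem; the fixed point stays defined over R[xi^-1]. *)
Section FixedPoint.
Context (xi : R) (xi0 : xi != 0) (p q : nat) (Phi : 'M[G]_(p, q) -> 'M[G]_(p, q)).

Definition away_integral (X : 'M[G]_(p, q)) : Prop :=
  forall i j, coefs_away xi (X i j) /\ vge 0 (X i j).
Definition agree (k : nat) (X Y : 'M[G]_(p, q)) : Prop :=
  forall i j, vge k%:R (X i j - Y i j).

Context (Phi_integral : forall X, away_integral X -> away_integral (Phi X)).
Context (Phi_contract : forall k X Y, away_integral X -> away_integral Y ->
  agree k X Y -> agree k.+1 (Phi X) (Phi Y)).

Lemma contraction_fixpoint : exists2 X, away_integral X & Phi X = X.
Proof.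
pose it n := iter n Phi 0.
have it_int n : away_integral (it n).
  elim: n => [|n IHn]; last exact: Phi_integral.
  move=> i j; rewrite mxE; split; last exact: vge0.
  by move=> n; rewrite rmorph0 lcoef0 rpred0.
have it_agree n m : agree n (it n) (it (n + m)%N).
  elim: n m => [|n IHn] m; last exact: Phi_contract.
  by move=> i j; rewrite rmorphB; apply: vgeB; apply: ((it_int _ i j).2).
have itE n m i j (k : int) : (n <= m)%N -> k < n%:Z -> it n i j k = it m i j k.
  move=> nm kn; apply/eqP; rewrite -subr_eq0 -lcoefN -lcoefD -rmorphB.
  rewrite -(subnKC nm); apply/eqP/it_agree.
  by rewrite -(ltr_int rat) in kn.
(* The coefficient of z^k is stationary from iterate |k| + 1 on, so each coefficient of the limit is
   that of an iterate and brings no new denominator. *)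
pose lim i j (k : int) := it (absz k).+1 i j k.
have lim_bounded i j : exists N : int, forall k : int, k < N -> lim i j k = 0.
  by exists 0 => k k0; apply: ((it_int _ i j).2); rewrite ltrz0.
have lim_away i j : coefs_away xi (Laurent (lim_bounded i j)).
  by move=> k; apply: ((it_int _ i j).1).
pose X := \matrix_(i, j) gmk xi0 (lim_away i j).
have X_int : away_integral X.
  move=> i j; rewrite mxE; split=> [|k k0]; first exact: lim_away.
  by apply: ((it_int _ i j).2).
have X_agree n : agree n X (it n).
  move=> i j k; rewrite mxE rmorphB lcoefD lcoefN /= /lim.
  rewrite -[n%:R]/(n%:Z%:~R) ltr_int => kn.
  apply/eqP; rewrite subr_eq0; apply/eqP.
  have [kn'|nk] := leqP (absz k).+1 n; first by apply: itE => //; lia.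
  by apply/esym/itE => //; lia.
exists X => //; apply/matrixP => i j; apply/eqP; rewrite -subr_eq0; apply/eqP.
apply: val_inj; apply: vge_all => a.
have [n an] : exists n : nat, a <= n%:R.
  by exists (Num.bound `|a|); apply: le_trans (ler_norm a) _; apply/ltW/archi_boundP.
apply: (vge_le an).
have -> : Phi X i j - X i j = (Phi X i j - it n.+1 i j) - (X i j - it n.+1 i j).
  by rewrite opprB addrA subrK.
rewrite rmorphB; apply: vgeB; apply: (@vge_le _ _ n.+1%:R); rewrite ?ler_nat //.
- exact: (Phi_contract X_int (it_int n) (X_agree n)).
- exact: X_agree.
Qed.
End FixedPoint.
End GlsRing.

Section GlsConst.
Context (R : idomainType).
Local Notation Q := {fraction R}.
Local Notation G := (gls R).

Lemma fraction_exists (a : Q) :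
  exists n d : R, d != 0 /\ a = tofrac n / tofrac d.
Proof.
elim/quotW: a => x; exists \n_x, \d_x; have d0 := denom_ratioP x; split=> //.
apply: (canRL (mulfK _)); first by rewrite tofrac_eq0.
rewrite -[LHS]/(FracField.mul _ _); apply/eqP; rewrite !piE.
rewrite FracField.equivfE /FracField.mulf !numden_Ratio ?oner_eq0 ?mulf_neq0 ?oner_eq0 //.
by rewrite !mulr1 mulrC.
Qed.

Lemma away_pred_exists (a : Q) : exists2 xi : R, xi != 0 & a \in away_pred xi.
Proof.
have [n [d [d0 ->]]] := fraction_exists a; exists d => //.
by apply/asboolP; exists n, 1%N; rewrite expr1.
Qed.

Lemma gconst_subproof (a : Q) : lmonom a 0 \in gls_pred R.
Proof.
have [xi xi0 aP] := away_pred_exists a; apply/asboolP; exists xi => // n /=.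
by case: ifP => _; rewrite ?rpred0.
Qed.

Definition gconst (a : Q) : G := Gls (gconst_subproof a).

Lemma gconst_zmod : zmod_morphism gconst.
Proof.
move=> a b; apply: gls_eq => n; rewrite rmorphB lcoefD lcoefN /=.
by case: ifP; rewrite ?subr0.
Qed.

Lemma gconst_monoid : monoid_morphism gconst.
Proof.
split=> [|a b]; first exact: val_inj.
apply: gls_eq => n; rewrite rmorphM [RHS]lmonomM /= subr0.
by case: ifP; rewrite ?mulr0.
Qed.

HB.instance Definition _ := GRing.isZmodMorphism.Build Q G gconst gconst_zmod.
HB.instance Definition _ := GRing.isMonoidMorphism.Build Q G gconst gconst_monoid.

(** Division by the leading term turns x into 1 - y with y divisible by z, and the geometric series
    of y is the fixed point of t = 1 + y t. Beyond the denominators of x, only the leading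
    coefficient is inverted. *)
Lemma gls_inverse_exists (x : G) : x != 0 -> exists y, y * x = 1.
Proof.
move=> x0; have [c xc] : exists c, lead c x.
  by apply: lead_exists => x0'; case/eqP: x0; apply: val_inj; rewrite -[LHS]/(gls_val x) x0' rmorph0.
have [xi xi0 xP] := gls_away x; have a0 : (x : laurent Q) c != 0 by apply/eqP; case: xc.
have [eta [eta0 sub aP]] := away_pred_inv xi0 a0 (xP c).
pose u := gconst ((x : laurent Q) c)^-1 * gmonom R (- c).
have uxE n : (u * x : G) n = ((x : laurent Q) c)^-1 * (x : laurent Q) (n + c).
  have -> : gls_val (u * x) =
      lmul (lmonom ((x : laurent Q) c)^-1 0) (lmul (lmonom 1 (- c)) x).
    by rewrite /u !rmorphM -mulrA.
  by rewrite !lmonomM mul1r subr0 opprK.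
pose y := 1 - u * x.
have y_away : coefs_away eta y.
  move=> n; rewrite rmorphB lcoefD lcoefN uxE rmorph1 lcoef1.
  apply: rpredB; first by case: ifP; rewrite ?rpred1 ?rpred0.
  by apply: rpredM => //; apply/sub/xP.
have y1 : vge 1 y.
  move=> n; rewrite -[1]/(1%:~R) ltr_int => n1.
  rewrite rmorphB lcoefD lcoefN uxE rmorph1 lcoef1; have [->|n0] := eqVneq n 0.
    by rewrite add0r mulVf // subrr.
  by rewrite (xc.1 (n + c)) ?mulr0 ?subr0 //; lia.
have [| |t _ tE] := @contraction_fixpoint R eta eta0 1 1 (fun X => 1%:M + y *: X).
- move=> X XP i j; have [Xa Xi] := XP i j; rewrite !mxE rmorphD; split.
    move=> n; rewrite lcoefD rpredD //; last by rewrite rmorphM; apply: coefs_awayM.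
    case: (i == j); rewrite ?rmorph0 ?rmorph1.
      by rewrite lcoef1; case: ifP; rewrite ?rpred1 ?rpred0.
    by rewrite lcoef0 rpred0.
  apply: vgeD; first by case: (i == j); rewrite ?rmorph0 ?rmorph1; [exact: vge1 | exact: vge0].
  rewrite rmorphM; apply: (@vge_le _ 0 (1 + 0)) => //; exact: vgeM.
- move=> k X Y _ _ XY i j; rewrite !mxE opprD addrACA subrr add0r -mulrBr rmorphM.
  by rewrite -natr1 [_ + 1]addrC; apply: vgeM => //; apply: XY.
exists (t 0 0 * u); have := congr1 (fun X : 'M_1 => X 0 0) tE; rewrite !mxE eqxx => t0E.
by rewrite -mulrA; apply/eqP; rewrite -(subKr 1 (u * x)) -/y mulrBr mulr1 mulrC -{1}t0E addrK.
Qed.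

Definition gls_inv (x : G) : G :=
  if pselect (exists y, y * x = 1) is left e then projT1 (cid e) else 0.

Lemma gls_mulVx (x : G) : x != 0 -> gls_inv x * x = 1.
Proof.
move=> /gls_inverse_exists ex; rewrite /gls_inv.
by case: pselect => // e; case: cid.
Qed.

Lemma gls_inv0 : gls_inv 0 = 0.
Proof.
rewrite /gls_inv; case: pselect => // e; exfalso.
by case: e => y /eqP; rewrite mulr0 eq_sym oner_eq0.
Qed.

HB.instance Definition _ := GRing.ComNzRing_isField.Build G gls_mulVx gls_inv0.
End GlsConst.

Section GlsVal.
Context (R : idomainType).
Local Notation Q := {fraction R}.
Local Notation G := (gls R).
Implicit Types (x y : G) (a b : rat) (c : int).

Lemma gls_valD x y : gls_val (x + y) = gls_val x + gls_val y. Proof. by []. Qed.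
Lemma gls_valN x : gls_val (- x) = - gls_val x. Proof. by []. Qed.
Lemma gls_valM x y : gls_val (x * y) = gls_val x * gls_val y. Proof. by []. Qed.
Lemma gls_val0 : gls_val (0 : G) = 0. Proof. by []. Qed.
Lemma gls_val1 : gls_val (1 : G) = 1. Proof. by []. Qed.

Lemma gls_lead_exists x : x != 0 -> exists c, lead c x.
Proof.
move=> x0; apply: lead_exists => x0'; case/eqP: x0; apply: val_inj.
by rewrite -[LHS]/(gls_val x) x0'.
Qed.

Lemma leadM c d x y : lead c x -> lead d y -> lead (c + d) (x * y : G).
Proof.
move=> xc yd; split; last first.
  rewrite gls_valM coefM_lead; [|exact: lead_vge|exact: lead_vge].
  by apply/eqP; rewrite mulf_neq0 //; apply/eqP; [case: xc | case: yd].
by apply/vge_ltz; rewrite gls_valM rmorphD; apply: vgeM; exact: lead_vge.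
Qed.

Lemma lead_divl c b x y : lead c x -> vgt (c%:~R + b) (x * y : G) -> vgt b y.
Proof.
move=> xc xyb; have [->|y0] := eqVneq y 0; first exact: vgt0.
have [d yd] := gls_lead_exists y0; have := lead_vgtE (leadM xc yd) xyb.
by rewrite rmorphD /= ltrD2l => bd; apply: vge_vgt bd (lead_vge yd).
Qed.

Lemma lead_divl_ge c b x y : lead c x -> vge (c%:~R + b) (x * y : G) -> vge b y.
Proof.
move=> xc xyb; have [->|y0] := eqVneq y 0; first exact: vge0.
have [d yd] := gls_lead_exists y0; have := lead_vgeE (leadM xc yd) xyb.
by rewrite rmorphD /= lerD2l => bd; apply: vge_le bd (lead_vge yd).
Qed.

Lemma lead_gmonom c : lead c (gmonom R c).
Proof.
split=> [n nc /=|]; first by rewrite lt_eqF.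
by rewrite /= eqxx; apply/eqP; rewrite oner_eq0.
Qed.

Lemma vge_gmonom c : vge c%:~R (gls_val (gmonom R c)).
Proof. exact: vge_lmonom. Qed.

Lemma gmonom_neq0 c : gmonom R c != 0.
Proof. by apply/eqP => z0; apply: (leadN0 (lead_gmonom c)); rewrite z0. Qed.

Lemma gmonomD c d : gmonom R (c + d) = gmonom R c * gmonom R d.
Proof. by apply: val_inj; rewrite /= -lmonomD. Qed.

Lemma gmonom0 : gmonom R 0 = 1.
Proof. exact: val_inj. Qed.

Lemma gmonomN c : gmonom R (- c) = (gmonom R c)^-1.
Proof.
apply: (mulIf (gmonom_neq0 c)); rewrite -gmonomD addNr gmonom0 mulVf //.
exact: gmonom_neq0.
Qed.

Lemma gmonomX c k : gmonom R c ^+ k = gmonom R (k%:Z * c).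
Proof.
elim: k => [|k IHk]; first by rewrite mul0r gmonom0.
by rewrite exprS IHk -gmonomD; congr gmonom; lia.
Qed.

Lemma gls_val_sum (I : Type) (r : seq I) (P : pred I) (F : I -> G) :
  gls_val (\sum_(i <- r | P i) F i) = \sum_(i <- r | P i) gls_val (F i).
Proof. exact: (big_morph (@gls_val R) gls_valD gls_val0). Qed.

Section MatrixVal.
Context (p q : nat).
Implicit Types X Y : 'M[G]_(p, q).

Definition mvge a X : Prop := forall i j, vge a (X i j).

Lemma mvge_le a b X : a <= b -> mvge b X -> mvge a X.
Proof. by move=> ab Xb i j; apply: vge_le ab (Xb i j). Qed.

Lemma mvge0 a : mvge a 0.
Proof. by move=> i j; rewrite mxE; exact: vge0. Qed.

Lemma mvgeD a X Y : mvge a X -> mvge a Y -> mvge a (X + Y).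
Proof. by move=> Xa Ya i j; rewrite mxE gls_valD; apply: vgeD. Qed.

Lemma mvgeN a X : mvge a X -> mvge a (- X).
Proof. by move=> Xa i j; rewrite mxE gls_valN; apply: vgeN. Qed.

Lemma mvgeB a X Y : mvge a X -> mvge a Y -> mvge a (X - Y).
Proof. by move=> Xa Ya; apply/mvgeD/mvgeN. Qed.

Lemma mvge_sum (I : Type) (r : seq I) (P : pred I) (F : I -> 'M[G]_(p, q)) a :
  (forall i, P i -> mvge a (F i)) -> mvge a (\sum_(i <- r | P i) F i).
Proof.
by move=> Fa; elim/big_ind: _ => //; [exact: mvge0 | move=> *; exact: mvgeD].
Qed.

Lemma mvgeZ a b x X : vge a x -> mvge b X -> mvge (a + b) (x *: X).
Proof. by move=> xa Xb i j; rewrite mxE gls_valM; apply: vgeM. Qed.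

Lemma mvge_exists X : exists c, mvge c%:~R X.
Proof.
have cP (u : 'I_p * 'I_q) : exists c, vge c%:~R (X u.1 u.2) by exact: vge_exists.
have [c {}cP] := boolp.choice cP.
exists (- (\sum_u absz (c u))%N%:Z) => i j; apply: vge_le (cP (i, j)).
rewrite ler_int (bigD1 (i, j)) //=; lia.
Qed.

Lemma mvge_all X : (forall c, mvge c%:~R X) -> X = 0.
Proof.
move=> XP; apply/matrixP => i j; rewrite mxE; apply: val_inj; apply: vge_all => a.
have [k ak] : exists k : nat, a <= k%:R.
  by exists (Num.bound `|a|); apply: le_trans (ler_norm a) _; apply/ltW/archi_boundP.
exact: vge_le ak (XP k%:Z i j).
Qed.
End MatrixVal.

Lemma mvgeM p q r a b (X : 'M[G]_(p, q)) (Y : 'M[G]_(q, r)) :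
  mvge a X -> mvge b Y -> mvge (a + b) (X *m Y).
Proof.
move=> Xa Yb i j; rewrite mxE gls_val_sum.
by apply: vge_sum => k _; rewrite gls_valM; apply: vgeM.
Qed.

Lemma mvge1 n : mvge 0 (1%:M : 'M[G]_n).
Proof. by move=> i j; rewrite mxE; case: eqP => _; [exact: vge1 | exact: vge0]. Qed.

End GlsVal.

Arguments mvge {R p q}.

Section Coefwise.
Context (R : idomainType).
Local Notation Q := {fraction R}.
Local Notation G := (gls R).

(** The model is Frobenius on the coefficients. The second condition keeps every R[xi^-1]((z))
    stable, so that fixed points of equations involving [s] acquire no new denominators. *)
Definition coefwise (s : {rmorphism G -> G}) (s0 : {rmorphism Q -> Q}) : Prop :=
  (forall (x : G) n, s x n = s0 (x n)) /\
  (forall xi a, a \in away_pred xi -> s0 a \in away_pred xi).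

Fixpoint rmorph_iter (A : pzRingType) (s : {rmorphism A -> A}) (m : nat) : {rmorphism A -> A} :=
  if m is m'.+1 then (s \o rmorph_iter s m')%FUN : {rmorphism A -> A} else idfun.

Lemma rmorph_iterS (A : pzRingType) (s : {rmorphism A -> A}) m x :
  rmorph_iter s m.+1 x = s (rmorph_iter s m x).
Proof. by []. Qed.

Lemma rmorph_iterD (A : pzRingType) (s : {rmorphism A -> A}) m k x :
  rmorph_iter s (m + k) x = rmorph_iter s m (rmorph_iter s k x).
Proof. by elim: m => //= m ->. Qed.

Lemma coefwise_iter s s0 m : coefwise s s0 -> coefwise (rmorph_iter s m) (rmorph_iter s0 m).
Proof.
move=> [sE sC]; elim: m => [|m [IH1 IH2]]; first by split.
split=> [x n|xi a aP]; first by rewrite !rmorph_iterS sE IH1.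
by rewrite rmorph_iterS; apply/sC/IH2.
Qed.

Section One.
Context (s : {rmorphism G -> G}) (s0 : {rmorphism Q -> Q}) (ss0 : coefwise s s0).

Lemma coefwise_vge a (x : G) : vge a x -> vge a (s x).
Proof. by move=> xa n na; rewrite ss0.1 xa // rmorph0. Qed.

Lemma coefwise_vgt a (x : G) : vgt a x -> vgt a (s x).
Proof. by move=> xa n na; rewrite ss0.1 xa // rmorph0. Qed.

Lemma coefwise_lead c (x : G) : lead c x -> lead c (s x).
Proof.
move=> [xc xc0]; split=> [n nc|]; rewrite ss0.1; first by rewrite xc // rmorph0.
by apply/eqP; rewrite fmorph_eq0; apply/eqP.
Qed.

Lemma coefwise_gmonom c : s (gmonom R c) = gmonom R c.
Proof.
by apply: gls_eq => n; rewrite ss0.1 /=; case: ifP; rewrite ?rmorph0 ?rmorph1.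
Qed.

Lemma coefwise_mvge p q a (X : 'M[G]_(p, q)) : mvge a X -> mvge a (map_mx s X).
Proof. by move=> Xa i j; rewrite mxE; apply: coefwise_vge. Qed.

Lemma coefwise_away xi (x : G) : coefs_away xi x -> coefs_away xi (s x).
Proof. by move=> xP n; rewrite ss0.1; apply: ss0.2. Qed.
End One.
End Coefwise.

(** * Semilinear maps *)

Section Tau.
Context (A : comPzRingType) (s : {rmorphism A -> A}) (n : nat).
Implicit Types (T P : 'M[A]_n) (x y : 'rV[A]_n).

(** Coordinates are rows: row i of [T] is the image of the i-th basis vector. A zero upper right
    block thus means that the first basis vectors span a stable subspace. *)
Definition semilin T x : 'rV[A]_n := map_mx s x *m T.

(** The matrix of the q-th iterate of [semilin T], see [iter_semilinE]. *)
Fixpoint twpow T (q : nat) : 'M[A]_n :=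
  if q is q'.+1 then map_mx s (twpow T q') *m T else 1%:M.

Lemma semilinD T x y : semilin T (x + y) = semilin T x + semilin T y.
Proof. by rewrite /semilin map_mxD mulmxDl. Qed.

Lemma semilinZ T a x : semilin T (a *: x) = s a *: semilin T x.
Proof. by rewrite /semilin map_mxZ scalemxAl. Qed.

Lemma semilin0 T : semilin T 0 = 0.
Proof. by rewrite /semilin map_mx0 mul0mx. Qed.

Lemma map_rmorph_iterS p q m (X : 'M[A]_(p, q)) :
  map_mx (rmorph_iter s m.+1) X = map_mx s (map_mx (rmorph_iter s m) X).
Proof. by apply/matrixP => i j; rewrite !mxE. Qed.

Lemma iter_semilinD T q x y :
  iter q (semilin T) (x + y) = iter q (semilin T) x + iter q (semilin T) y.
Proof. by elim: q => //= q ->; rewrite semilinD. Qed.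

Lemma iter_semilinZ T q a x :
  iter q (semilin T) (a *: x) = rmorph_iter s q a *: iter q (semilin T) x.
Proof. by elim: q => // q IHq; rewrite !iterS IHq semilinZ. Qed.

Lemma iter_semilin0 T q : iter q (semilin T) 0 = 0.
Proof. by elim: q => //= q ->; rewrite semilin0. Qed.

Lemma iter_semilin_sum T q (I : Type) (r : seq I) (Pr : pred I) (F : I -> 'rV[A]_n) :
  iter q (semilin T) (\sum_(i <- r | Pr i) F i) =
  \sum_(i <- r | Pr i) iter q (semilin T) (F i).
Proof.
exact: (big_morph (iter q (semilin T)) (iter_semilinD T q) (iter_semilin0 T q)).
Qed.

Lemma iter_semilinE T q x :
  iter q (semilin T) x = map_mx (rmorph_iter s q) x *m twpow T q.
Proof.
elim: q => [|q IHq]; first by rewrite mulmx1; apply/rowP => i; rewrite mxE.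
by rewrite iterS IHq /semilin map_mxM mulmxA map_rmorph_iterS.
Qed.

Lemma twpowD T a b :
  twpow T (a + b) = map_mx (rmorph_iter s a) (twpow T b) *m twpow T a.
Proof.
elim: a => [|a IHa]; first by rewrite mulmx1; apply/matrixP => i j; rewrite mxE.
by rewrite addSn [LHS]/= IHa map_mxM mulmxA map_rmorph_iterS.
Qed.

End Tau.

Section Change.
Context (A : comPzRingType) (s : {rmorphism A -> A}).

Lemma twpow_change n n' (T : 'M[A]_n) (P : 'M[A]_(n', n)) (Pi : 'M[A]_(n, n')) q : Pi *m P = 1%:M ->
  twpow s (map_mx s P *m T *m Pi) q *m P = map_mx (rmorph_iter s q) P *m twpow s T q.
Proof.
move=> PiP; set T' := _ *m Pi.
have T'P : T' *m P = map_mx s P *m T by rewrite /T' -mulmxA PiP mulmx1.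
elim: q => [|q IHq].
  by rewrite /= mul1mx mulmx1; apply/matrixP => i j; rewrite mxE.
rewrite [twpow _ T' _]/= -mulmxA T'P mulmxA -map_mxM IHq map_mxM -map_rmorph_iterS.
by rewrite -mulmxA.
Qed.

Lemma semilin_change n n' (T : 'M[A]_n) (P : 'M[A]_(n', n)) (Pi : 'M[A]_(n, n')) q x : Pi *m P = 1%:M ->
  iter q (semilin s (map_mx s P *m T *m Pi)) x *m P = iter q (semilin s T) (x *m P).
Proof.
move=> PiP; elim: q => // q IHq; rewrite !iterS /semilin -IHq map_mxM.
by rewrite -!mulmxA PiP mulmx1.
Qed.
End Change.

Lemma twpow_iter (A : comPzRingType) (s : {rmorphism A -> A}) n (T : 'M[A]_n) m k :
  twpow (rmorph_iter s m) (twpow s T m) k = twpow s T (k * m).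
Proof. by elim: k => // k IHk; rewrite mulSn twpowD [LHS]/= IHk. Qed.

Lemma twpow_map (A B : comPzRingType) (s : {rmorphism A -> A}) (t : {rmorphism B -> B})
    (f : {rmorphism A -> B}) n (T : 'M[A]_n) q :
  (forall a, f (s a) = t (f a)) -> map_mx f (twpow s T q) = twpow t (map_mx f T) q.
Proof.
move=> fs; elim: q => [|q IHq]; first by rewrite /= map_mx1.
rewrite [LHS]/= map_mxM [RHS]/= -IHq; congr (_ *m _).
by apply/matrixP => i j; rewrite !mxE fs.
Qed.

Section Bounded.
Context (R : idomainType).
Local Notation Q := {fraction R}.
Local Notation G := (gls R).
Context (s : {rmorphism G -> G}) (s0 : {rmorphism Q -> Q}) (ss0 : coefwise s s0).

Section Space.
Context (n : nat) (T : 'M[G]_n).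
Implicit Types (g : rat) (x y : 'rV[G]_n).

(* The slopes of the cyclic submodule generated by [x] are at least [g]. *)
Definition bounded g x : Prop :=
  exists C : rat, forall q : nat, mvge (q%:R * g - C) (iter q (semilin s T) x).

Lemma boundedD g x y : bounded g x -> bounded g y -> bounded g (x + y).
Proof.
move=> [C xC] [D yD]; exists (Num.max C D) => q; rewrite iter_semilinD.
have [CD|/ltW DC] := leP C D; apply: mvgeD; move: (xC q) (yD q) => xq yq //.
- by apply: mvge_le xq; rewrite lerD2l lerN2.
- by apply: mvge_le yq; rewrite lerD2l lerN2.
Qed.

Lemma boundedZ g a x : bounded g x -> bounded g (a *: x).
Proof.
have [c ac] := vge_exists a; move=> [C xC]; exists (C - c%:~R) => q.
rewrite iter_semilinZ (_ : _ - _ = c%:~R + (q%:R * g - C)); last lra.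
by apply: mvgeZ => //; apply: (coefwise_vge (coefwise_iter q ss0)).
Qed.

Lemma bounded0 g : bounded g 0.
Proof. by exists 0 => q; rewrite iter_semilin0; exact: mvge0. Qed.

Lemma bounded_le g h x : g <= h -> bounded h x -> bounded g x.
Proof.
move=> gh [C xC]; exists C => q; apply: mvge_le (xC q).
by rewrite lerD2r ler_wpM2l.
Qed.

Lemma bounded_sum g (I : Type) (r : seq I) (Pr : pred I) (F : I -> 'rV[G]_n) :
  (forall i, Pr i -> bounded g (F i)) -> bounded g (\sum_(i <- r | Pr i) F i).
Proof.
by move=> Fg; elim/big_ind: _ => //; [exact: bounded0 | exact: boundedD].
Qed.

Lemma bounded_rows g : (forall i, bounded g (row i 1%:M)) -> forall x, bounded g x.
Proof.
move=> rg x; rewrite -[x]mulmx1 mulmx_sum_row.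
by apply: bounded_sum => i _; apply: boundedZ.
Qed.

(** One constant propagates along a recurrence of order r. It comes from the first r iterates, as
    the sum of the absolute values of their deviations from the line of slope g. *)
Lemma bounded_recurrence g x (r : nat) :
  (forall q (B : rat),
     (forall i, (i < r)%N -> mvge ((q + i)%:R * g - B) (iter (q + i) (semilin s T) x)) ->
     mvge ((q + r)%:R * g - B) (iter (q + r) (semilin s T) x)) ->
  bounded g x.
Proof.
move=> rec.
have cP (i : 'I_r) : exists c : int, mvge c%:~R (iter i (semilin s T) x).
  exact: mvge_exists.
have [c {}cP] := boolp.choice cP.
exists (\sum_(i < r) `|i%:R * g - (c i)%:~R|) => q.
elim/ltn_ind: q => q IHq; have [qr|rq] := ltnP q r.
  apply: mvge_le (cP (Ordinal qr)); rewrite (bigD1 (Ordinal qr)) //=.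
  set S := \sum_(i < r | _) _; have S0 : 0 <= S by apply: sumr_ge0.
  have := ler_norm (q%:R * g - (c (Ordinal qr))%:~R); lra.
rewrite -(subnK rq); apply: rec => i ir; apply: IHq; lia.
Qed.

(** A recurrence of order m in which only the oldest term occurs. When e / m is the bottom slope,
    the bound obtained is larger: this contradicts maximality in one use, and separates the slopes
    of the quotient from the bottom one in the other. *)
Lemma bounded_twpow (m : nat) (e : int) : (0 < m)%N ->
  mvge (e + 1)%:~R (twpow s T m) -> forall x, bounded ((e + 1)%:~R / m%:R) x.
Proof.
move=> m0 Te x; apply: (@bounded_recurrence _ _ m) => q B IH.
rewrite addnC iterD iter_semilinE.
rewrite [_ - _](_ : _ = ((q + 0)%:R * ((e + 1)%:~R / m%:R) - B) + (e + 1)%:~R).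
  apply: mvgeM Te; apply: (coefwise_mvge (coefwise_iter m ss0)).
  by rewrite -{2}[q]addn0; exact: IH.
have mE : m%:R * ((e + 1)%:~R / m%:R) = (e + 1)%:~R :> rat.
  by rewrite mulrC divfK // pnatr_eq0 -lt0n.
by rewrite addn0 natrD mulrDl mE; ring.
Qed.
End Space.
End Bounded.

(** * The Newton polygon of a cyclic vector *)

Section CyclicSlope.
Context (R : idomainType).
Local Notation Q := {fraction R}.
Local Notation G := (gls R).
Context (s : {rmorphism G -> G}) (s0 : {rmorphism Q -> Q}) (ss0 : coefwise s s0).
Context (n : nat) (T : 'M[G]_n) (T_unit : T \in unitmx).
Local Notation tau := (semilin s T).

Lemma semilin_eq0 x : tau x = 0 -> x = 0.
Proof.
move=> /(congr1 (mulmx^~ (invmx T))); rewrite mulmxK // mul0mx => sx0.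
apply/matrixP => i j; have := congr1 (fun X : 'rV_n => X i j) sx0.
by rewrite !mxE => /eqP; rewrite fmorph_eq0 => /eqP.
Qed.

(** The least r for which the r-th iterate depends on the earlier ones makes these independent, and
    the dimension bounds r. If all coefficients vanished, injectivity of the semilinear map would
    force x = 0. *)
Lemma cyclic_relation (x : 'rV[G]_n) : x != 0 ->
  exists r (a : 'I_r -> G), [/\ row_free (\matrix_(i < r) iter i tau x),
    iter r tau x = \sum_i a i *: iter i tau x & exists i, a i != 0].
Proof.
move=> x0; pose Y r := \matrix_(i < r) iter i tau x.
have YS r : (Y r <= Y r.+1)%MS.
  apply/row_subP => i; rewrite rowK; apply/submxP.
  exists (delta_mx 0 (lift ord_max i)); rewrite -rowE rowK /=.
  by rewrite /bump leqNgt ltn_ord.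
have rankY r : (forall i, (i < r)%N -> ~~ (iter i tau x <= Y i)%MS) -> (r <= \rank (Y r))%N.
  elim: r => // r IHr xY; apply: (leq_ltn_trans (IHr _)); first by move=> i /leqW; exact: xY.
  apply: rank_ltmx; apply/andP; split; first exact: YS.
  apply: contra (xY r _) => // YSr; apply: submx_trans YSr.
  by apply/submxP; exists (delta_mx 0 ord_max); rewrite -rowE rowK.
have [r xr] : exists r, (iter r tau x <= Y r)%MS.
  apply: contrapT => /forallNP xY; have := rankY n.+1 (fun i _ => introN idP (xY i)).
  by rewrite leqNgt ltnS rank_leq_col.
case: (ex_minnP (ex_intro (fun r => iter r tau x <= Y r)%MS r xr)) => {r xr} r xr rmin.
have [a aE] := submxP xr.
have relE : iter r tau x = \sum_i a 0 i *: iter i tau x.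
  by rewrite aE mulmx_sum_row; apply: eq_bigr => i _; rewrite rowK.
exists r, (a 0); split=> //.
- rewrite /row_free eqn_leq rank_leq_row rankY // => i ir.
  by apply/negP => /rmin; rewrite leqNgt ir.
- apply: contrapT => /forallNP a0; case/eqP: x0.
  have : iter r tau x = 0.
    by rewrite relE big1 // => i _; have /negP := a0 i; rewrite negbK => /eqP->; rewrite scale0r.
  by elim: (r) => // k IHk /semilin_eq0.
Qed.

(** [mu] is the extreme slope of the Newton polygon, the minimum of v(a i) / (r - i) over the
    nonzero coefficients. Among the indices attaining it [i0] is the smallest, whence the strict
    inequalities below [i0]. *)
Lemma newton_slope (r : nat) (a : 'I_r -> G) : (exists i, a i != 0) ->
  exists (mu : rat) (e : int) (i0 : 'I_r),
    [/\ (r - i0)%:R * mu = e%:~R, lead e (a i0),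
        forall i : 'I_r, vge ((r - i)%:R * mu) (a i) &
        forall i : 'I_r, (i < i0)%N -> vgt ((r - i)%:R * mu) (a i)].
Proof.
move=> [j aj0].
have cP i : exists c, a i != 0 -> lead c (a i).
  by have [_|/gls_lead_exists[c ac]] := eqVneq (a i) 0; [exists 0 | exists c].
have {cP}[c cP] := boolp.choice cP.
pose f i : rat := (c i)%:~R / (r - i)%:R.
have rf (i : 'I_r) : (r - i)%:R * f i = (c i)%:~R.
  by rewrite mulrC divfK // pnatr_eq0 -lt0n subn_gt0.
case: (@arg_minP _ _ _ j (fun i => a i != 0) f aj0) => i1 ai1 fmin.
case: (@arg_minnP _ i1 (fun i => (a i != 0) && (f i == f i1)) (@nat_of_ord r)); first by rewrite ai1 /=.
move=> i0 /andP[ai0 /eqP fi0] imin.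
exists (f i1), (c i0), i0; split; first by rewrite -fi0.
- exact: cP.
- move=> i; have [->|ai] := eqVneq (a i) 0; first exact: vge0.
  by apply: vge_le (lead_vge (cP _ ai)); rewrite -rf ler_wpM2l ?ler0n // fmin.
- move=> i ii0; have [->|ai] := eqVneq (a i) 0; first exact: vgt0.
  apply: vge_vgt (lead_vge (cP _ ai)); rewrite -rf ltr_pM2l ?ltr0n ?subn_gt0 //.
  rewrite lt_neqAle fmin // andbT; apply/negP => fi.
  by have := imin i; rewrite ai eq_sym fi => /(_ isT); rewrite leqNgt ii0.
Qed.

(** The relation yields the bound mu by recurrence. It is sharp: a larger bound makes a coordinate
    functional strictly small far out, and the recurrence, solved for its term of index [i0],
    carries this strictness back to an iterate on which the functional is 1. *)
Lemma cyclic_slope (x : 'rV[G]_n) : x != 0 ->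
  exists (mu : rat) (m : nat) (e : int), [/\ (0 < m)%N, m%:R * mu = e%:~R,
    bounded s T mu x & forall eps, 0 < eps -> ~ bounded s T (mu + eps) x].
Proof.
move=> /cyclic_relation[r [a [freeY relE a_neq0]]].
have [mu [e [i0 [rmu lead_i0 a_ge a_gt]]]] := newton_slope a_neq0.
have recE q : iter (q + r) tau x = \sum_i rmorph_iter s q (a i) *: iter (q + i) tau x.
  rewrite iterD relE iter_semilin_sum; apply: eq_bigr => i _.
  by rewrite iter_semilinZ iterD.
exists mu, (r - i0)%N, e; split=> //; first by rewrite subn_gt0.
  apply: (@bounded_recurrence _ _ _ _ _ _ r) => q B IH; rewrite recE.
  apply: mvge_sum => i _.
  rewrite (_ : _ - B = (r - i)%:R * mu + ((q + i)%:R * mu - B)); last first.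
    by rewrite natrB 1?ltnW // !natrD; ring.
  apply: mvgeZ (IH _ _) => //; apply: (coefwise_vge (coefwise_iter q ss0)).
  exact: a_ge.
move=> eps eps0 [C xC].
have [B YB] := row_freeP freeY.
have r0 : (0 < r)%N by exact: leq_ltn_trans (ltn_ord i0).
have rl : (r.-1 < r)%N by rewrite prednK.
(* [B] reads off coordinates in the cyclic basis. [u q] is the last coordinate of the q-th iterate,
   and [L q] the lower bound that slope mu imposes on its valuation, normalized to 0 at r - 1, where
   u is 1. *)
pose l := Ordinal rl; pose u q : G := (iter q tau x *m B) 0 l.
pose L q : rat := (q%:R - r.-1%:R) * mu.
have u_small q : (q < r)%N -> u q = (q == r.-1)%:R.
  move=> qr; have := congr1 (fun X : 'M_r => X (Ordinal qr) l) YB.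
  by rewrite [RHS]mxE => <-; rewrite /u -(rowK (fun i : 'I_r => iter i tau x) (Ordinal qr)) -row_mul mxE.
have u_rec q : u (q + r)%N = \sum_i rmorph_iter s q (a i) * u (q + i)%N.
  rewrite /u recE mulmx_suml summxE; apply: eq_bigr => i _.
  by rewrite -scalemxAl mxE.
have a_geq q (i : 'I_r) : vge ((r - i)%:R * mu) (rmorph_iter s q (a i)).
  exact: (coefwise_vge (coefwise_iter q ss0)).
have L_split p (i : 'I_r) : L (p + r)%N = (r - i)%:R * mu + L (p + i)%N.
  by rewrite /L natrB 1?ltnW // !natrD; ring.
have u_ge q : vge (L q) (u q).
  elim/ltn_ind: q => q IHq; have [qr|rq] := ltnP q r.
    rewrite u_small //; case: eqP => [->|_]; last exact: vge0.
    by rewrite /L subrr mul0r; exact: vge1.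
  rewrite -(subnK rq) u_rec gls_val_sum; apply: vge_sum => i _.
  rewrite (L_split _ i) gls_valM; apply: vgeM => //; apply: IHq.
  by rewrite -[X in (_ < X)%N](subnK rq) ltn_add2l.
(* Descending induction. In the recurrence started at [q - i0], the coefficients of index below [i0]
   are strict, and so are the values of u beyond q; hence [a i0 * u q] is strict, while [a i0] has
   valuation exactly (r - i0) mu. *)
have u_down N : (forall q, (N <= q)%N -> vgt (L q) (u q)) ->
    forall j q, (r.-1 <= q)%N -> (N - j <= q)%N -> vgt (L q) (u q).
  move=> uN; elim=> [|j IHj] q rq Nq; first by apply: uN; rewrite subn0 in Nq.
  have u_gt q' : (q < q')%N -> vgt (L q') (u q').
    by move=> qq'; apply: IHj; lia.
  have i0q : (i0 <= q)%N by have := ltn_ord i0; lia.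
  pose p := (q - i0)%N; have pq : (p + i0 = q)%N by rewrite subnK.
  have lead_p := coefwise_lead (coefwise_iter p ss0) lead_i0.
  apply: (lead_divl lead_p); rewrite -rmu -pq -L_split.
  have -> : rmorph_iter s p (a i0) * u (p + i0)%N =
      u (p + r)%N - \sum_(i | i != i0) rmorph_iter s p (a i) * u (p + i)%N.
    by rewrite u_rec (bigD1 i0) //= addrK.
  rewrite gls_valD gls_valN; apply: vgtB; first by apply: u_gt; have := ltn_ord i0; lia.
  rewrite gls_val_sum; apply: vgt_sum => i ii0; rewrite (L_split _ i) gls_valM.
  have [lt_i|gt_i|/val_inj eq_i] := ltngtP i i0; last by rewrite eq_i eqxx in ii0.
    rewrite [_ + L _]addrC [gls_val _ * _]mulrC; apply: vgtM => //.
    by apply: (coefwise_vgt (coefwise_iter p ss0)); exact: a_gt.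
  by apply: vgtM => //; apply: u_gt; rewrite -pq ltn_add2l.
have [c Bc] := mvge_exists B.
(* The line of slope mu + eps, lowered by the constants, lies above [L q] as soon as q eps exceeds
   [D]. *)
pose D : rat := C - c%:~R - r.-1%:R * mu.
have N_large q : (Num.bound `|D / eps| <= q)%N -> vgt (L q) (u q).
  move=> Nq; apply: (@vge_vgt _ _ (q%:R * (mu + eps) - C + c%:~R)); last first.
    exact: (mvgeM (xC q) Bc).
  have : D / eps < q%:R.
    apply: le_lt_trans (ler_norm _) _; apply: lt_le_trans (archi_boundP _) _ => //.
    by rewrite ler_nat.
  by rewrite ltr_pdivrMr // /D /L; lra.
have := u_down _ N_large (Num.bound `|D / eps|) r.-1 (leqnn _).
rewrite subnn => /(_ isT 0); rewrite /L subrr mul0r => /(_ (lexx _)).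
by rewrite u_small // eqxx gls_val1 lcoef1 => /eqP; rewrite oner_eq0.
Qed.
End CyclicSlope.

(** * The bottom slope and stable lattices *)

Section BottomSlope.
Context (R : idomainType).
Local Notation Q := {fraction R}.
Local Notation G := (gls R).

Section Bottom.
Context (s : {rmorphism G -> G}) (s0 : {rmorphism Q -> Q}) (ss0 : coefwise s s0).

(** The minimum of the sharp bounds of the standard basis vectors: all vectors satisfy it by
    linearity, and a basis vector attaining it excludes any larger bound. *)
Lemma bottom_slope n (T : 'M[G]_n.+1) : T \in unitmx ->
  exists (mu : rat) (m : nat) (e : int), [/\ (0 < m)%N, m%:R * mu = e%:~R,
    forall x, bounded s T mu x &
    forall g, (forall x, bounded s T g x) -> g <= mu].
Proof.
move=> T_unit.
have muP (i : 'I_n.+1) : exists mu : rat, exists (m : nat) (e : int), [/\ (0 < m)%N,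
    m%:R * mu = e%:~R, bounded s T mu (row i 1%:M) &
    forall eps, 0 < eps -> ~ bounded s T (mu + eps) (row i 1%:M)].
  apply: (cyclic_slope ss0 T_unit); rewrite rowE mulmx1.
  by apply/eqP => /matrixP/(_ 0 i); rewrite !mxE !eqxx => /eqP; rewrite oner_eq0.
have [mu {}muP] := boolp.choice muP.
case: (@arg_minP _ _ _ ord0 xpredT mu isT) => i _ imin.
have [m [e [m0 me _ notb]]] := muP i.
exists (mu i), m, e; split=> // [x|g gb].
  apply: (bounded_rows ss0) => j; have [_ [_ [_ _ bj _]]] := muP j.
  by apply: bounded_le bj; exact: imin.
rewrite leNgt; apply/negP => lt_g.
by apply: (notb (g - mu i)); rewrite ?subr_gt0 // addrC subrK.
Qed.
End Bottom.

(** Hermite form over the discrete valuation ring O of G. A vector [f] of L whose first entry has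
    least valuation splits L into O f and the vectors with first entry 0, to which induction
    applies. The rows of [F] are the basis. *)
Lemma lattice_basis n (L : 'rV[G]_n -> Prop) :
  (forall x y, L x -> L y -> L (x + y)) ->
  (forall a x, vge 0 (gls_val a) -> L x -> L (a *: x)) ->
  (forall x, L x -> mvge 0 x) ->
  (forall x, exists c, L (gmonom R c *: x)) ->
  exists2 F, F \in unitmx & forall v, L (v *m F) <-> mvge 0 v.
Proof.
elim: n L => [|n IHn]; last rewrite -[n.+1]/(1 + n)%N; move=> L LD LZ Lint Lspan.
  exists 1%:M => [|v]; first exact: unitmx1.
  have [c] := Lspan 0; rewrite scaler0 => L0.
  by rewrite (thinmx0 v) mul0mx; split=> // _; exact: mvge0.
pose o := lshift n (0 : 'I_1).
have L0 : L 0 by have [c] := Lspan 0; rewrite scaler0.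
have LB x y : L x -> L y -> L (x - y).
  move=> Lx Ly; rewrite -scaleN1r; apply: LD => //; apply: LZ => //.
  by rewrite gls_valN; apply: vgeN; exact: vge1.
pose P (k : nat) := `[< exists x, L x /\ lead k%:Z (x 0 o) >].
have [k0 Pk0] : exists k, P k.
  have [c Lc] := Lspan (delta_mx 0 o).
  have xE : (gmonom R c *: delta_mx 0 o : 'rV[G]_(1 + n)) 0 o = gmonom R c by rewrite !mxE !eqxx mulr1.
  have c0 : 0 <= c.
    rewrite -(ler_int rat); apply: lead_vgeE (lead_gmonom R c) _.
    by rewrite -xE; exact: Lint.
  by exists `|c|%N; apply/asboolP; eexists; split; first exact: Lc; rewrite xE gez0_abs //; exact: lead_gmonom.
case: (ex_minnP (ex_intro _ k0 Pk0)) => k /asboolP[f [Lf fk]] kmin {k0 Pk0}.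
have k_min x : L x -> vge k%:R (x 0 o).
  move=> Lx; have [->|x00] := eqVneq (x 0 o) 0; first exact: vge0.
  have [c xc] := gls_lead_exists x00.
  have c0 : 0 <= c by rewrite -(ler_int rat); apply: lead_vgeE xc (Lint _ Lx 0 o).
  apply: vge_le (lead_vge xc); rewrite -[k%:R]/(k%:Z%:~R) ler_int -(gez0_abs c0).
  by apply: kmin; apply/asboolP; exists x; rewrite gez0_abs.
have f00 : f 0 o != 0 by apply/eqP => f0; apply: (leadN0 fk); rewrite f0.
pose L' (y : 'rV[G]_n) := L (row_mx (0 : 'rV_1) y).
have [| | | |F F_unit FP] := IHn L'.
- by move=> x y Lx Ly; have := LD _ _ Lx Ly; rewrite add_row_mx addr0.
- by move=> a x a0 Lx; have := LZ _ _ a0 Lx; rewrite scale_row_mx scaler0.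
- by move=> x Lx i j; have := Lint _ Lx i (rshift 1 j); rewrite row_mxEr.
- by move=> x; have [c Lc] := Lspan (row_mx 0 x); exists c; move: Lc; rewrite scale_row_mx scaler0.
exists (block_mx (f 0 o)%:M (rsubmx f) 0 F : 'M_(1 + n)).
  by rewrite unitmxE det_ublock det_scalar1 unitrM -unitmxE F_unit unitfE f00.
move=> v; rewrite -[v]hsubmxK.
set v1 := lsubmx _; set v2 := rsubmx v.
have fE : f = row_mx (f 0 o)%:M (rsubmx f).
  rewrite -{1}[f]hsubmxK; congr row_mx.
  by rewrite [LHS]mx11_scalar !mxE.
have vF : row_mx v1 v2 *m block_mx (f 0 o)%:M (rsubmx f) 0 F =
    v1 0 0 *: f + row_mx 0 (v2 *m F).
  rewrite mul_row_block mulmx0 addr0 {3}fE scale_row_mx add_row_mx addr0.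
  by congr row_mx; rewrite {1}[v1]mx11_scalar mul_scalar_mx.
rewrite vF; split=> [Lv|vint].
- have v1_int : vge 0 (v1 0 0).
    apply: (@lead_divl_ge _ k _ (f 0 o)) => //; rewrite addr0.
    have := k_min _ Lv; rewrite mxE [X in _ + X](_ : _ = 0) ?addr0.
      by rewrite mxE mulrC.
    by rewrite row_mxEl mxE.
  have Lv2 : L (row_mx 0 (v2 *m F)).
    by have := LB _ _ Lv (LZ _ _ v1_int Lf); rewrite addrAC subrr add0r.
  have {Lv2} v2_int : mvge 0 v2 by apply/FP.
  move=> i j; rewrite ord1; case: (split_ordP j) => j' ->.
    by rewrite row_mxEl ord1.
  by rewrite row_mxEr; exact: v2_int.
- apply: LD; first apply: LZ => //.
    by have := vint 0 (lshift n 0); rewrite row_mxEl.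
  by apply/FP => i j; have := vint i (rshift 1 j); rewrite row_mxEr.
Qed.
End BottomSlope.

Section StableLattice.
Context (R : idomainType).
Local Notation Q := {fraction R}.
Local Notation G := (gls R).
Context (s : {rmorphism G -> G}) (s0 : {rmorphism Q -> Q}) (ss0 : coefwise s s0).

(** In the application these are the matrices of the multiplications by elements of k. Closure under
    products is what makes the lattice of [stable_lattice] stable under each of them. *)
Definition commuting_monoid (A : comPzRingType) (t : {rmorphism A -> A}) (I : Type) n
    (T : 'M[A]_n) (H : I -> 'M[A]_n) : Prop :=
  [/\ exists i, H i = 1%:M, forall i j, exists l, H i *m H j = H l &
      forall i, map_mx t (H i) *m T = T *m H i].

Lemma commuting_semilin n (T : 'M[G]_n) (I : Type) (H : I -> 'M[G]_n) q i x :
  commuting_monoid s T H ->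
  iter q (semilin s T) (x *m H i) = iter q (semilin s T) x *m H i.
Proof.
move=> [_ _ comm]; elim: q => // q IHq.
by rewrite !iterS IHq /semilin map_mxM -!mulmxA comm.
Qed.

Lemma mvge_rows p q a (X : 'M[G]_(p, q)) : (forall i, mvge a (row i X)) -> mvge a X.
Proof. by move=> Xa i j; have := Xa i 0 j; rewrite mxE. Qed.

Lemma stable_lattice n (T : 'M[G]_n) (I : finType) (H : I -> 'M[G]_n)
    (mu : rat) (m : nat) (e : int) :
  commuting_monoid s T H -> m%:R * mu = e%:~R -> (forall x, bounded s T mu x) ->
  exists2 F, F \in unitmx &
    mvge e%:~R (map_mx (rmorph_iter s m) F *m twpow s T m *m invmx F) /\
    forall i, mvge 0 (F *m H i *m invmx F).
Proof.
move=> monH me bT; have [[i1 Hi1] HM comm] := monH.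
(* The vectors all of whose translates by [H] have iterates on or above the line of slope mu. As m
   mu = e, replacing q by q + m shows that L is stable under z^(-e) times the m-th iterate. *)
pose L (x : 'rV[G]_n) := forall q i, mvge (q%:R * mu) (iter q (semilin s T) (x *m H i)).
have Lint x : L x -> mvge 0 x.
  by move=> /(_ 0%N i1); rewrite Hi1 mulmx1 mul0r.
have LZ a x : vge 0 (gls_val a) -> L x -> L (a *: x).
  move=> a0 Lx q i; rewrite -scalemxAl iter_semilinZ -[_ * mu]add0r; apply: mvgeZ => //.
  exact: (coefwise_vge (coefwise_iter q ss0)).
have LN x : L x -> L (gmonom R (- e) *: iter m (semilin s T) x).
  move=> Lx q i; rewrite -scalemxAl iter_semilinZ (coefwise_gmonom (coefwise_iter q ss0)).
  rewrite -(commuting_semilin _ _ _ monH) -iterD.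
  rewrite (_ : q%:R * mu = (- e)%:~R + (q + m)%:R * mu); last by rewrite natrD mulrDl me rmorphN /=; ring.
  by apply: mvgeZ; [exact: lead_vge (lead_gmonom R (- e)) | exact: Lx].
have LH x i : L x -> L (x *m H i).
  by move=> Lx q j; have [l Hl] := HM i j; rewrite -mulmxA Hl.
have [| | | |F F_unit FP] := @lattice_basis R n L.
- move=> x y Lx Ly q i; rewrite mulmxDl iter_semilinD.
  by apply: mvgeD; [exact: Lx | exact: Ly].
- exact: LZ.
- exact: Lint.
(* The index set is finite, so one power of z absorbs the constants of all translates. *)
- move=> x; have [C {}bT] := boolp.choice (fun i => bT (x *m H i)).
  have [c cC] : exists c : nat, \sum_i `|C i| <= c%:R.
    by exists (Num.bound (\sum_i `|C i|)); apply/ltW/archi_boundP/sumr_ge0.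
  exists c%:Z => q i; rewrite -scalemxAl iter_semilinZ (coefwise_gmonom (coefwise_iter q ss0)).
  apply: mvge_le (mvgeZ (lead_vge (lead_gmonom R c%:Z)) (bT i q)).
  rewrite -[c%:~R]/(c%:R); move: cC; rewrite (bigD1 i) //=.
  set S := \sum_(j | _) _; have S0 : 0 <= S by apply: sumr_ge0.
  have := ler_norm (C i); lra.
exists F => //.
have rowF i : L (row i F) by rewrite -[F]mul1mx row_mul; apply/FP => j k; rewrite mxE; exact: mvge1.
split=> [|i].
- rewrite -[map_mx _ _ *m _ *m _]scale1r -(gmonom0 R) -[0](subrr e) gmonomD -scalerA.
  rewrite -[e%:~R]addr0; apply: mvgeZ; first exact: lead_vge (lead_gmonom R e).
  apply: mvge_rows => i; apply/FP; rewrite linearZ /= !row_mul -scalemxAl mulmxKV //.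
  by rewrite -map_row -iter_semilinE; apply: LN.
- apply: mvge_rows => j; apply/FP; rewrite !row_mul mulmxKV //.
  exact: LH.
Qed.
End StableLattice.

(** * Integral matrices and their reduction modulo z *)

Section IntegralMatrix.
Context (R : idomainType).
Local Notation Q := {fraction R}.
Local Notation G := (gls R).

Definition resmx p q (X : 'M[G]_(p, q)) : 'M[Q]_(p, q) := map_mx (fun x : G => x 0) X.

Lemma resmxM p q r (X : 'M[G]_(p, q)) (Y : 'M[G]_(q, r)) :
  mvge 0 X -> mvge 0 Y -> resmx (X *m Y) = resmx X *m resmx Y.
Proof.
move=> X0 Y0; apply/matrixP => i j; rewrite !mxE gls_val_sum.
rewrite lcoef_sum.
apply: eq_bigr => k _; rewrite !mxE gls_valM.
by rewrite coefM0; [| exact: X0 | exact: Y0].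
Qed.

Lemma resmxD p q (X Y : 'M[G]_(p, q)) : resmx (X + Y) = resmx X + resmx Y.
Proof. by apply/matrixP => i j; rewrite !mxE. Qed.

Lemma resmx_gconst p q (X : 'M[Q]_(p, q)) : resmx (map_mx (@gconst R) X) = X.
Proof. by apply/matrixP => i j; rewrite !mxE. Qed.

Lemma mvge_gconst p q (X : 'M[Q]_(p, q)) : mvge 0 (map_mx (@gconst R) X).
Proof.
by move=> i j; rewrite mxE; apply: (vge_le _ (@vge_lmonom _ _ 0)); rewrite mulr0z.
Qed.

Lemma resmx_eq0 p q (X : 'M[G]_(p, q)) : mvge 0 X -> resmx X = 0 -> mvge 1 X.
Proof.
move=> X0 resX i j k; rewrite -[1]/(1%:~R) ltr_int => k1.
have [->|k0] := eqVneq k 0; last by apply: X0; rewrite ltrz0; lia.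
by have /matrixP/(_ i j) := resX; rewrite !mxE.
Qed.

Lemma mvge1_resmx p q (X : 'M[G]_(p, q)) : mvge 1 X -> resmx X = 0.
Proof. by move=> X1; apply/matrixP => i j; rewrite !mxE; apply: X1; rewrite mulr0z. Qed.

Lemma integral_prod (I : Type) (r : seq I) (F : I -> G) : (forall i, vge 0 (F i)) ->
  vge 0 (\prod_(i <- r) F i) /\ (\prod_(i <- r) F i) 0 = \prod_(i <- r) (F i 0).
Proof.
move=> F0; elim: r => [|i r [IH1 IH2]].
  by rewrite !big_nil gls_val1 lcoef1; split; first exact: vge1.
rewrite !big_cons gls_valM; split; first by rewrite -[0]addr0; apply: vgeM.
by rewrite coefM0 // IH2.
Qed.

Lemma integral_det n (X : 'M[G]_n) : mvge 0 X ->
  vge 0 (\det X) /\ (\det X) 0 = \det (resmx X).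
Proof.
move=> X0; have sgnE (b : bool) (x : laurent Q) : vge 0 x ->
    vge 0 ((-1) ^+ b * x) /\ ((-1) ^+ b * x) 0 = (-1) ^+ b * x 0.
  case: b => x0; rewrite ?expr0 ?expr1 ?mul1r ?mulN1r //.
  by split; [exact: vgeN | rewrite lcoefN].
have val_sgn (b : bool) (x : G) : gls_val ((-1) ^+ b * x) = (-1) ^+ b * gls_val x.
  by case: b; rewrite ?expr0 ?expr1 ?mul1r ?mulN1r.
rewrite /determinant gls_val_sum; split.
  by apply: vge_sum => t _; rewrite val_sgn; apply: (sgnE _ _ _).1; apply: (integral_prod _ _).1.
rewrite lcoef_sum.
apply: eq_bigr => t _; rewrite val_sgn (sgnE _ _ _).2; last by apply: (integral_prod _ _).1.
by rewrite (integral_prod _ _).2 //; congr (_ * _); apply: eq_bigr => i _; rewrite mxE.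
Qed.

(** The determinant of the residue is the residue of the determinant, which is therefore a unit of
    the valuation ring; the adjugate formula then stays integral. *)
Lemma integral_invmx n (X : 'M[G]_n) : mvge 0 X -> resmx X \in unitmx ->
  X \in unitmx /\ mvge 0 (invmx X).
Proof.
move=> X0; rewrite unitmxE unitfE => res_det; have [det0 detE] := integral_det X0.
have lead_det : lead 0 (\det X).
  by split=> [k k0|]; [apply: det0; rewrite ltrz0 | apply/eqP; rewrite detE].
have det_neq0 : \det X != 0 by apply/eqP => d0; apply: (leadN0 lead_det); rewrite d0.
have X_unit : X \in unitmx by rewrite unitmxE unitfE.
split=> //; rewrite /invmx X_unit -[0]addr0; apply: mvgeZ.
  by apply: (lead_divl_ge lead_det); rewrite addr0 mulfV //; exact: vge1.
move=> i j; rewrite mxE /cofactor; have := integral_det (X := row' j (col' i X)).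
case=> [k l|]; first by rewrite !mxE; exact: X0.
have val_sgn k (x : G) : vge 0 x -> vge 0 ((-1) ^+ k * x : G).
  move=> x0; rewrite -signr_odd; case: odd; rewrite ?expr0 ?expr1 ?mul1r ?mulN1r //.
  by rewrite gls_valN; exact: vgeN.
by move=> + _; exact: val_sgn.
Qed.

Lemma gls_away_family (J : finType) (f : J -> G) :
  exists2 xi : R, xi != 0 & forall j, coefs_away xi (f j).
Proof.
have xiP j : exists xi : R, xi != 0 /\ coefs_away xi (f j).
  by have [xi xi0 xiP] := gls_away (f j); exists xi.
have [xi {}xiP] := boolp.choice xiP; exists (\prod_j xi j).
  by apply/prodf_neq0 => j _; case: (xiP j).
move=> j; rewrite (bigD1 j) //=; apply: coefs_away_dvd; last by case: (xiP j).
by apply/prodf_neq0 => i _; case: (xiP i).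
Qed.

Lemma mx_away_family p q (X : 'M[G]_(p, q)) :
  exists2 xi : R, xi != 0 & forall i j, coefs_away xi (X i j).
Proof.
have [xi xi0 xiP] := gls_away_family (fun u : 'I_p * 'I_q => X u.1 u.2).
by exists xi => // i j; exact: xiP (i, j).
Qed.
End IntegralMatrix.

(** * Splitting off the bottom slope *)

Section Fitting.
Context (F : fieldType) (t : {rmorphism F -> F}).

Lemma twpow_rank_stable n (N : 'M[F]_n) : exists k0, forall k, (k0 <= k)%N ->
  \rank (twpow t N k) = \rank (twpow t N k0).
Proof.
have rP : exists r, `[< exists k, \rank (twpow t N k) = r >].
  by exists (\rank (twpow t N 0)); apply/asboolP; exists 0%N.
case: (ex_minnP rP) => r /asboolP[k0 rk0] rmin; exists k0 => k k0k.
apply/eqP; rewrite eqn_leq rk0; apply/andP; split; last first.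
  by apply: rmin; apply/asboolP; exists k.
by rewrite -rk0 -(subnKC k0k) twpowD; apply/mxrankS/submxMl.
Qed.

(* The image of a large power of a semilinear map is the part on which the map is
   bijective; on the quotient the power vanishes. *)
Lemma fitting_semilin n (N : 'M[F]_n) d : (0 < d)%N -> (forall k, twpow t N k != 0) ->
  exists k r n2 (P : 'M[F]_(r + n2, n)) (Pi : 'M[F]_(n, r + n2)) A B,
    [/\ (0 < k)%N, (d %| k)%N, (0 < r)%N & A \in unitmx] /\
    [/\ P *m Pi = 1%:M, Pi *m P = 1%:M &
        map_mx (rmorph_iter t k) P *m twpow t N k *m Pi = block_mx A 0 B 0].
Proof.
move=> d0 Nk; have [k0 k0P] := twpow_rank_stable N.
(* Positive, past the point where the ranks stabilize, and a multiple of d because purity concerns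
   iterates of order divisible by d. *)
pose k := (d * k0.+1)%N.
have k0k : (k0 <= k)%N by rewrite /k; apply: leq_trans (leqnSn _) (leq_pmull _ d0).
pose N' := twpow t N k; pose t' := rmorph_iter t k.
(* Stability of the rank means that the k-th iterate is still injective on the span of its image;
   this makes the block [A] invertible. *)
have rank2 : \rank (map_mx t' N' *m N') = \rank N'.
  by rewrite -twpowD !k0P //; apply: leq_trans k0k (leq_addr _ _).
pose P1 := row_base N'; pose P2 := row_base (N'^C)%MS; pose P := col_mx P1 P2.
have rankP : (\rank N' + \rank (N'^C)%MS)%N = n.
  by rewrite mxrank_compl subnKC // rank_leq_row.
have P_full : row_full P.
  rewrite -sub1mx /P -addsmxE (adds_eqmx (eq_row_base _) (eq_row_base _)).
  by rewrite sub1mx addsmx_compl_full.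
have P_free : row_free P by rewrite /row_free (eqP P_full) rankP.
have [Pi PPi] := row_freeP P_free.
have PiP : Pi *m P = 1%:M.
  by apply: (row_full_inj P_full); rewrite mulmxA PPi mulmx1 mul1mx.
have P1Pi : P1 *m Pi = row_mx 1%:M 0.
  by have := PPi; rewrite mul_col_mx scalar_mx_block => /eq_col_mx[].
have [D DE] : exists D, map_mx t' P *m N' = D *m P1.
  by apply/submxP; rewrite eq_row_base; exact: submxMl.
exists k, (\rank N'), (\rank (N'^C)%MS), P, Pi, (usubmx D), (dsubmx D); split; split=> //.
- by rewrite muln_gt0 d0.
- exact: dvdn_mulr.
- by rewrite lt0n mxrank_eq0; exact: Nk.
- have DP1 : usubmx D *m P1 = map_mx t' P1 *m N'.
    by have := DE; rewrite map_col_mx mul_col_mx -{1}[D]vsubmxK mul_col_mx => /eq_col_mx[].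
  rewrite -row_free_unit /row_free -(mxrankMfree _ (row_base_free N')) -/P1 DP1.
  by rewrite (eqmxMr _ (_ : map_mx t' P1 :=: map_mx t' N')%MS) ?rank2 //; apply/map_eqmx/eq_row_base.
- rewrite -[twpow _ _ _]/N' -/t' DE -mulmxA P1Pi mul_mx_row mulmx1 mulmx0.
  by rewrite -{1}[D]vsubmxK block_mxEh col_mx0.
Qed.
End Fitting.

Section Hensel.
Context (R : idomainType).
Local Notation Q := {fraction R}.
Local Notation G := (gls R).
Context (s : {rmorphism G -> G}) (s0 : {rmorphism Q -> Q}) (ss0 : coefwise s s0).

Definition maway p q xi (X : 'M[G]_(p, q)) : Prop := forall i j, coefs_away xi (X i j).

Lemma mawayM p q r xi (X : 'M[G]_(p, q)) (Y : 'M[G]_(q, r)) :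
  maway xi X -> maway xi Y -> maway xi (X *m Y).
Proof.
move=> XP YP i j; rewrite mxE gls_val_sum => k; rewrite lcoef_sum.
by apply: rpred_sum => l _; rewrite gls_valM; apply: coefs_awayM.
Qed.

Lemma mawayD p q xi (X Y : 'M[G]_(p, q)) : maway xi X -> maway xi Y -> maway xi (X + Y).
Proof. by move=> XP YP i j k; rewrite mxE gls_valD lcoefD; apply: rpredD; [apply: XP|apply: YP]. Qed.

Lemma mawayN p q xi (X : 'M[G]_(p, q)) : maway xi X -> maway xi (- X).
Proof. by move=> XP i j k; rewrite mxE gls_valN lcoefN rpredN; apply: XP. Qed.

Lemma mawayZ p q xi c (X : 'M[G]_(p, q)) : maway xi X -> maway xi (gmonom R c *: X).
Proof.
move=> XP i j; rewrite mxE gls_valM; apply: coefs_awayM => // k /=.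
by case: ifP; rewrite ?rpred1 ?rpred0.
Qed.

(** With [Ai] inverse to A, the equation says that conjugation by the unipotent matrix with upper
    right block X kills the upper right block of [block_mx A Y B D]. Written for X / z, its
    right-hand side is a contraction, since [D] and the quadratic term each contribute a factor
    z. *)
Lemma hensel_semilin n1 n2 (Ai : 'M[G]_n1) (Y : 'M[G]_(n1, n2)) (B : 'M[G]_(n2, n1))
    (D : 'M[G]_n2) :
  mvge 0 Ai -> mvge 1 Y -> mvge 0 B -> mvge 1 D ->
  exists2 X, mvge 1 X & X = Ai *m (Y + map_mx s X *m D - map_mx s X *m B *m X).
Proof.
move=> Ai0 Y1 B0 D1; pose z := gmonom R 1; pose Yt := gmonom R (- 1) *: Y.
have zYt : z *: Yt = Y by rewrite scalerA -gmonomD subrr gmonom0 scale1r.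
have Yt0 : mvge 0 Yt.
  apply: (@mvge_le _ _ _ _ ((- 1)%:~R + 1)) => //.
  by apply: mvgeZ => //; exact: vge_gmonom.
have z1 : vge 1 z by have := @vge_gmonom R 1; rewrite mulr1z.
have sz : s z = z by exact: coefwise_gmonom ss0 _.
have [xA xA0 AP] := mx_away_family Ai; have [xY xY0 YP] := mx_away_family Yt.
have [xB xB0 BP] := mx_away_family B; have [xD xD0 DP] := mx_away_family D.
pose xi := xA * xY * xB * xD.
have xi0 : xi != 0 by rewrite !mulf_neq0.
have {}AP : maway xi Ai by move=> i j; rewrite /xi -!mulrA; apply: coefs_away_dvd; rewrite ?mulf_neq0.
have {}YP : maway xi Yt.
  by move=> i j; rewrite /xi [xA * xY]mulrC -!mulrA; apply: coefs_away_dvd; rewrite ?mulf_neq0.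
have {}BP : maway xi B.
  by move=> i j; rewrite /xi [_ * xB]mulrC -!mulrA; apply: coefs_away_dvd; rewrite ?mulf_neq0.
have {}DP : maway xi D.
  by move=> i j; rewrite /xi [_ * xD]mulrC; apply: coefs_away_dvd; rewrite ?mulf_neq0.
pose Phi X := Ai *m (Yt + map_mx s X *m D - z *: (map_mx s X *m B *m X)).
have s_int (X : 'M[G]_(n1, n2)) : mvge 0 X -> mvge 0 (map_mx s X).
  exact: (coefwise_mvge ss0).
have [| |X XP XE] := @contraction_fixpoint R xi xi0 n1 n2 Phi.
- move=> X XP.
  have X0 : mvge 0 X by move=> i j; case: (XP i j).
  have Xa : maway xi X by move=> i j; case: (XP i j).
  have sXa : maway xi (map_mx s X) by move=> i j; rewrite mxE; exact: (coefwise_away ss0).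
  suff [Pa P0] : maway xi (Phi X) /\ mvge 0 (Phi X) by move=> i j; split; [exact: Pa | exact: P0].
  split.
    apply: mawayM => //; apply: mawayD; last apply: mawayN.
      by apply: mawayD => //; exact: mawayM.
    by apply: mawayZ; apply: mawayM => //; exact: mawayM.
  rewrite -[0]addr0; apply: mvgeM => //; apply: mvgeB.
    apply: mvgeD => //; apply: (@mvge_le _ _ _ _ (0 + 1)) => //.
    by apply: mvgeM => //; exact: s_int.
  apply: (@mvge_le _ _ _ _ (1 + (0 + 0 + 0))) => //; apply: mvgeZ => //.
  by apply: mvgeM => //; apply: mvgeM => //; exact: s_int.
- move=> k X X' XP XP' XX'.
  have X0 : mvge 0 X by move=> i j; case: (XP i j).
  have X0' : mvge 0 X' by move=> i j; case: (XP' i j).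
  pose W := X - X'.
  have Wk : mvge k%:R W by move=> i j; have := XX' i j; rewrite !mxE.
  have sWk : mvge k%:R (map_mx s W) by exact: (coefwise_mvge ss0).
  have PhiB : Phi X - Phi X' = Ai *m (map_mx s W *m D -
      z *: (map_mx s W *m B *m X + map_mx s X' *m B *m W)).
    rewrite /Phi -mulmxBr; congr (_ *m _).
    rewrite map_mxB !mulmxBl mulmxBr (addrA (_ - _)) subrK scalerBr.
    rewrite !opprD !opprK (AC (3*3) ((1*4)*((2*5)*(3*6)))) /= subrr add0r.
    by rewrite addrA.
  suff : mvge k.+1%:R (Phi X - Phi X') by move: (Phi X) (Phi X') => X1 X2 P i j; have := P i j; rewrite !mxE.
  rewrite PhiB -natr1 -[_ + 1]add0r; apply: mvgeM => //; apply: mvgeB; first exact: mvgeM.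
  rewrite [_ + 1]addrC; apply: mvgeZ => //; apply: mvgeD.
    by rewrite -[k%:R]addr0 -[k%:R]addr0; apply: mvgeM => //; exact: mvgeM.
  rewrite -[k%:R]add0r -[0](addr0 0); apply: mvgeM => //; apply: mvgeM => //; exact: s_int.
exists (z *: X).
  by rewrite -[1]addr0; apply: mvgeZ => // i j; case: (XP i j).
rewrite -{1}XE /Phi scalemxAr; congr (_ *m _).
by rewrite map_mxZ sz scalerBr scalerDr zYt -!scalemxAl -!scalemxAr.
Qed.
End Hensel.

Section BlockAlgebra.
Context (A : comPzRingType) (s : {rmorphism A -> A}).

Lemma rmorph_iter_mul m k x : rmorph_iter (rmorph_iter s m) k x = rmorph_iter s (k * m) x.
Proof. by elim: k => // k IHk; rewrite mulSn rmorph_iterS rmorph_iterD IHk. Qed.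

Lemma twpowSr n (T : 'M[A]_n) q :
  twpow s T q.+1 = map_mx (rmorph_iter s q) T *m twpow s T q.
Proof. by rewrite -addn1 twpowD /= map_mx1 mul1mx. Qed.

Lemma twpowZ n (T : 'M[A]_n) c q : s c = c -> twpow s (c *: T) q = c ^+ q *: twpow s T q.
Proof.
move=> sc; elim: q => [|q IHq]; first by rewrite expr0 scale1r.
rewrite [LHS]/= IHq map_mxZ rmorphXn sc -scalemxAl -scalemxAr scalerA -exprSr.
by [].
Qed.

Lemma twpow_lblock n1 n2 (T1 : 'M[A]_n1) (T2 : 'M[A]_n2) T21 q :
  exists B, twpow s (block_mx T1 0 T21 T2) q =
            block_mx (twpow s T1 q) 0 B (twpow s T2 q).
Proof.
elim: q => [|q [B IHq]]; first by exists 0; rewrite /= -scalar_mx_block.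
rewrite [twpow _ (block_mx _ _ _ _) _]/= IHq map_block_mx map_mx0 mulmx_block.
by rewrite !mulmx0 !mul0mx !addr0 add0r; eexists.
Qed.

Context (I : Type).

Lemma commuting_monoid_twpow n (T : 'M[A]_n) (H : I -> 'M[A]_n) q i :
  commuting_monoid s T H ->
  map_mx (rmorph_iter s q) (H i) *m twpow s T q = twpow s T q *m H i.
Proof.
move=> [_ _ comm]; elim: q => [|q IHq].
  by rewrite mulmx1 mul1mx; apply/matrixP => k l; rewrite mxE.
by rewrite [twpow _ _ _]/= mulmxA map_rmorph_iterS -map_mxM IHq map_mxM -!mulmxA comm.
Qed.

Lemma commuting_monoid_change n n' (T : 'M[A]_n) (H : I -> 'M[A]_n)
    (P : 'M[A]_(n', n)) (Pi : 'M[A]_(n, n')) :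
  P *m Pi = 1%:M -> Pi *m P = 1%:M -> commuting_monoid s T H ->
  commuting_monoid s (map_mx s P *m T *m Pi) (fun i => P *m H i *m Pi).
Proof.
move=> PPi PiP [[i1 Hi1] HM comm]; split.
- by exists i1; rewrite Hi1 mulmx1.
- move=> i j; have [l Hl] := HM i j; exists l.
  by rewrite -Hl !mulmxA -[_ *m Pi *m P]mulmxA PiP mulmx1.
- move=> i; have sPiP : map_mx s Pi *m map_mx s P = 1%:M by rewrite -map_mxM PiP map_mx1.
  rewrite !map_mxM -!mulmxA; congr (_ *m _).
  rewrite (mulmxA (map_mx s Pi)) sPiP mul1mx (mulmxA Pi) PiP mul1mx.
  by rewrite !mulmxA comm.
Qed.

Lemma commuting_monoid_drblock n1 n2 (T1 : 'M[A]_n1) (T2 : 'M[A]_n2) T21 H1 H21 H2 :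
  commuting_monoid s (block_mx T1 0 T21 T2)
    (fun i : I => block_mx (H1 i) 0 (H21 i) (H2 i)) -> commuting_monoid s T2 H2.
Proof.
move=> [[i1 Hi1] HM comm]; split.
- by exists i1; move: Hi1; rewrite scalar_mx_block => /eq_block_mx[].
- move=> i j; have [l Hl] := HM i j; exists l; move: Hl.
  by rewrite mulmx_block => /eq_block_mx[_ _ _]; rewrite mulmx0 add0r.
- move=> i; have := comm i; rewrite map_block_mx map_mx0 !mulmx_block => /eq_block_mx[_ _ _].
  by rewrite !mulmx0 !add0r.
Qed.
End BlockAlgebra.

Section BottomPiece.
Context (R : idomainType).
Local Notation Q := {fraction R}.
Local Notation G := (gls R).

Lemma mvge_shift p q a c (X : 'M[G]_(p, q)) :
  mvge a X -> mvge (c%:~R + a) (gmonom R c *: X).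
Proof. by apply: mvgeZ; exact: vge_gmonom. Qed.

Lemma mvge_unshift p q a c (X : 'M[G]_(p, q)) :
  mvge (c%:~R + a) (gmonom R c *: X) -> mvge a X.
Proof.
move=> /(@mvge_shift _ _ _ (- c) _); rewrite scalerA -gmonomD addNr gmonom0 scale1r.
by rewrite addrA mulrNz addNr add0r.
Qed.

Lemma mvge_block p1 p2 q1 q2 a (X : 'M[G]_(p1, q1)) (Y : 'M_(p1, q2)) (Z : 'M_(p2, q1))
    (W : 'M_(p2, q2)) :
  mvge a (block_mx X Y Z W) <-> [/\ mvge a X, mvge a Y, mvge a Z & mvge a W].
Proof.
split=> [XP|[Xa Ya Za Wa] i j].
  split=> i j.
  - by have := XP (lshift _ i) (lshift _ j); rewrite block_mxEul.
  - by have := XP (lshift _ i) (rshift _ j); rewrite block_mxEur.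
  - by have := XP (rshift _ i) (lshift _ j); rewrite block_mxEdl.
  - by have := XP (rshift _ i) (rshift _ j); rewrite block_mxEdr.
case: (split_ordP i) => i' ->; case: (split_ordP j) => j' ->.
- by rewrite block_mxEul.
- by rewrite block_mxEur.
- by rewrite block_mxEdl.
- by rewrite block_mxEdr.
Qed.

Section One.
Context (s : {rmorphism G -> G}) (s0 : {rmorphism Q -> Q}) (ss0 : coefwise s s0).

(** Each substitution of the equation into itself raises the valuation of X by one, so every power
    of z divides X. Applied to upper right blocks, this turns commutation with a block triangular
    iterate into block triangularity. *)
Lemma intertwiner_eq0 p q (X : 'M[G]_(p, q)) (L : 'M[G]_p) (D : 'M[G]_q) :
  mvge 0 L -> mvge 1 D -> X = L *m map_mx s X *m D -> X = 0.
Proof.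
move=> L0 D1 XE; have [c Xc] := mvge_exists X; apply: mvge_all => a.
have X_k (k : nat) : mvge (c%:~R + k%:R) X.
  elim: k => [|k IHk]; first by rewrite addr0.
  rewrite XE -natr1 addrA; apply: mvgeM => //; rewrite -[_ + _]add0r.
  by apply: mvgeM => //; apply: (coefwise_mvge ss0).
apply: mvge_le (X_k `|a - c|%N).
by rewrite -[_%:R]/((Posz _)%:~R) -rmorphD ler_int; lia.
Qed.

Lemma bounded_change n n' (T : 'M[G]_n) (P : 'M[G]_(n', n)) (Pi : 'M[G]_(n, n')) g :
  P *m Pi = 1%:M -> Pi *m P = 1%:M ->
  (forall x, bounded s (map_mx s P *m T *m Pi) g x) -> forall x, bounded s T g x.
Proof.
move=> PPi PiP bT x; have [C xC] := bT (x *m Pi); have [c Pc] := mvge_exists P.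
exists (C - c%:~R) => q; have := mvgeM (xC q) Pc.
rewrite semilin_change // -mulmxA PiP mulmx1; apply: mvge_le; lra.
Qed.

Lemma resmx_map p q m (X : 'M[G]_(p, q)) :
  resmx (map_mx (rmorph_iter s m) X) = map_mx (rmorph_iter s0 m) (resmx X).
Proof. by apply/matrixP => i j; rewrite !mxE (coefwise_iter m ss0).1. Qed.

Lemma resmx_twpow n m k (N : 'M[G]_n) : mvge 0 N ->
  mvge 0 (twpow (rmorph_iter s m) N k) /\
  resmx (twpow (rmorph_iter s m) N k) = twpow (rmorph_iter s0 m) (resmx N) k.
Proof.
move=> N0; elim: k => [|k [IH1 IH2]].
  split; first exact: mvge1.
  by apply/matrixP => i j; rewrite !mxE; case: eqP; rewrite ?lcoef1 ?lcoef0.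
have tk0 : mvge 0 (map_mx (rmorph_iter s m) (twpow (rmorph_iter s m) N k)).
  exact: (coefwise_mvge (coefwise_iter m ss0)).
split; first by rewrite -[0]addr0; apply: mvgeM.
by rewrite resmxM // resmx_map IH2.
Qed.

(** The first [bp_n1] basis vectors span the part of slope [bp_mu], where the m-th iterate is z^e
    times an automorphism of the standard lattice. [bp_T2_pow] forces strictly larger slopes on the
    quotient, which orders the slopes in the induction. *)
Record bottom_piece n (T : 'M[G]_n) (I : Type) (H : I -> 'M[G]_n) (d : nat) : Type := BottomPiece {
  bp_mu : rat; bp_m : nat; bp_e : int; bp_n1 : nat; bp_n2 : nat;
  bp_P : 'M[G]_(bp_n1 + bp_n2, n); bp_Pi : 'M[G]_(n, bp_n1 + bp_n2);
  bp_T1 : 'M[G]_bp_n1; bp_T21 : 'M[G]_(bp_n2, bp_n1); bp_T2 : 'M[G]_bp_n2;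
  bp_H1 : I -> 'M[G]_bp_n1; bp_H21 : I -> 'M[G]_(bp_n2, bp_n1); bp_H2 : I -> 'M[G]_bp_n2;
  bp_m_gt0 : (0 < bp_m)%N; bp_dvd : (d %| bp_m)%N; bp_slope : bp_m%:R * bp_mu = bp_e%:~R;
  bp_max : forall g, (forall x, bounded s T g x) -> g <= bp_mu;
  bp_n1_gt0 : (0 < bp_n1)%N;
  bp_PPi : bp_P *m bp_Pi = 1%:M; bp_PiP : bp_Pi *m bp_P = 1%:M;
  bp_T' : map_mx s bp_P *m T *m bp_Pi = block_mx bp_T1 0 bp_T21 bp_T2;
  bp_H' : forall i, bp_P *m H i *m bp_Pi = block_mx (bp_H1 i) 0 (bp_H21 i) (bp_H2 i);
  bp_H1_int : forall i, mvge 0 (bp_H1 i);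
  bp_T1_pow : mvge bp_e%:~R (twpow s bp_T1 bp_m);
  bp_T1_unit : twpow s bp_T1 bp_m \in unitmx;
  bp_T1_inv : mvge (- bp_e%:~R) (invmx (twpow s bp_T1 bp_m));
  bp_T2_pow : mvge (bp_e + 1)%:~R (twpow s bp_T2 bp_m) }.
End One.
End BottomPiece.

Lemma ursubmx_intertwine (A : comPzRingType) n1 n2 (X Y : 'M[A]_(n1 + n2))
    (A1 A1' : 'M_n1) (B B' : 'M_(n2, n1)) (D D' : 'M_n2) :
  X *m block_mx A1 0 B D = block_mx A1' 0 B' D' *m Y ->
  ursubmx X *m D = A1' *m ursubmx Y.
Proof.
rewrite -{1}[X]submxK -{1}[Y]submxK !mulmx_block => /eq_block_mx[_ + _ _].
by rewrite mulmx0 add0r mul0mx addr0.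
Qed.

Section BottomPieceExists.
Context (R : idomainType).
Local Notation Q := {fraction R}.
Local Notation G := (gls R).
Context (s : {rmorphism G -> G}) (s0 : {rmorphism Q -> Q}) (ss0 : coefwise s s0).
Context (I : finType) (d : nat) (d_gt0 : (0 < d)%N).

Lemma mvge0M p q r (X : 'M[G]_(p, q)) (Y : 'M[G]_(q, r)) :
  mvge 0 X -> mvge 0 Y -> mvge 0 (X *m Y).
Proof. by move=> X0 Y0; rewrite -[0]addr0; apply: mvgeM. Qed.

Lemma bottom_piece_exists n (T : 'M[G]_n.+1) (H : I -> 'M[G]_n.+1) :
  T \in unitmx -> commuting_monoid s T H -> inhabited (bottom_piece s T H d).
Proof.
move=> T_unit monH; have [mu [m0 [e0 [m0_gt0 mu_e bT maxT]]]] := bottom_slope ss0 T_unit.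
have [F F_unit [NF_int HF_int]] := stable_lattice ss0 monH mu_e bT.
pose t := rmorph_iter s m0; pose t0 := rmorph_iter s0 m0.
pose TF := map_mx s F *m T *m invmx F; pose N0 := gmonom R (- e0) *: twpow s TF m0.
have FV : F *m invmx F = 1%:M := mulmxV F_unit.
have VF : invmx F *m F = 1%:M := mulVmx F_unit.
have TF_pow q : twpow s TF q = map_mx (rmorph_iter s q) F *m twpow s T q *m invmx F.
  by rewrite -(twpow_change s T q VF) mulmxK.
have N0_int : mvge 0 N0.
  apply: (@mvge_unshift _ _ _ _ e0); rewrite scalerA -gmonomD subrr gmonom0 scale1r addr0.
  by rewrite TF_pow.
have N0_pow k : twpow t N0 k = gmonom R (- (k%:Z * e0)) *: twpow s TF (k * m0).
  rewrite twpowZ; last exact: (coefwise_gmonom (coefwise_iter m0 ss0)).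
  by rewrite gmonomX mulrN twpow_iter.
have N0_pow' k : twpow s TF (k * m0) = gmonom R (k%:Z * e0) *: twpow t N0 k.
  by rewrite N0_pow scalerA -gmonomD subrr gmonom0 scale1r.
(* If a power vanished modulo z, all vectors would satisfy the bound (k e0 + 1) / (k m0), which
   exceeds mu, against the maximality of mu. *)
have res_neq0 k : twpow t0 (resmx N0) k != 0.
  have [tk0 tkE] := resmx_twpow ss0 m0 k N0_int; apply/eqP; rewrite -tkE => res0.
  have k0 : (0 < k)%N.
    rewrite lt0n; apply/eqP => k0; move: res0; rewrite k0 => /matrixP/(_ 0 0).
    by rewrite !mxE eqxx lcoef1 => /eqP; rewrite oner_eq0.
  have : mvge (k%:Z * e0 + 1)%:~R (twpow s TF (k * m0)).
    by rewrite N0_pow' rmorphD; apply: mvge_shift; apply: resmx_eq0.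
  have km0 : (0 < k * m0)%N by rewrite muln_gt0 k0.
  move=> /(bounded_twpow ss0 km0)/(bounded_change FV VF)/maxT.
  rewrite ler_pdivrMr ?ltr0n // natrM mulrCA [mu * _]mulrC mu_e rmorphD rmorphM /=.
  by rewrite gerDl ler10.
have [k [r [n2 [P0 [P0i [A [B [[k0 dk r0 A_unit] [P0P P0iP blockE]]]]]]]]] :=
  fitting_semilin d_gt0 res_neq0.
pose m := (k * m0)%N; pose e := k%:Z * e0.
(* The Fitting basis over the residue field is lifted by constant series. In the lifted basis the
   right block column is divisible by z. *)
pose Pc := map_mx (@gconst R) P0; pose Pci := map_mx (@gconst R) P0i.
have Pc_Pci : Pc *m Pci = 1%:M by rewrite -map_mxM P0P map_mx1.
have Pci_Pc : Pci *m Pc = 1%:M by rewrite -map_mxM P0iP map_mx1.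
have itE p q (X : 'M[Q]_(p, q)) : map_mx (rmorph_iter t0 k) X = map_mx (rmorph_iter s0 m) X.
  by apply/matrixP => i j; rewrite !mxE rmorph_iter_mul.
pose N1 := map_mx (rmorph_iter s m) Pc *m twpow t N0 k *m Pci.
have [tk_int tk_res] := resmx_twpow ss0 m0 k N0_int.
have Pc_int : mvge 0 Pc by exact: mvge_gconst.
have Pci_int : mvge 0 Pci by exact: mvge_gconst.
have sPc_int : mvge 0 (map_mx (rmorph_iter s m) Pc).
  exact: (coefwise_mvge (coefwise_iter m ss0)).
have N1_int : mvge 0 N1 by apply: mvge0M => //; exact: mvge0M.
have N1_res : resmx N1 = block_mx A 0 B 0.
  rewrite resmxM //; last exact: mvge0M.
  rewrite resmxM // tk_res (resmx_map ss0) !resmx_gconst -itE.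
  exact: blockE.
pose N1a := ulsubmx N1; pose N1y := ursubmx N1; pose N1b := dlsubmx N1; pose N1d := drsubmx N1.
have N1E : N1 = block_mx N1a N1y N1b N1d by rewrite submxK.
have [N1a_int N1y_int N1b_int N1d_int] : [/\ mvge 0 N1a, mvge 0 N1y, mvge 0 N1b & mvge 0 N1d].
  by apply/mvge_block; rewrite -N1E.
have [resA resY resB resD] : [/\ resmx N1a = A, resmx N1y = 0, resmx N1b = B & resmx N1d = 0].
  by have := N1_res; rewrite N1E /resmx map_block_mx => /eq_block_mx[].
have N1y1 : mvge 1 N1y by exact: resmx_eq0.
have N1d1 : mvge 1 N1d by exact: resmx_eq0.
have [N1a_unit N1a_inv] := integral_invmx N1a_int (etrans (congr1 (fun X => X \in unitmx) resA) A_unit).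
have ssm := coefwise_iter m ss0.
have [X X1 XE] := hensel_semilin ssm N1a_inv N1y1 N1b_int N1d1.
have X0 : mvge 0 X by exact: mvge_le X1.
pose sm := rmorph_iter s m.
have sX1 : mvge 1 (map_mx sm X) by exact: (coefwise_mvge ssm).
pose U : 'M[G]_(r + n2) := block_mx 1%:M X 0 1%:M.
pose Ui : 'M[G]_(r + n2) := block_mx 1%:M (- X) 0 1%:M.
have U_Ui : U *m Ui = 1%:M.
  rewrite mulmx_block !mul1mx !mulmx1 !mulmx0 !mul0mx !addr0 add0r addrC subrr.
  by rewrite -scalar_mx_block.
have Ui_U : Ui *m U = 1%:M by exact: mulmx1C.
pose A2 := N1a + map_mx sm X *m N1b; pose D2 := N1d - N1b *m X.
(* The fixed point equation in the form that cancels the upper right block in [N2E]. *)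
have NX : N1a *m X = N1y + map_mx sm X *m N1d - map_mx sm X *m N1b *m X.
  by rewrite {1}XE mulKVmx.
have N2E : map_mx sm U *m N1 *m Ui = block_mx A2 0 N1b D2.
  rewrite N1E map_block_mx map_mx0 !map_mx1 !mulmx_block !mul1mx !mul0mx !mulmx1 !mulmx0.
  rewrite !addr0 !add0r !mulmxN; congr block_mx; last by rewrite addrC.
  by rewrite mulmxDl NX subrK addNr.
have A2_int : mvge 0 A2.
  apply: mvgeD => //; apply: (@mvge_le _ _ _ _ (1 + 0)) => //; exact: mvgeM.
have A2_res : resmx A2 = A.
  rewrite resmxD resA mvge1_resmx ?addr0 //; rewrite -[1]addr0; exact: mvgeM.
have [A2_unit A2_inv] : A2 \in unitmx /\ mvge 0 (invmx A2).
  by apply: integral_invmx; rewrite ?A2_res.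
have D2_1 : mvge 1 D2.
  by apply: mvgeB => //; rewrite -[1]add0r; apply: mvgeM.
pose P := U *m Pc *m F; pose Pi := invmx F *m Pci *m Ui.
have P_Pi : P *m Pi = 1%:M.
  by rewrite /P /Pi !mulmxA -[_ *m F *m _]mulmxA FV mulmx1 -[_ *m Pc *m _]mulmxA Pc_Pci mulmx1.
have Pi_P : Pi *m P = 1%:M.
  by rewrite /P /Pi !mulmxA -[invmx F *m Pci *m Ui *m U]mulmxA Ui_U mulmx1
    -[invmx F *m Pci *m Pc]mulmxA Pci_Pc mulmx1.
pose T' := map_mx s P *m T *m Pi; pose H' i := P *m H i *m Pi.
have monH' : commuting_monoid s T' H' by exact: commuting_monoid_change.
have T'_pow : twpow s T' m = gmonom R e *: block_mx A2 0 N1b D2.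
  have -> : twpow s T' m = map_mx sm P *m twpow s T m *m Pi.
    by rewrite -(twpow_change s T m Pi_P) -[_ *m P *m Pi]mulmxA P_Pi mulmx1.
  rewrite -N2E scalemxAl scalemxAr scalemxAl scalemxAr -N0_pow' TF_pow /P /Pi !map_mxM.
  by rewrite !mulmxA.
pose z := gmonom R e; have z0 : z != 0 by exact: gmonom_neq0.
have pow_split j : s (gmonom R j) = gmonom R j by exact: (coefwise_gmonom ss0).
(* [T'] commutes, up to twists, with its own m-th iterate. Comparing upper right blocks gives an
   intertwiner equation for that of [T'], which therefore vanishes; the same argument serves the
   operators [H']. *)
have T'_block : T' = block_mx (ulsubmx T') 0 (dlsubmx T') (drsubmx T').
  rewrite -{1}[T']submxK; congr block_mx; apply: (intertwiner_eq0 ssm (L := invmx (map_mx s A2))) D2_1 _.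
    by rewrite -map_invmx; exact: (coefwise_mvge ss0).
  have : map_mx sm T' *m twpow s T' m = map_mx s (twpow s T' m) *m T' by rewrite -twpowSr.
  rewrite T'_pow map_mxZ pow_split -scalemxAr -scalemxAl => /(scalerI z0).
  rewrite map_block_mx map_mx0 => /ursubmx_intertwine; rewrite -map_ursubmx => E.
  have sA2_unit : map_mx s A2 \in unitmx by rewrite map_unitmx.
  by rewrite -mulmxA E; exact/esym/mulKmx.
have H'_block i : H' i = block_mx (ulsubmx (H' i)) 0 (dlsubmx (H' i)) (drsubmx (H' i)).
  rewrite -{1}[H' i]submxK; congr block_mx; apply: (intertwiner_eq0 ssm A2_inv D2_1).
  have := commuting_monoid_twpow m i monH'.
  rewrite T'_pow -scalemxAr -scalemxAl => /(scalerI z0).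
  move=> /ursubmx_intertwine; rewrite -map_ursubmx => E.
  by rewrite -mulmxA E mulKmx.
have [B' T'_pow'] := twpow_lblock s (ulsubmx T') (drsubmx T') (dlsubmx T') m.
have [T1_pow _ _ T2_pow] : [/\ twpow s (ulsubmx T') m = z *: A2, True, True &
    twpow s (drsubmx T') m = z *: D2].
  have := T'_pow'; rewrite -T'_block T'_pow scale_block_mx => /eq_block_mx[-> _ _ ->].
  by [].
have H'_int i : mvge 0 (H' i).
  rewrite /H' (_ : _ *m Pi = U *m Pc *m (F *m H i *m invmx F) *m Pci *m Ui); last by rewrite !mulmxA.
  have U_int : mvge 0 U by apply/mvge_block; split=> //; [exact: mvge1 | exact: mvge0 | exact: mvge1].
  have Ui_int : mvge 0 Ui.
    by apply/mvge_block; split=> //; [exact: mvge1 | exact: mvgeN | exact: mvge0 | exact: mvge1].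
  by apply: mvge0M => //; apply: mvge0M => //; apply: mvge0M => //; exact: mvge0M.
constructor; apply: (@BottomPiece R s n.+1 T I H d mu m e r n2 P Pi (ulsubmx T') (dlsubmx T')
  (drsubmx T') (fun i => ulsubmx (H' i)) (fun i => dlsubmx (H' i)) (fun i => drsubmx (H' i))) => //.
- by rewrite muln_gt0 k0.
- exact: dvdn_mulr.
- by rewrite /m /e natrM rmorphM /= -mulrA mu_e.
- by move=> i; have := H'_int i; rewrite {1}H'_block => /mvge_block[].
- by rewrite T1_pow -[e%:~R]addr0; apply: mvge_shift.
- by rewrite T1_pow unitmxZ ?unitfE.
- rewrite T1_pow invmxZ ?unitmxZ ?unitfE // -gmonomN -[- _]addr0 -rmorphN /=.
  exact: mvge_shift.
- by rewrite T2_pow rmorphD; apply: mvge_shift.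
Qed.
End BottomPieceExists.

(** * All slopes over the field of series, by induction on the rank *)

Section SlopeForm.
Context (R : idomainType).
Local Notation Q := {fraction R}.
Local Notation G := (gls R).
Context (s : {rmorphism G -> G}) (s0 : {rmorphism Q -> Q}) (ss0 : coefwise s s0).
Context (I : finType) (d : nat) (d_gt0 : (0 < d)%N).

(* [T'] and [H'] are the matrices of the semilinear map and of the commuting operators
   in the basis [P]; the basis vectors of slope at most [g] span the step [g] of the
   filtration, and [W] inverts the block of slope [sl i0] of a power of [T']. *)
Definition triangular n (sl : 'I_n -> rat) (A : pzRingType) (X : 'M[A]_n) : Prop :=
  forall i j, X i j <> 0 -> sl j <= sl i.

Record slope_form n n' (T : 'M[G]_n) (H : I -> 'M[G]_n)
    (P : 'M[G]_(n', n)) (Pi : 'M[G]_(n, n')) (T' Z : 'M[G]_n') (H' : I -> 'M[G]_n')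
    (sl : 'I_n' -> rat) : Prop := SlopeForm {
  slf_PPi : P *m Pi = 1%:M;
  slf_PiP : Pi *m P = 1%:M;
  slf_T' : map_mx s P *m T *m Pi = T';
  slf_H' : forall i, P *m H i *m Pi = H' i;
  slf_Z : Z *m T' = 1%:M;
  slf_triT : triangular sl T';
  slf_triZ : triangular sl Z;
  slf_triH : forall i, triangular sl (H' i);
  slf_intH : forall k i j, sl i = sl j -> vge 0 (H' k i j);
  slf_pure : forall i0, exists (m : nat) (e : int) (W : 'M[G]_n'),
    [/\ (0 < m)%N, (m * d)%:R * sl i0 = e%:~R,
        forall i j, sl i = sl i0 -> sl j = sl i0 -> vge e%:~R (twpow s T' (m * d) i j),
        forall i j, vge (- e%:~R) (W i j) &
        forall i j, sl i = sl i0 -> sl j = sl i0 ->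
          \sum_(l | sl l == sl i0) W i l * twpow s T' (m * d) l j = (i == j)%:R];
  slf_bound : forall g, (forall x, bounded s T g x) -> forall i, g <= sl i }.

Lemma slope_form_exists n (T : 'M[G]_n) (H : I -> 'M[G]_n) :
  T \in unitmx -> commuting_monoid s T H ->
  exists n' P Pi T' Z H' sl, @slope_form n n' T H P Pi T' Z H' sl.
Proof.
elim/ltn_ind: n T H => -[|n] IH T H T_unit monH.
  have mx0 (X Y : 'M[G]_0) : X = Y by rewrite (flatmx0 X) (flatmx0 Y).
  exists 0%N, 1%:M, 1%:M, T, (invmx T), H, (fun=> 0); split; try (move=> *; exact: mx0).
  - by move=> [].
  - by move=> [].
  - by move=> ? [].
  - by move=> ? [].
  - by move=> [].
  - by move=> ? ? [].
have [[mu m e n1 n2 P Pi T1 T21 T2 H1 H21 H2 m0 dm mu_e maxT n1_gt0 PPi PiP T'E H'E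
  H1_int T1_pow T1_punit T1_inv T2_pow]] := bottom_piece_exists ss0 d_gt0 T_unit monH.
have n1n2 : (n1 + n2 = n.+1)%N.
  apply/eqP; rewrite eqn_leq.
  have := mulmx_max_rank P Pi; rewrite PPi mxrank1 => ->.
  by have := mulmx_max_rank Pi P; rewrite PiP mxrank1.
have T'_unit : block_mx T1 0 T21 T2 \in unitmx.
  have : block_mx T1 0 T21 T2 *m (P *m invmx T *m map_mx s Pi) = 1%:M.
    rewrite -T'E -!mulmxA (mulmxA Pi) PiP mul1mx (mulmxA T) mulmxV // mul1mx.
    by rewrite -map_mxM PPi map_mx1.
  by move=> /mulmx1_unit[T'_unit _]; exact: T'_unit.
have [T1_unit T2_unit] : T1 \in unitmx /\ T2 \in unitmx.
  by move: T'_unit; rewrite !unitmxE det_lblock unitrM => /andP[].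
have monH2 : commuting_monoid s T2 H2.
  apply: (@commuting_monoid_drblock _ s I _ _ T1 T2 T21 H1 H21 H2).
  have := commuting_monoid_change PPi PiP monH; rewrite T'E.
  by rewrite (_ : (fun i => _) = (fun i => block_mx (H1 i) 0 (H21 i) (H2 i))) //; apply/funext.
have [|n' [P2 [P2i [T2' [Z2 [H2' [sl2 [P2P P2iP T2'E H2'E Z2T triT triZ triH intH pure bound]]]]]]]] :=
  IH n2 _ T2 H2 T2_unit monH2; first by rewrite -n1n2; lia.
(* The slopes of the quotient exceed mu strictly, so no slope class meets both blocks, and the lower
   left block is compatible with [triangular]. *)
have mu_lt j : mu < sl2 j.
  apply: lt_le_trans (bound _ (bounded_twpow ss0 m0 T2_pow) j).
  by rewrite ltr_pdivlMr ?ltr0n // mulrC mu_e rmorphD /= ltrDl.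
pose sl (i : 'I_(n1 + n')) := row_mx (const_mx mu) (\row_j sl2 j) 0 i.
have sll i : sl (lshift n' i) = mu by rewrite /sl row_mxEl mxE.
have slr j : sl (rshift n1 j) = sl2 j by rewrite /sl row_mxEr mxE.
pose D := block_mx 1%:M 0 0 P2 : 'M[G]_(n1 + n', n1 + n2).
pose Di := block_mx 1%:M 0 0 P2i : 'M[G]_(n1 + n2, n1 + n').
have DDi : D *m Di = 1%:M.
  by rewrite mulmx_block !mul1mx !mulmx0 !mul0mx !addr0 add0r P2P -scalar_mx_block.
have DiD : Di *m D = 1%:M.
  by rewrite mulmx_block !mul1mx !mulmx0 !mul0mx !addr0 add0r P2iP -scalar_mx_block.
have lower_tri (X1 : 'M[G]_n1) X21 (X2 : 'M[G]_n') : triangular sl2 X2 -> triangular sl (block_mx X1 0 X21 X2).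
  move=> triX2 i j; case: (split_ordP i) => i' ->; case: (split_ordP j) => j' ->.
  - by rewrite !sll.
  - by rewrite block_mxEur mxE.
  - by rewrite sll slr ltW.
  - by rewrite block_mxEdr !slr; exact: triX2.
pose T21' := map_mx s P2 *m T21.
have T''E : map_mx s (D *m P) *m T *m (Pi *m Di) = block_mx T1 0 T21' T2'.
  rewrite map_mxM mulmxA -2!(mulmxA (map_mx s D)) T'E map_block_mx !map_mx0 map_mx1.
  by rewrite !mulmx_block !mul1mx !mulmx0 !mul0mx !mulmx1 !addr0 !add0r T2'E mul0mx.
exists (n1 + n')%N, (D *m P), (Pi *m Di), (block_mx T1 0 T21' T2'),
  (block_mx (invmx T1) 0 (- (Z2 *m T21' *m invmx T1)) Z2),
  (fun i => block_mx (H1 i) 0 (P2 *m H21 i) (H2' i)), sl; split=> //.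
- by rewrite mulmxA -(mulmxA D) PPi mulmx1.
- by rewrite mulmxA -(mulmxA Pi) DiD mulmx1.
- move=> i; rewrite mulmxA -2!(mulmxA D) H'E.
  by rewrite !mulmx_block !mul1mx !mulmx0 !mul0mx !mulmx1 !addr0 !add0r H2'E mul0mx.
- rewrite mulmx_block mulVmx // !mulmx0 !mul0mx !addr0 add0r Z2T.
  by rewrite mulNmx mulmxKV // addNr -scalar_mx_block.
- exact: lower_tri.
- exact: lower_tri.
- by move=> i; exact: lower_tri.
- move=> k i j; case: (split_ordP i) => i' ->; case: (split_ordP j) => j' ->.
  + by rewrite block_mxEul => _; exact: H1_int.
  + by rewrite sll slr => E; have := mu_lt j'; rewrite E ltxx.
  + by rewrite sll slr => E; have := mu_lt i'; rewrite E ltxx.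
  + by rewrite block_mxEdr !slr; exact: intH.
- move=> i0; case: (split_ordP i0) => i1 ->.
  + exists (m %/ d)%N, e, (block_mx (invmx (twpow s T1 m)) 0 0 0).
    have [B TqE] := twpow_lblock s T1 T2' T21' m.
    rewrite divnK // TqE !sll; split=> //.
    * by rewrite divn_gt0 // dvdn_leq.
    * move=> i j; case: (split_ordP i) => i' ->; case: (split_ordP j) => j' ->.
      - by rewrite block_mxEul => _ _; exact: T1_pow.
      - by rewrite sll slr => _ E; have := mu_lt j'; rewrite E ltxx.
      - by rewrite slr => E; have := mu_lt i'; rewrite E ltxx.
      - by rewrite slr => E; have := mu_lt i'; rewrite E ltxx.
    * by apply/mvge_block; split=> //; exact: mvge0.
    * move=> i j; case: (split_ordP i) => i' ->; last first.
        by rewrite slr => E; have := mu_lt i'; rewrite E ltxx.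
      case: (split_ordP j) => j' ->; last first.
        by rewrite slr => _ E; have := mu_lt j'; rewrite E ltxx.
      move=> _ _; rewrite big_split_ord /= [X in _ + X]big1 ?addr0; last first.
        by move=> l; rewrite slr => /eqP E; have := mu_lt l; rewrite E ltxx.
      rewrite (eq_bigl xpredT); last by move=> l; rewrite sll eqxx.
      have /matrixP/(_ i' j') := mulVmx T1_punit; rewrite !mxE (inj_eq (@lshift_inj _ _)) => <-.
      by apply: eq_bigr => l _; rewrite !block_mxEul.
  + have [m' [e' [W [m'0 m'e TW_int W_int WT]]]] := pure i1.
    exists m', e', (block_mx 0 0 0 W).
    have [B TqE] := twpow_lblock s T1 T2' T21' (m' * d).
    rewrite TqE !slr; split=> //.
    * move=> i j; case: (split_ordP i) => i' ->; case: (split_ordP j) => j' ->.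
      - by rewrite sll => E; have := mu_lt i1; rewrite E ltxx.
      - by rewrite sll => E; have := mu_lt i1; rewrite E ltxx.
      - by rewrite sll => _ E; have := mu_lt i1; rewrite E ltxx.
      - by rewrite block_mxEdr !slr; exact: TW_int.
    * by apply/mvge_block; split=> //; exact: mvge0.
    * move=> i j; case: (split_ordP i) => i' ->.
        by rewrite sll => E; have := mu_lt i1; rewrite E ltxx.
      case: (split_ordP j) => j' ->.
        by rewrite sll => _ E; have := mu_lt i1; rewrite E ltxx.
      rewrite !slr => ii1 ji1; rewrite big_split_ord /= [X in X + _]big1 ?add0r; last first.
        by move=> l; rewrite sll => /eqP E; have := mu_lt i1; rewrite E ltxx.
      rewrite (inj_eq (@rshift_inj _ _)) -WT //.
      by apply: eq_big => [l|l _]; rewrite ?slr ?block_mxEdr.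
- move=> g gT i; have := maxT g gT; case: (split_ordP i) => i' ->; rewrite ?sll ?slr //.
  by move=> gmu; apply: le_trans gmu (ltW _).
Qed.
End SlopeForm.

(** * The trace form of a finite extension of a finite field *)

Section Trace.
Context (Fq : finFieldType) (k : fieldExtType Fq).
Local Notation d := (\dim {:k}).
Local Notation q := #|Fq|.

Lemma card_finfield_ext : #|finvect_type k| = (q ^ d)%N.
Proof.
pose c := Vector.class (k : vectType Fq).
by rewrite -(@card_vspacef Fq (finvect_type k) c) (@card_vspace Fq (finvect_type k) c).
Qed.

Lemma expf_card_ext (x : k) : x ^+ (q ^ d) = x.
Proof. by rewrite -card_finfield_ext; exact: (@expf_card (FinFieldExtType k)). Qed.

(** X^q - X is the product of the X - c over all c in F_q, so it has no other root in k. *)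
Lemma fixed_in_base (x : k) : x ^+ q = x -> exists c : Fq, x = c%:A.
Proof.
move=> xq; have := congr1 (fun p => (map_poly (in_alg k) p).[x]) (finField_genPoly Fq).
rewrite rmorphB /= map_polyXn map_polyX !hornerE xq subrr rmorph_prod.
rewrite horner_prod => /esym/eqP; rewrite prodf_seq_eq0 => /hasP[c _ /=].
by rewrite rmorphB /= map_polyX map_polyC !hornerE subr_eq0 => /eqP->; exists c.
Qed.

Definition trace (x : k) : k := \sum_(i < d) x ^+ (q ^ i).

Lemma frobq_iterE i (x : k) : rmorph_iter (frobq_of (in_alg k)) i x = x ^+ (q ^ i).
Proof.
elim: i => [|i IHi]; first by rewrite expn0 expr1.
by rewrite rmorph_iterS IHi expnSr exprM.
Qed.

Lemma traceD x y : trace (x + y) = trace x + trace y.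
Proof.
by rewrite -big_split; apply: eq_bigr => i _; rewrite -!frobq_iterE rmorphD.
Qed.

Lemma traceZ (c : Fq) x : trace (c *: x) = c *: trace x.
Proof.
rewrite scaler_sumr; apply: eq_bigr => i _; rewrite exprZn; congr (_ *: _).
by elim: (nat_of_ord i) => [|j IHj]; rewrite ?expr1 // expnSr exprM IHj expf_card.
Qed.

Lemma trace_in_base x : exists c : Fq, trace x = c%:A.
Proof.
apply: fixed_in_base; rewrite -[LHS]/(frobq_of (in_alg k) (trace x)) rmorph_sum /=.
have -> : \sum_(i < d) frobq_of (in_alg k) (x ^+ (q ^ i)) = \sum_(i < d) x ^+ (q ^ i.+1).
  by apply: eq_bigr => i _; rewrite /frobq_of -exprM -expnSr.
have d0 : (0 < d)%N by rewrite adim_gt0.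
rewrite /trace -(prednK d0) big_ord_recr [RHS]big_ord_recl /= prednK // expf_card_ext addrC.
by rewrite expn0 expr1.
Qed.

(** Otherwise a nonzero polynomial of degree q^(d-1) would vanish at all q^d elements of k. *)
Lemma trace_neq0 : exists x, trace x != 0.
Proof.
apply: contrapT => /forallNP tr0.
have d0 : (0 < d)%N by rewrite adim_gt0.
have q1 : (1 < q)%N := finNzRing_gt1 Fq.
pose p : {poly k} := \sum_(i < d) 'X^(q ^ i).
have size_p : (size p <= (q ^ d.-1).+1)%N.
  apply: (leq_trans (size_sum _ _ _)); apply/bigmax_leqP => i _.
  by rewrite size_polyXn ltnS leq_exp2l // -ltnS prednK.
have p0 : p != 0.
  apply/eqP => /(congr1 (fun r : {poly k} => r`_(q ^ d.-1))).
  rewrite coef0 coef_sum.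
  have dl : (d.-1 < d)%N by rewrite prednK.
  rewrite (bigD1 (Ordinal dl)) //= coefXn eqxx big1 ?addr0 => [/eqP|i id1].
    by rewrite oner_eq0.
  rewrite coefXn eqn_exp2l //; case: eqP => // E; case/eqP: id1; exact: val_inj.
have roots : all (root p) (enum (finvect_type k) : seq k).
  apply/allP => x _; rewrite /root horner_sum.
  have /negP := tr0 x; rewrite negbK => /eqP tr; rewrite -[X in _ == X]tr; apply/eqP.
  by apply: eq_bigr => i _; rewrite hornerXn.
have := leq_trans (max_poly_roots p0 roots (enum_uniq _)) size_p.
rewrite -(cardE (finvect_type k)) card_finfield_ext ltnS leq_exp2l //.
by rewrite -ltnS prednK // ltnn.
Qed.

(** [w] is a basis and [w'] its dual for the trace form, nondegenerate because the trace is not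
    zero. The identity for the sum of the w_j w'_j provides the separability idempotent. *)
Lemma trace_dual_bases : exists (w w' : 'I_d -> k) (l : k -> Fq),
  [/\ forall a x y, l (a *: x + y) = a * l x + l y,
      forall x, x = \sum_j l (w' j * x) *: w j,
      forall x, x = \sum_j l (w j * x) *: w' j,
      \sum_j w j * w' j = 1 &
      forall i j, l (w' j * w i) = (i == j)%:R].
Proof.
have [l lE] := boolp.choice trace_in_base.
have inA_inj : injective (fun c : Fq => c%:A : k) by exact: (fmorph_inj (in_alg k)).
have l_lin a x y : l (a *: x + y) = a * l x + l y.
  by apply: inA_inj; rewrite -lE traceD traceZ !lE scalerDl scalerA.
have lD x y : l (x + y) = l x + l y by have := l_lin 1 x y; rewrite scale1r mul1r.
have l0 : l 0 = 0 by apply: (addIr (l 0)); rewrite -lD !add0r.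
have lZ a x : l (a *: x) = a * l x by have := l_lin a x 0; rewrite l0 !addr0.
have lB x y : l (x - y) = l x - l y by rewrite lD -scaleN1r lZ mulN1r.
have l_sum (F : 'I_d -> k) : l (\sum_j F j) = \sum_j l (F j).
  exact: (big_morph l lD l0).
pose w (i : 'I_d) := (vbasis {:k})`_i.
have wE x : x = \sum_i coord (vbasis {:k}) i x *: w i.
  by apply: coord_vbasis; rewrite memvf.
have nondeg x : (forall i, l (w i * x) = 0) -> x = 0.
  move=> lx; apply/eqP/negPn/negP => x0; have [u] := trace_neq0.
  rewrite lE -(divfK x0 u) {1}[u / x]wE mulr_suml l_sum big1 ?scale0r ?eqxx // => i _.
  by rewrite -scalerAl lZ lx mulr0.
pose M := \matrix_(i, j) l (w i * w j).
have M_unit : M \in unitmx.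
  rewrite -row_free_unit -kermx_eq0; apply/eqP/row_matrixP => r; rewrite row0.
  set v := row r _; have vM : v *m M = 0 by apply/sub_kermxP; exact: row_sub.
  have x0 : \sum_i v 0 i *: w i = 0.
    apply: nondeg => j; rewrite mulr_sumr l_sum.
    transitivity ((v *m M) 0 j); last by rewrite vM mxE.
    rewrite mxE; apply: eq_bigr => i _.
    by rewrite -scalerAr lZ [M i j]mxE [w i * _]mulrC.
  have /freeP w_free := basis_free (vbasisP {:k}).
  by apply/rowP => i; rewrite w_free // mxE.
pose w' j := \sum_i invmx M i j *: w i.
have dual i j : l (w i * w' j) = (i == j)%:R.
  have /matrixP/(_ i j) := mulmxV M_unit; rewrite !mxE => <-.
  rewrite mulr_sumr l_sum; apply: eq_bigr => t _.
  by rewrite -scalerAr lZ mxE mulrC.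
exists w, w', l; split=> //.
- move=> x; rewrite {1}[x]wE; apply: eq_bigr => j _; congr (_ *: _).
  rewrite {2}[x]wE mulr_sumr l_sum (bigD1 j) //= big1 ?addr0.
    by rewrite -scalerAr lZ mulrC [w' j * _]mulrC dual eqxx mul1r.
  by move=> i ij; rewrite -scalerAr lZ [w' j * _]mulrC dual (negPf ij) mulr0.
- move=> x; apply/eqP; rewrite -subr_eq0; apply/eqP/nondeg => i.
  rewrite mulrBr lB mulr_sumr l_sum (bigD1 i) //= big1 ?addr0.
    by rewrite -scalerAr lZ dual eqxx mulr1 subrr.
  by move=> j ji; rewrite -scalerAr lZ dual eq_sym (negPf ji) mulr0.
(* Duality says that the transposed matrix of conjugates of [w] is a one-sided inverse of that of
   [w']. The product in the other order is then 1 too, and its entry at the identity conjugate is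
   the sum in question. *)
- pose W := \matrix_(i < d, j < d) w j ^+ (q ^ i).
  pose W' := \matrix_(i < d, j < d) w' j ^+ (q ^ i).
  have WW : W^T *m W' = 1%:M.
    apply/matrixP => i j; rewrite !mxE; transitivity (trace (w i * w' j)).
      by apply: eq_bigr => t _; rewrite !mxE exprMn.
    by rewrite lE dual; case: eqP => _; rewrite ?scale1r ?scale0r.
  have d0 : (0 < d)%N by rewrite adim_gt0.
  have /matrixP/(_ (Ordinal d0) (Ordinal d0)) := mulmx1C WW; rewrite !mxE eqxx => E.
  by apply: etrans E; apply: eq_bigr => j _; rewrite !mxE expn0 !expr1 mulrC.
- by move=> i j; rewrite mulrC.
Qed.
End Trace.

(** * Modules with a basis over a subring *)

Section Averaging.
Context (A E : comPzRingType) (io : {rmorphism A -> E}) (d : nat) (w w' : 'I_d -> E).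

(* [E] is spanned by [w] over [A], and [\sum_j w j (x) w' j] is a separability
   idempotent of [E] over [A]; the [c l j i] are the structure constants. *)
Definition separable_pair (c : 'I_d -> 'I_d -> 'I_d -> A) : Prop :=
  [/\ forall x, exists a : 'I_d -> A, x = \sum_j io (a j) * w j,
      \sum_j w j * w' j = 1,
      forall l j, w l * w j = \sum_i io (c l j i) * w i &
      forall l i, w' i * w l = \sum_j io (c l j i) * w' j].

Context (c : 'I_d -> 'I_d -> 'I_d -> A) (sep : separable_pair c).
Context (N : lmodType E) (m : nat) (y : 'I_m -> N) (co : 'I_m -> N -> A).
Hypothesis co_lin : forall i a x x', co i (io a *: x + x') = a * co i x + co i x'.
Hypothesis coK : forall x, x = \sum_i io (co i x) *: y i.

Lemma dual_basis_fg : finitely_generated N.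
Proof. by exists m, y => x; exists (fun i => io (co i x)); exact: coK. Qed.

(* An [A]-linear section becomes [E]-linear after averaging it over the
   separability idempotent. *)
Lemma dual_basis_projective : projective N.
Proof.
have [Espan ww' wM w'M] := sep.
move=> N1 P p f p_surj; have [y1 y1E] := boolp.choice (fun i => p_surj (f (y i))).
have pZ a u : p (a *: u) = a *: p u by exact: linearZ_LR.
have fZ a u : f (a *: u) = a *: f u by exact: linearZ_LR.
pose h0 (x : N) : N1 := \sum_i io (co i x) *: y1 i.
have h0E x : p (h0 x) = f x.
  rewrite /h0 linear_sum [x in RHS]coK linear_sum; apply: eq_bigr => i _.
  by rewrite pZ fZ y1E.
have h0_lin a x x' : h0 (io a *: x + x') = io a *: h0 x + h0 x'.
  rewrite /h0 scaler_sumr -big_split; apply: eq_bigr => i _ /=.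
  by rewrite co_lin rmorphD rmorphM scalerDl scalerA.
have h0D x x' : h0 (x + x') = h0 x + h0 x'.
  by rewrite -[x in LHS]scale1r -(rmorph1 io) h0_lin rmorph1 scale1r.
have h00 : h0 0 = 0 by apply: (addIr (h0 0)); rewrite -h0D !add0r.
have h0Z a x : h0 (io a *: x) = io a *: h0 x by rewrite -[_ *: x]addr0 h0_lin h00 addr0.
have h0_sum (F : 'I_d -> N) : h0 (\sum_j F j) = \sum_j h0 (F j) by exact: (big_morph h0 h0D h00).
(* The average of [h0]. It is still a section over f: p and f are E-linear, p (h0 x) = f x, and the
   w_j w'_j sum to 1. *)
pose h (x : N) : N1 := \sum_j w j *: h0 (w' j *: x).
have hD x x' : h (x + x') = h x + h x'.
  by rewrite /h -big_split; apply: eq_bigr => j _; rewrite scalerDr h0D scalerDr.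
(* The structure constants move [w l] from the second tensor factor of the idempotent to the
   first. *)
have hw l x : h (w l *: x) = w l *: h x.
  rewrite /h scaler_sumr.
  transitivity (\sum_i \sum_j (io (c l j i) * w i) *: h0 (w' j *: x)).
    apply: eq_bigr => i _; rewrite scalerA w'M scaler_suml h0_sum scaler_sumr.
    by apply: eq_bigr => j _; rewrite -scalerA h0Z scalerA mulrC.
  rewrite exchange_big; apply: eq_bigr => j _ /=.
  by rewrite scalerA wM scaler_suml.
have hA a x : h (io a *: x) = io a *: h x.
  rewrite /h scaler_sumr; apply: eq_bigr => j _.
  by rewrite scalerA mulrC -scalerA h0Z scalerA mulrC -scalerA.
have h_0 : h 0 = 0 by apply: (addIr (h 0)); rewrite -hD !add0r.
have h_sum (F : 'I_d -> N) : h (\sum_j F j) = \sum_j h (F j) by exact: (big_morph h hD h_0).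
have h_lin : linear h.
  move=> e x x'; rewrite hD; congr (_ + _); have [a ->] := Espan e.
  rewrite !scaler_suml h_sum; apply: eq_bigr => j _.
  by rewrite -!scalerA hA hw.
pose hM := GRing.isLinear.Build E N N1 *:%R h h_lin.
pose hL : {linear N -> N1} := HB.pack h hM.
exists hL => x; rewrite -[hL x]/(h x) /h linear_sum -[x in RHS]scale1r -ww' scaler_suml linear_sum.
by apply: eq_bigr => j _; rewrite pZ h0E -scalerA !fZ.
Qed.
End Averaging.

Section FilteredBasisDef.
Context (A E : comPzRingType) (io : {rmorphism A -> E}) (M : lmodType E).

(* The last condition says that the basis vectors of slope at most any bound span an
   [E]-submodule. *)
Record fbasis := FBasis {
  fb_n : nat;
  fb_b : 'I_fb_n -> M;
  fb_co : M -> 'rV[A]_fb_n;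
  fb_lin : forall a x y, fb_co (io a *: x + y) = a *: fb_co x + fb_co y;
  fb_K : forall x, x = \sum_i io (fb_co x 0 i) *: fb_b i;
  fb_bK : forall v : 'rV[A]_fb_n, fb_co (\sum_i io (v 0 i) *: fb_b i) = v;
  fb_sl : 'I_fb_n -> rat;
  fb_tri : forall e i l, fb_co (e *: fb_b i) 0 l != 0 -> fb_sl l <= fb_sl i
}.

(** Downward closed sets of slopes: the bounds <= a and < a and the empty set make steps and
    subquotients instances of one construction. *)
Record segment := Segment {
  seg_set :> pred rat;
  seg_down : forall g h : rat, g <= h -> seg_set h -> seg_set g
}.

End FilteredBasisDef.
Arguments fb_n {A E io M} f.
Arguments fb_b {A E io M} f.
Arguments fb_co {A E io M} f.
Arguments fb_sl {A E io M} f.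
Arguments fb_lin {A E io M} f.
Arguments fb_K {A E io M} f.
Arguments fb_bK {A E io M} f.
Arguments fb_tri {A E io M} f.

Section FilteredBasis.
Context (A E : comPzRingType) (io : {rmorphism A -> E}) (M : lmodType E).
Context (B : fbasis io M).
Local Notation n := (fb_n B).
Local Notation b := (fb_b B).
Local Notation co := (fb_co B).
Local Notation sl := (fb_sl B).
Implicit Types (x y : M) (D : segment).

Lemma coD x y : co (x + y) = co x + co y.
Proof. by rewrite -[x in LHS]scale1r -(rmorph1 io) fb_lin scale1r. Qed.

Lemma co0 : co 0 = 0.
Proof. by apply: (addIr (co 0)); rewrite -coD !add0r. Qed.

Lemma coZ a x : co (io a *: x) = a *: co x.
Proof. by rewrite -[_ *: x]addr0 fb_lin co0 addr0. Qed.

Lemma coN x : co (- x) = - co x.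
Proof. by rewrite -scaleN1r -(rmorph1 io) -rmorphN coZ scaleN1r. Qed.

Lemma coB x y : co (x - y) = co x - co y.
Proof. by rewrite coD coN. Qed.

Lemma co_sum (I : Type) (r : seq I) (P : pred I) (F : I -> M) :
  co (\sum_(i <- r | P i) F i) = \sum_(i <- r | P i) co (F i).
Proof. exact: (big_morph co coD co0). Qed.

Lemma co_inj : injective co.
Proof. by move=> x y xy; rewrite (fb_K B x) (fb_K B y) xy. Qed.

Lemma co_b i : co (b i) = delta_mx 0 i.
Proof.
rewrite -[RHS](fb_bK B) (bigD1 i) //= big1 ?addr0; last first.
  by move=> j ji; rewrite mxE (negPf ji) andbF rmorph0 scale0r.
by rewrite mxE !eqxx rmorph1 scale1r.
Qed.

Definition fsupp D x : Prop := forall i, co x 0 i != 0 -> D (sl i).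

Lemma fsupp0 D : fsupp D 0.
Proof. by move=> i; rewrite co0 mxE eqxx. Qed.

Lemma fsuppD D x y : fsupp D x -> fsupp D y -> fsupp D (x + y).
Proof.
move=> xD yD i; rewrite coD mxE; have [x0|/xD //] := eqVneq (co x 0 i) 0.
by rewrite x0 add0r => /yD.
Qed.

Lemma fsupp_sum D (I : Type) (r : seq I) (P : pred I) (F : I -> M) :
  (forall i, P i -> fsupp D (F i)) -> fsupp D (\sum_(i <- r | P i) F i).
Proof. by move=> FD; elim/big_ind: _ => //; [exact: fsupp0 | exact: fsuppD]. Qed.

Lemma fsuppZA D a x : fsupp D x -> fsupp D (io a *: x).
Proof.
move=> xD i; rewrite coZ mxE => ax; apply: xD; apply: contra_neq ax => ->.
by rewrite mulr0.
Qed.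

Lemma fsupp_ge D x (z : 'I_n -> M) : fsupp D x ->
  (forall i, D (sl i) -> fsupp D (z i)) -> fsupp D (\sum_i io (co x 0 i) *: z i).
Proof.
move=> xD zD; apply: fsupp_sum => i _; have [->|xi] := eqVneq (co x 0 i) 0.
  by rewrite rmorph0 scale0r; exact: fsupp0.
by apply/fsuppZA/zD/xD.
Qed.

Lemma fsuppZ D e x : fsupp D x -> fsupp D (e *: x).
Proof.
move=> xD; rewrite [x in e *: x](fb_K B) scaler_sumr.
rewrite (eq_bigr (fun i => io (co x 0 i) *: (e *: b i))).
  apply: fsupp_ge => // i Di l /fb_tri li; exact: seg_down li Di.
by move=> i _; rewrite scalerA mulrC -scalerA.
Qed.

(** The representative of x modulo M_D in the span of the basis vectors whose slope is not in D. *)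
Definition ftrunc D x : M := \sum_(i | ~~ D (sl i)) io (co x 0 i) *: b i.

Lemma co_ftrunc D x i : co (ftrunc D x) 0 i = if D (sl i) then 0 else co x 0 i.
Proof.
rewrite /ftrunc co_sum summxE (eq_bigr (fun j => co x 0 j * (j == i)%:R)); last first.
  by move=> j _; rewrite coZ co_b !mxE eqxx eq_sym.
case: ifP => Di.
  rewrite big1 // => j; case: eqVneq => [->|_ _]; first by rewrite Di.
  by rewrite mulr0.
rewrite (bigD1 i) ?Di //= eqxx mulr1 big1 ?addr0 // => j /andP[_ /negPf->].
by rewrite mulr0.
Qed.

Lemma ftruncP D x y : (forall i, co y 0 i = if D (sl i) then 0 else co x 0 i) -> ftrunc D x = y.
Proof. by move=> yE; apply: co_inj; apply/rowP => i; rewrite co_ftrunc yE. Qed.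

Lemma ftruncD D x y : ftrunc D (x + y) = ftrunc D x + ftrunc D y.
Proof.
by apply: ftruncP => i; rewrite !coD !mxE !co_ftrunc; case: ifP; rewrite ?addr0.
Qed.

Lemma ftrunc_eq0 D x : fsupp D x -> ftrunc D x = 0.
Proof.
move=> xD; apply: ftruncP => i; rewrite co0 mxE; case: ifPn => // /negP Di.
by apply/esym/eqP/negPn/negP => /xD.
Qed.

Lemma ftrunc_supp D x : fsupp D (x - ftrunc D x).
Proof.
move=> i; rewrite coB !mxE co_ftrunc; case: ifP => // _.
by rewrite subrr eqxx.
Qed.

Definition fstable (f : M -> M) : Prop :=
  (forall x y, f (x + y) = f x + f y) /\ forall D x, fsupp D x -> fsupp D (f x).

(** A map preserving M_D acts on M / M_D, so truncating its argument does not affect the truncated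
    value. *)
Lemma ftrunc_stable D f x : fstable f -> ftrunc D (f (ftrunc D x)) = ftrunc D (f x).
Proof.
move=> [fD fs]; rewrite -[x in RHS](subrK (ftrunc D x)) fD ftruncD.
by rewrite [ftrunc D (f (x - _))]ftrunc_eq0 ?add0r //; apply: fs; exact: ftrunc_supp.
Qed.

Lemma scale_fstable e : fstable ( *:%R e).
Proof. by split=> [x y|D x]; [exact: scalerDr | exact: fsuppZ]. Qed.

Definition in_piece (D1 D2 : segment) : pred M :=
  fun x => [forall i, (co x 0 i != 0) ==> (D1 (sl i) && ~~ D2 (sl i))].

Lemma in_pieceP D1 D2 x : reflect (fsupp D1 x /\ ftrunc D2 x = x) (in_piece D1 D2 x).
Proof.
apply: (iffP forallP) => [xP|[x1 x2] i].
  split=> [i xi|]; first by have := xP i; rewrite xi => /andP[].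
  apply: ftruncP => i; case: ifPn => // D2i; apply/eqP/negPn/negP => xi.
  by have := xP i; rewrite xi D2i andbF.
apply/implyP => xi; rewrite x1 //=; apply: contra xi => D2i.
by rewrite -x2 co_ftrunc D2i.
Qed.

Lemma in_piece_closed D1 D2 : zmod_closed (in_piece D1 D2).
Proof.
split.
  by apply/forallP => i; rewrite co0 mxE eqxx.
move=> x y /forallP xP /forallP yP; apply/forallP => i; apply/implyP.
rewrite coB !mxE; have := xP i; have := yP i.
have [->|_ _ /= -> //] := eqVneq (co x 0 i) 0.
by have [->|_ /= -> //] := eqVneq (co y 0 i) 0; rewrite subrr eqxx.
Qed.

Lemma in_piece_trunc D1 D2 x : fsupp D1 x -> in_piece D1 D2 (ftrunc D2 x).
Proof.
move=> x1; apply/in_pieceP; split.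
  by move=> i; rewrite co_ftrunc; case: ifP => [|_ /x1 //]; rewrite eqxx.
by apply: ftruncP => i; rewrite co_ftrunc; case: ifP.
Qed.
End FilteredBasis.

(** * Subquotients of an isocrystal with a filtered basis *)

(* The subquotient M_D1 / M_D2 of the filtration spanned by the basis vectors,
   identified with the span of the basis vectors whose slope lies in D1 but not in D2. *)
Section Piece.
Context (A E : comPzRingType) (io : {rmorphism A -> E}) (M : lmodType E).
Context (B : fbasis io M) (D1 D2 : segment).

Record piece := Piece { piece_val :> M; _ : piece_val \in in_piece B D1 D2 }.

HB.instance Definition _ := [isSub for piece_val].
HB.instance Definition _ := [Choice of piece by <:].
HB.instance Definition _ := GRing.SubChoice_isSubZmodule.Build M (in_piece B D1 D2) piece
  (@in_piece_closed _ _ _ _ B D1 D2).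

Lemma piece_supp (x : piece) : fsupp B D1 x.
Proof. by case: x => x /= /in_pieceP[]. Qed.

Lemma piece_trunc (x : piece) : ftrunc B D2 x = x.
Proof. by case: x => x /= /in_pieceP[]. Qed.

Lemma piece_valD (x y : piece) : piece_val (x + y) = piece_val x + piece_val y.
Proof. by []. Qed.

Lemma piece_val_sum (I : Type) (r : seq I) (P : pred I) (F : I -> piece) :
  piece_val (\sum_(i <- r | P i) F i) = \sum_(i <- r | P i) piece_val (F i).
Proof. exact: (big_morph piece_val piece_valD erefl). Qed.

Definition piece_map (f : M -> M) (ff : fstable B f) (x : piece) : piece :=
  Piece (in_piece_trunc D2 (ff.2 D1 x (@piece_supp x))).

(** The span of the chosen basis vectors is stable under A but need not be under E, so scalars of E
    act through truncation, as on the quotient. *)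
Definition piece_scale e := piece_map (scale_fstable B e).

Lemma piece_scaleA a b x : piece_scale a (piece_scale b x) = piece_scale (a * b) x.
Proof.
apply: val_inj; rewrite /= (ftrunc_stable D2 _ (scale_fstable B a)).
by rewrite scalerA.
Qed.

Lemma piece_scale1 : left_id 1 piece_scale.
Proof. by move=> x; apply: val_inj; rewrite /= scale1r piece_trunc. Qed.

Lemma piece_scaleDr : right_distributive piece_scale +%R.
Proof. by move=> e x y; apply: val_inj; rewrite /= scalerDr ftruncD. Qed.

Lemma piece_scaleDl x : {morph piece_scale^~ x : a b / a + b}.
Proof. by move=> a b; apply: val_inj; rewrite /= scalerDl ftruncD. Qed.

HB.instance Definition _ := GRing.Zmodule_isLmodule.Build E piece
  piece_scaleA piece_scale1 piece_scaleDr piece_scaleDl.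

Lemma piece_valZ e (x : piece) : piece_val (e *: x) = ftrunc B D2 (e *: piece_val x).
Proof. by []. Qed.

Lemma ftruncZA a x : ftrunc B D2 (io a *: x) = io a *: ftrunc B D2 x.
Proof.
by apply: ftruncP => i; rewrite !coZ !mxE co_ftrunc; case: ifP; rewrite ?mulr0.
Qed.

Lemma piece_valZA a (x : piece) : piece_val (io a *: x) = io a *: piece_val x.
Proof. by rewrite piece_valZ ftruncZA piece_trunc. Qed.

(** Basis vectors outside the piece become 0, which keeps the index type of [B]; the family
    generates the piece without having to be free. *)
Definition piece_b i : piece := insubd (0 : piece) (fb_b B i).
Definition piece_co i (x : piece) : A := fb_co B x 0 i.

Lemma in_piece_b i : (fb_b B i \in in_piece B D1 D2) =
  (fb_co B (fb_b B i) 0 i == 0) || (D1 (fb_sl B i) && ~~ D2 (fb_sl B i)).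
Proof.
apply/forallP/orP => [/(_ i)/implyP ib|ib l].
  by have [_|/ib ->] := eqVneq (fb_co B (fb_b B i) 0 i) 0; [left | right].
have [->|li] := eqVneq l i; last by rewrite co_b mxE (negPf li) andbF eqxx.
by apply/implyP => /negPf b0; case: ib => //; rewrite b0.
Qed.

Lemma piece_bE i :
  D1 (fb_sl B i) && ~~ D2 (fb_sl B i) -> piece_val (piece_b i) = fb_b B i.
Proof. by move=> ib; rewrite /piece_b -[LHS]/(val _) val_insubd in_piece_b ib orbT. Qed.

Lemma piece_b0 i : ~~ (D1 (fb_sl B i) && ~~ D2 (fb_sl B i)) -> piece_b i = 0.
Proof.
move=> /negPf nJ; apply: val_inj; rewrite val_insubd in_piece_b nJ orbF; case: ifP => // /eqP b0.
apply: (@co_inj _ _ _ _ B); apply/rowP => l; rewrite co0 co_b !mxE eqxx /=.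
have [_|//] := eqVneq l i.
by move: b0; rewrite co_b mxE !eqxx.
Qed.

Lemma piece_co0 i (x : piece) : ~~ (D1 (fb_sl B i) && ~~ D2 (fb_sl B i)) -> piece_co i x = 0.
Proof.
case: x => x /= xP; rewrite /piece_co /=; have /forallP/(_ i)/implyP xi := xP.
by have [//|/xi ->] := eqVneq (fb_co B x 0 i) 0.
Qed.

Lemma piece_co_lin i a x x' :
  piece_co i (io a *: x + x') = a * piece_co i x + piece_co i x'.
Proof. by rewrite /piece_co piece_valD piece_valZA fb_lin !mxE. Qed.

Lemma piece_coK x : x = \sum_i io (piece_co i x) *: piece_b i.
Proof.
apply: val_inj; rewrite -[RHS]/(piece_val _) piece_val_sum.
rewrite -[LHS]/(piece_val x) [LHS](fb_K B); apply: eq_bigr => i _.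
have [ib|ib] := boolP (D1 (fb_sl B i) && ~~ D2 (fb_sl B i)).
  by rewrite piece_valZA piece_bE.
have := piece_co0 x ib; rewrite /piece_co => ->.
by rewrite rmorph0 !scale0r.
Qed.
End Piece.
Arguments piece_b {A E io M} B D1 D2 i.
Arguments piece_co {A E io M} B D1 D2 i x.

Section LinBijective.
Context (A E : comPzRingType) (io : {rmorphism A -> E}).
Context (s : {rmorphism A -> A}) (sE : {rmorphism E -> E}) (sio : forall a, sE (io a) = io (s a)).
Context (d : nat) (w : 'I_d -> E) (sw : forall j, sE (w j) = w j).
Hypothesis Espan : forall x, exists a : 'I_d -> A, x = \sum_j io (a j) * w j.

(** As [sE] fixes the [w j], these can be moved across the tensor sign, so the elements 1 (x) y i
    generate the source over A. The alternative [y i = 0] admits the zeros of [piece_b]. *)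
Lemma lin_bijective (N : taumod sE) m (y : 'I_m -> N) (co : 'I_m -> N -> A) :
  (forall x, x = \sum_i io (co i x) *: y i) ->
  (forall x, exists c : 'I_m -> A, x = \sum_i io (c i) *: tau N (y i)) ->
  (forall c : 'I_m -> A, \sum_i io (c i) *: tau N (y i) = 0 ->
     forall i, c i = 0 \/ y i = 0) ->
  bijective (linearization N).
Proof.
move=> coK surj inj.
have linD x x' : linearization N (x + x') = linearization N x + linearization N x'.
  exact: linearD.
have lin0 : linearization N 0 = 0 by exact: linear0.
have linp e x : linearization N (ptensor sE e x) = e *: tau N x by exact: ext_lift_pure.
have linB x x' : linearization N (x - x') = linearization N x - linearization N x'.
  exact: linearB.
have lin_sum (F : 'I_m -> ext sE N) :
    linearization N (\sum_i F i) = \sum_i linearization N (F i).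
  exact: (big_morph _ linD lin0).
pose gen (x : ext sE N) := exists c : 'I_m -> A, x = \sum_i ptensor sE (io (c i)) (y i).
have genD x x' : gen x -> gen x' -> gen (x + x').
  move=> [c ->] [c' ->]; exists (fun i => c i + c' i); rewrite -big_split.
  by apply: eq_bigr => i _; rewrite rmorphD pureDl.
have gen0 : gen 0.
  exists (fun=> 0); rewrite big1 // => i _.
  by apply: (addIr (ptensor sE 0 (y i))); rewrite rmorph0 -pureDl !add0r.
have gen_sum (I : Type) (r : seq I) (F : I -> ext sE N) :
    (forall i, gen (F i)) -> gen (\sum_(i <- r) F i).
  by move=> FP; elim/big_ind: _.
have genA a x : gen (ptensor sE (io a) x).
  exists (fun i => a * s (co i x)); rewrite {1}[x]coK.
  rewrite (big_morph (ptensor sE (io a)) (pureDr sE _) (pure0 sE _ _)).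
  by apply: eq_bigr => i _; rewrite pureZ rmorphM sio.
have gen_all x : gen x.
  elim/ext_ind: x => [e x||x x']; [|exact: gen0|exact: genD].
  have [a ->] := Espan e.
  have -> : ptensor sE (\sum_j io (a j) * w j) x = \sum_j ptensor sE (io (a j) * w j) x.
    have p0 : ptensor sE 0 x = 0 by apply: (addIr (ptensor sE 0 x)); rewrite -pureDl !add0r.
    exact: (big_morph (fun e' => ptensor sE e' x) (pureDl sE x) p0).
  by apply: gen_sum => j; rewrite -[w j]sw -pureZ; exact: genA.
have lin_inj x : linearization N x = 0 -> x = 0.
  have [c ->] := gen_all x; rewrite lin_sum => c0.
  rewrite big1 // => i _; have [|->|->] := inj c _ i.
  - by rewrite -[RHS]c0; apply: eq_bigr => l _; rewrite linp.
  - by apply: (addIr (ptensor sE 0 (y i))); rewrite rmorph0 -pureDl !add0r.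
  - exact: pure0.
have lin_surj x : exists u, linearization N u = x.
  have [c ->] := surj x; exists (\sum_i ptensor sE (io (c i)) (y i)).
  by rewrite lin_sum; apply: eq_bigr => i _; rewrite linp.
have [g gP] := boolp.choice lin_surj; exists g => // x.
by apply/eqP; rewrite -subr_eq0; apply/eqP/lin_inj; rewrite linB gP subrr.
Qed.
End LinBijective.

Section PieceIsocrystal.
Context (A E : comPzRingType) (io : {rmorphism A -> E}).
Context (s : {rmorphism A -> A}) (sE : {rmorphism E -> E}) (sio : forall a, sE (io a) = io (s a)).
Context (d : nat) (w w' : 'I_d -> E) (c : 'I_d -> 'I_d -> 'I_d -> A).
Context (sep : separable_pair io w w' c) (sw : forall j, sE (w j) = w j).
Context (M : taumod sE) (B : fbasis io M).
Local Notation n := (fb_n B).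
Local Notation b := (fb_b B).
Local Notation co := (fb_co B).
Local Notation sl := (fb_sl B).
Context (T Z : 'M[A]_n) (tauT : forall i, co (tau M (b i)) = row i T) (ZT : Z *m T = 1%:M).
Context (triT : triangular sl T) (triZ : triangular sl Z).

Lemma tau_comb (v : 'I_n -> A) :
  tau M (\sum_i io (v i) *: b i) = \sum_i io (s (v i)) *: tau M (b i).
Proof. by rewrite linear_sum; apply: eq_bigr => i _; rewrite linearZ /= sio. Qed.

Lemma co_tau x : co (tau M x) = semilin s T (co x).
Proof.
rewrite [x in LHS](fb_K B) tau_comb co_sum /semilin mulmx_sum_row.
by apply: eq_bigr => i _; rewrite coZ tauT mxE.
Qed.

Lemma co_iter_tau q x : co (iter q (tau M) x) = iter q (semilin s T) (co x).
Proof. by elim: q => // q IHq; rewrite !iterS co_tau IHq. Qed.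

Lemma tau_stable : fstable B (tau M).
Proof.
split=> [x y|D x xD]; first exact: linearD.
move=> i; rewrite co_tau mxE => xi.
have [l xl] : exists l, co x 0 l != 0 /\ T l i != 0.
  apply: contrapT => /forallNP nl; case/eqP: xi; rewrite big1 // => l _; rewrite mxE.
  have [->|xl] := eqVneq (co x 0 l) 0; first by rewrite rmorph0 mul0r.
  by have [->|Tl] := eqVneq (T l i) 0; [rewrite mulr0 | case: (nl l)].
by case: xl => /xD Dl /eqP/triT sli; exact: seg_down sli Dl.
Qed.

Section Piece.
Context (D1 D2 : segment).
Local Notation Pc := (piece B D1 D2).

Definition piece_tau of fstable B (tau M) := fun x : Pc => piece_map tau_stable x.

Lemma piece_tau_linear : linear_for (sE \; *:%R) (piece_tau tau_stable).
Proof.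
move=> e x y; apply: val_inj; rewrite /= linearD ftruncD ftrunc_stable; last exact: tau_stable.
by rewrite linearZ /= (ftrunc_stable D2 _ (scale_fstable B _)).
Qed.

HB.instance Definition _ := GRing.isLinear.Build E Pc Pc (sE \; *:%R)
  (piece_tau tau_stable) piece_tau_linear.

Definition piece_taumod : taumod sE := TauMod (piece_tau tau_stable).

Lemma val_piece_tau (x : piece_taumod) :
  piece_val (tau piece_taumod x) = ftrunc B D2 (tau M (piece_val x)).
Proof. by []. Qed.

Lemma val_iter_piece_tau q (x : piece_taumod) :
  piece_val (iter q (tau piece_taumod) x) = ftrunc B D2 (iter q (tau M) (piece_val x)).
Proof.
elim: q => [|q IHq]; first by rewrite piece_trunc.
by rewrite !iterS val_piece_tau IHq ftrunc_stable //; exact: tau_stable.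
Qed.

Lemma mul_triangular (D : segment) (v : 'rV[A]_n) (X : 'M[A]_n) : triangular sl X ->
  (forall i, v 0 i != 0 -> D (sl i)) -> forall i, (v *m X) 0 i != 0 -> D (sl i).
Proof.
move=> triX vD i; rewrite mxE => vXi.
have [l [vl Xl]] : exists l, v 0 l != 0 /\ X l i != 0.
  apply: contrapT => /forallNP nl; case/eqP: vXi; rewrite big1 // => l _.
  have [->|vl] := eqVneq (v 0 l) 0; first by rewrite mul0r.
  by have [->|Xl] := eqVneq (X l i) 0; [rewrite mulr0 | case: (nl l)].
exact: seg_down (triX _ _ (elimN eqP Xl)) (vD _ vl).
Qed.

Lemma piece_lin_bijective : bijective (linearization piece_taumod).
Proof.
have [Espan _ _ _] := sep.
apply: (@lin_bijective A E io s sE sio d w sw Espan piece_taumod n (piece_b B D1 D2)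
  (piece_co B D1 D2)); first exact: piece_coK.
(* [Z] gives coordinates with respect to the images of the basis vectors, and its triangularity
   keeps them in D1. *)
- move=> x; pose v := co (piece_val x) *m Z; exists (fun i => v 0 i).
  have vD1 i : v 0 i != 0 -> D1 (sl i).
    by apply: mul_triangular triZ _ _ => l; exact: piece_supp.
  have xE : piece_val x = \sum_i io (v 0 i) *: tau M (b i).
    apply: (@co_inj _ _ _ _ B); rewrite co_sum.
    rewrite (eq_bigr (fun i => v 0 i *: row i T)); last by move=> i _; rewrite coZ tauT.
    by rewrite -mulmx_sum_row -mulmxA ZT mulmx1.
  apply: val_inj; rewrite -[RHS]/(piece_val _) piece_val_sum -[LHS]/(piece_val x).
  rewrite -[LHS]piece_trunc {1}xE.
  rewrite (big_morph (ftrunc B D2) (ftruncD B D2) (ftrunc_eq0 (@fsupp0 _ _ _ _ B D2))).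
  apply: eq_bigr => i _; rewrite ftruncZA piece_valZA val_piece_tau.
  have [->|vi] := eqVneq (v 0 i) 0; first by rewrite rmorph0 !scale0r.
  have [D2i|nD2i] := boolP (D2 (sl i)).
    rewrite piece_b0 ?D2i ?andbF // linear0 !ftrunc_eq0 //; first exact: fsupp0.
    apply: tau_stable.2 => l; rewrite co_b mxE eqxx /=.
    by have [->|_] := eqVneq l i; rewrite ?eqxx.
  by rewrite piece_bE // vD1.
(* A relation in the piece is a combination [u] lying in M_D2. Triangularity of [Z] confines its
   coefficients to D2, so they vanish on the piece. *)
- move=> a aE i; have [Ji|/negPf nJi] := boolP (D1 (sl i) && ~~ D2 (sl i)); last first.
    by right; apply: piece_b0; apply/negbT.
  left; pose v : 'rV[A]_n := \row_j (if D1 (sl j) && ~~ D2 (sl j) then a j else 0).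
  pose u := \sum_j io (v 0 j) *: tau M (b j).
  have co_u : co u = v *m T.
    by rewrite co_sum mulmx_sum_row; apply: eq_bigr => j _; rewrite coZ tauT.
  have u0 : ftrunc B D2 u = 0.
    have := congr1 (fun x : Pc => piece_val x) aE; rewrite /= piece_val_sum => <-.
    rewrite (big_morph (ftrunc B D2) (ftruncD B D2) (ftrunc_eq0 (@fsupp0 _ _ _ _ B D2))).
    apply: eq_bigr => j _; rewrite ftruncZA piece_valZA val_piece_tau mxE.
    case: ifP => [Jj|nJj]; first by rewrite piece_bE.
    rewrite piece_b0 ?(negbT nJj) // rmorph0 scale0r.
    have -> : tau M (piece_val (0 : Pc)) = 0 by exact: linear0.
    by rewrite ftrunc_eq0 ?scaler0 //; exact: fsupp0.
  have uD2 : fsupp B D2 u by have := @ftrunc_supp _ _ _ _ B D2 u; rewrite u0 subr0.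
  have vE : v = co u *m Z by rewrite co_u -mulmxA (mulmx1C ZT) mulmx1.
  apply/eqP/negPn/negP => ai.
  have : v 0 i != 0 by rewrite mxE Ji.
  rewrite vE => /(mul_triangular triZ uD2) D2i.
  by rewrite D2i andbF in Ji.
Qed.

Definition piece_isocrystal : isocrystal sE :=
  @Isocrystal E sE piece_taumod
    (dual_basis_fg (@piece_coK _ _ _ _ B D1 D2))
    (dual_basis_projective sep (@piece_co_lin _ _ _ _ B D1 D2) (@piece_coK _ _ _ _ B D1 D2))
    piece_lin_bijective.
End Piece.
End PieceIsocrystal.

(** * Separability idempotents over Laurent and power series *)

Section LaurentPair.
Context (S K : comPzRingType) (j : {rmorphism S -> K}) (d : nat) (w w' : 'I_d -> K).
Context (c : 'I_d -> 'I_d -> 'I_d -> S) (sep : separable_pair j w w' c).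

Definition lconst (L : comPzRingType) (x : L) : laurent L := lmonom x 0.

Lemma lconstM (L : comPzRingType) (x : L) (y : laurent L) n : (lconst x * y) n = x * y n.
Proof. by rewrite [LHS]lmonomM subr0. Qed.

Lemma lconst_is_zmod (L : comPzRingType) : zmod_morphism (@lconst L).
Proof.
by move=> x y; apply: laurent_eq => n; rewrite lcoefD lcoefN /=; case: ifP; rewrite ?subr0.
Qed.

Lemma lconst_is_monoid (L : comPzRingType) : monoid_morphism (@lconst L).
Proof.
split=> [//|x y]; apply: laurent_eq => n; rewrite lconstM /=.
by case: ifP; rewrite ?mulr0.
Qed.

HB.instance Definition _ (L : comPzRingType) :=
  GRing.isZmodMorphism.Build L (laurent L) (@lconst L) (@lconst_is_zmod L).
HB.instance Definition _ (L : comPzRingType) :=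
  GRing.isMonoidMorphism.Build L (laurent L) (@lconst L) (@lconst_is_monoid L).

Lemma laurent_map_lconst x : laurent_map j (lconst x) = lconst (j x).
Proof. by apply: laurent_eq => n /=; rewrite (fun_if j) rmorph0. Qed.

Lemma vge_lconst (L : comPzRingType) (x : L) : vge 0 (lconst x).
Proof. by apply/vge0P => n n0 /=; rewrite lt_eqF. Qed.

Lemma laurent_span (x : laurent K) : exists a : 'I_d -> laurent S,
  x = \sum_i laurent_map j (a i) * lconst (w i) /\ (vge 0 x -> forall i, vge 0 (a i)).
Proof.
have [Kspan _ _ _] := sep; have [f fE] := boolp.choice Kspan.
(* The chosen coordinates of 0 need not vanish; setting them to 0 keeps the coordinate series
   bounded below, and integral when x is. *)
pose g i n := if x n == 0 then 0 else f (x n) i.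
have g_bounded i : exists N : int, forall n, n < N -> g i n = 0.
  by have [N xN] := lcoef_bounded x; exists N => n /xN; rewrite /g => ->; rewrite eqxx.
exists (fun i => Laurent (g_bounded i)); split.
  apply: laurent_eq => n; rewrite lcoef_sum.
  rewrite (eq_bigr (fun i => j (g i n) * w i)); last first.
    by move=> i _; rewrite mulrC lconstM mulrC.
  rewrite /g; have [->|_] := eqVneq (x n) 0; last exact: fE.
  by rewrite big1 // => i _; rewrite rmorph0 mul0r.
by move=> x0 i n n0; rewrite /= /g x0 // eqxx.
Qed.

Lemma laurent_pair : separable_pair (laurent_map j) (fun i => lconst (w i))
  (fun i => lconst (w' i)) (fun l m i => lconst (c l m i)).
Proof.
have [_ ww' wM w'M] := sep; split.
- by move=> x; have [a [xE _]] := laurent_span x; exists a.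
- rewrite -[RHS](rmorph1 (@lconst K)) -ww' rmorph_sum.
  by apply: eq_bigr => i _; rewrite rmorphM.
- move=> l m; rewrite -rmorphM wM rmorph_sum.
  by apply: eq_bigr => i _; rewrite rmorphM /= laurent_map_lconst.
- move=> l i; rewrite -rmorphM w'M rmorph_sum.
  by apply: eq_bigr => m _; rewrite rmorphM /= laurent_map_lconst.
Qed.

Lemma integralP (L : comPzRingType) (x : laurent L) : reflect (vge 0 x) (x \in integral (K := L)).
Proof.
by apply: (iffP (asboolP _)) => [x0|/vge0P//]; apply/vge0P.
Qed.

Lemma psval_vge (L : comPzRingType) (x : powser L) : vge 0 (psval x).
Proof. by case: x => x /= /integralP. Qed.

Definition pconst (L : comPzRingType) (x : L) : powser L :=
  PowSer (introT (integralP (lconst x)) (vge_lconst x)).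

Lemma powser_map_subproof (x : powser S) :
  laurent_map j (psval x) \in integral (K := K).
Proof. by apply/integralP/laurent_map_vge/psval_vge. Qed.

Definition powser_map (x : powser S) : powser K := PowSer (powser_map_subproof x).

Lemma powser_map_zmod : zmod_morphism powser_map.
Proof. by move=> x y; apply: val_inj; exact: (rmorphB (laurent_map j)). Qed.

Lemma powser_map_monoid : monoid_morphism powser_map.
Proof.
split=> [|x y]; apply: val_inj; first exact: (rmorph1 (laurent_map j)).
exact: (rmorphM (laurent_map j)).
Qed.

HB.instance Definition _ := GRing.isZmodMorphism.Build (powser S) (powser K)
  powser_map powser_map_zmod.
HB.instance Definition _ := GRing.isMonoidMorphism.Build (powser S) (powser K)
  powser_map powser_map_monoid.

Lemma powser_pair : separable_pair powser_map (fun i => pconst (w i))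
  (fun i => pconst (w' i)) (fun l m i => pconst (c l m i)).
Proof.
have [_ ww' wM w'M] := laurent_pair.
have psum (I : Type) (r : seq I) (F : I -> powser K) :
  psval (\sum_(i <- r) F i) = \sum_(i <- r) psval (F i) by rewrite rmorph_sum.
split.
- move=> x; have [a [xE a0]] := laurent_span (psval x).
  exists (fun i => PowSer (introT (integralP (a i)) (a0 (psval_vge x) i))).
  by apply: val_inj; rewrite -[LHS]/(psval x) {1}xE -[RHS]/(psval _) psum.
- by apply: val_inj; rewrite -[LHS]/(psval _) psum; exact: ww'.
- by move=> l m; apply: val_inj; rewrite -[RHS]/(psval _) psum; exact: wM.
- by move=> l m; apply: val_inj; rewrite -[RHS]/(psval _) psum; exact: w'M.
Qed.
End LaurentPair.

Section Segments.

Lemma seg_le_down (a g h : rat) : g <= h -> h <= a -> g <= a.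
Proof. exact: le_trans. Qed.
Lemma seg_lt_down (a g h : rat) : g <= h -> h < a -> g < a.
Proof. exact: le_lt_trans. Qed.

Definition seg_le (a : rat) : segment := @Segment (fun g => g <= a) (@seg_le_down a).
Definition seg_lt (a : rat) : segment := @Segment (fun g => g < a) (@seg_lt_down a).
Definition seg_none : segment := @Segment (fun=> false) (fun _ _ _ => id).

Context (A E : comPzRingType) (io : {rmorphism A -> E}) (M : lmodType E) (B : fbasis io M).

Lemma ftrunc_none x : ftrunc B seg_none x = x.
Proof. exact: ftruncP. Qed.

Lemma piece_val_none_linear D1 : linear (@piece_val _ _ _ _ B D1 seg_none).
Proof. by move=> e x y; rewrite piece_valD piece_valZ ftrunc_none. Qed.

HB.instance Definition _ D1 := GRing.isLinear.Build E (piece B D1 seg_none) M *:%R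
  (@piece_val _ _ _ _ B D1 seg_none) (@piece_val_none_linear D1).

Definition piece_proj D1 D2 (x : piece B D1 seg_none) : piece B D1 D2 :=
  Piece (in_piece_trunc D2 (@piece_supp _ _ _ _ B D1 seg_none x)).

Lemma piece_proj_linear D1 D2 : linear (@piece_proj D1 D2).
Proof.
move=> e x y; apply: val_inj; rewrite /= ftrunc_none ftruncD; congr (_ + _).
by rewrite (ftrunc_stable D2 _ (scale_fstable B e)).
Qed.

HB.instance Definition _ D1 D2 := GRing.isLinear.Build E (piece B D1 seg_none) (piece B D1 D2)
  *:%R (@piece_proj D1 D2) (@piece_proj_linear D1 D2).

Lemma fsupp_le_all (x : M) a : (forall i, fb_sl B i <= a) -> fsupp B (seg_le a) x.
Proof. by move=> sla i _; exact: sla. Qed.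

(** There are finitely many slopes, so the union of the steps below a is a single step. The default
    a - 1 serves when no slope is below a. *)
Lemma slopes_below (a : rat) : exists2 g : rat, g < a & forall i, fb_sl B i < a -> fb_sl B i <= g.
Proof.
exists (\big[Order.max/(a - 1)]_(i | fb_sl B i < a) fb_sl B i).
  elim/big_ind: _ => //; first by rewrite gtrBl.
  by move=> x y xa ya; rewrite gt_max xa.
by move=> i ia; rewrite (bigD1 i) //= le_max lexx.
Qed.
End Segments.

(** * Purity of the graded pieces *)

Section SlopeFiltration.
Context (S K : comPzRingType) (j : {rmorphism S -> K}) (r : nat) (w w' : 'I_r -> K).
Context (c : 'I_r -> 'I_r -> 'I_r -> S) (sep : separable_pair j w w' c).
Local Notation io := (laurent_map j).
Context (s : {rmorphism laurent S -> laurent S}) (sK : {rmorphism laurent K -> laurent K}).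
Context (sio : forall a, sK (io a) = io (s a)) (sw : forall i, sK (lconst (w i)) = lconst (w i)).
Context (s_vge : forall a x, vge a x -> vge a (s x)).
Context (M : isocrystal sK) (B : fbasis io M).
Local Notation n := (fb_n B).
Local Notation b := (fb_b B).
Local Notation co := (fb_co B).
Local Notation sl := (fb_sl B).
Context (T Z : 'M[laurent S]_n).
Context (tauT : forall i, co (tau M (b i)) = row i T) (ZT : Z *m T = 1%:M).
Context (triT : triangular sl T) (triZ : triangular sl Z).
Context (intw : forall l i i', sl i = sl i' -> vge 0 (co (lconst (w l) *: b i) 0 i')).
Context (d : nat) (pure_at : forall i0, exists (m : nat) (e : int) (W : 'M[laurent S]_n),
    [/\ (0 < m)%N, m%:R * sl i0 = e%:~R,
        forall i i', sl i = sl i0 -> sl i' = sl i0 -> vge e%:~R (twpow s T (m * d) i i'),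
        forall i i', vge (- e%:~R) (W i i') &
        forall i i', sl i = sl i0 -> sl i' = sl i0 ->
          \sum_(l | sl l == sl i0) W i l * twpow s T (m * d) l i' = (i == i')%:R]).

Section Graded.
Context (a : rat).
Local Notation gr := (piece B (seg_le a) (seg_lt a)).

Definition gr_iso : isocrystal sK :=
  piece_isocrystal sio (laurent_pair sep) sw tauT ZT triT triZ (seg_le a) (seg_lt a).

Lemma gr_in i : (seg_le a (sl i) && ~~ seg_lt a (sl i)) = (sl i == a).
Proof. by rewrite /= -leNgt -eq_le. Qed.

(** The integral span of the basis vectors of slope a. It is stable under k because [intw] makes the
    blocks of equal slope integral. *)
Definition lat_pred : pred (restr (@psval K) gr) :=
  fun x => `[< forall i, vge 0 (piece_co B (seg_le a) (seg_lt a) i x) >].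

Lemma lat_predP (x : gr) : reflect (forall i, vge 0 (co x 0 i)) (lat_pred x).
Proof. exact: asboolP. Qed.

Lemma gr_co0 i (x : gr) : sl i != a -> co x 0 i = 0.
Proof.
by move=> ia; have := @piece_co0 _ _ _ _ B (seg_le a) (seg_lt a) i x; rewrite gr_in; exact.
Qed.

Lemma gr_coZ (e : laurent K) (x : gr) i :
  co (e *: x : gr) 0 i = if sl i == a then co (e *: (x : M)) 0 i else 0.
Proof.
have [ia|] := eqVneq (sl i) a; last exact: gr_co0.
by rewrite piece_valZ co_ftrunc /= ia ltxx.
Qed.

Lemma lat_closed : submod_closed lat_pred.
Proof.
split; first by apply/lat_predP => i; rewrite co0 mxE; exact: vge0.
move=> e x y /lat_predP x0 /lat_predP y0; apply/lat_predP => i.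
rewrite -[X in vge 0 X]/(co (piece_val ((psval e *: (x : gr)) + (y : gr) : gr)) 0 i).
rewrite piece_valD coD mxE; apply: vgeD => //.
rewrite gr_coZ; case: eqP => [ia|_]; last exact: vge0.
have [f [fE f0]] := laurent_span sep (psval e); rewrite {1}fE scaler_suml co_sum summxE.
apply: vge_sum => l _; rewrite -scalerA coZ mxE -[0]addr0.
apply: vgeM; first exact: f0 (@psval_vge _ e) l.
rewrite [X in _ *: X](fb_K B) scaler_sumr co_sum summxE.
apply: vge_sum => i' _; rewrite scalerA mulrC -scalerA coZ mxE -[0]addr0.
have [i'a|i'a] := eqVneq (sl i') a; last by rewrite gr_co0 // mul0r; exact: vge0.
by apply: vgeM => //; apply: intw; rewrite i'a ia.
Qed.

HB.instance Definition _ := GRing.isSubmodClosed.Build (powser K) (restr (@psval K) gr) lat_pred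
  lat_closed.

Record lat := Lat { lat_val :> restr (@psval K) gr; _ : lat_val \in lat_pred }.
HB.instance Definition _ := [isSub for lat_val].
HB.instance Definition _ := [Choice of lat by <:].
HB.instance Definition _ := GRing.SubChoice_isSubLmodule.Build (powser K)
  (restr (@psval K) gr) lat_pred lat lat_closed.

Definition lat_emb0 (x : lat) : gr := lat_val x.

Lemma lat_emb_linear : linear_for (@psval K \; *:%R) lat_emb0.
Proof. by []. Qed.

HB.instance Definition _ := GRing.isLinear.Build (powser K) lat gr (@psval K \; *:%R)
  lat_emb0 lat_emb_linear.

Lemma lat_emb_inj : injective lat_emb0.
Proof. exact: val_inj. Qed.

Lemma lat_b_in i : piece_b B (seg_le a) (seg_lt a) i \in lat_pred.
Proof.
apply/lat_predP => i'; have [ia|ia] := boolP (seg_le a (sl i) && ~~ seg_lt a (sl i)).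
  by rewrite piece_bE // co_b mxE eqxx /=; case: eqP => _; [exact: vge1 | exact: vge0].
by rewrite piece_b0 // co0 mxE; exact: vge0.
Qed.

Definition lat_b i : lat := Lat (lat_b_in i).

Lemma lat_int (x : lat) i : vge 0 (co (lat_emb0 x : M) 0 i).
Proof. by case: x => x /= /lat_predP. Qed.

Definition lat_co i (x : lat) : powser S := PowSer (introT (integralP _) (@lat_int x i)).

Lemma lat_co_lin i (f : powser S) x x' :
  lat_co i (powser_map j f *: x + x') = f * lat_co i x + lat_co i x'.
Proof.
apply: val_inj; have := piece_co_lin i (psval f) (lat_emb0 x) (lat_emb0 x').
by rewrite /piece_co.
Qed.

Lemma lat_sum N (F : 'I_N -> lat) : lat_emb0 (\sum_i F i) = \sum_i lat_emb0 (F i).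
Proof. exact: linear_sum. Qed.

Lemma lat_coK x : x = \sum_i powser_map j (lat_co i x) *: lat_b i.
Proof.
apply: lat_emb_inj; rewrite lat_sum.
exact: (piece_coK (lat_emb0 x)).
Qed.

Lemma lmonom_io e : lmonom 1 e = io (lmonom 1 e).
Proof. by rewrite laurent_map_lmonom. Qed.

Lemma lat_gen (m : gr) : exists (N : nat) (l : lat),
  m = lmonom 1 (- N%:Z) *: lat_emb0 l.
Proof.
have cP i : exists e, vge e%:~R (co (m : M) 0 i) by exact: vge_exists.
have [e {}cP] := boolp.choice cP.
pose N := (\sum_i absz (e i))%N.
have lP : (lmonom 1 N%:Z *: m : gr) \in lat_pred.
  apply/lat_predP => i; rewrite lmonom_io piece_valZA coZ mxE.
  apply: (@vge_le _ _ ((e i)%:~R + N%:~R)); last by rewrite addrC; apply: vgeM => //; exact: vge_lmonom.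
  by rewrite -intrD ler0z /N (bigD1 i) //=; lia.
exists N, (Lat lP); rewrite /lat_emb0 /= scalerA lmonomD addNr.
by rewrite lmonom0 scale1r.
Qed.

Definition gr_lattice : lattice gr :=
  @Lattice K gr lat lat_emb0 lat_emb_inj
    (dual_basis_fg lat_coK)
    (dual_basis_projective (powser_pair sep) lat_co_lin lat_coK) lat_gen.

Lemma gr_pure : pure_of_slope d gr_iso a.
Proof.
have [m [e [W [m0 me Tq_ge W_ge WT]]]] : exists (m : nat) (e : int) (W : 'M[laurent S]_n),
    [/\ (0 < m)%N, m%:R * a = e%:~R,
        forall i i', sl i = a -> sl i' = a -> vge e%:~R (twpow s T (m * d) i i'),
        forall i i', vge (- e%:~R) (W i i') &
        forall i i', sl i = a -> sl i' = a ->
          \sum_(l | sl l == a) W i l * twpow s T (m * d) l i' = (i == i')%:R].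
  (* If a is not a slope, the piece is 0 and any n with n a integral will do; the denominator of a
     is taken. *)
  have [[i0 <-]|no] := pselect (exists i0, sl i0 = a); first exact: pure_at.
  exists `|denq a|%N, (numq a), 0; split.
  - by rewrite absz_gt0 denq_neq0.
  - rewrite -[_%:R]/((`|denq a|%N : int)%:~R) absz_denq mulrC -{1}[a]divq_num_den divfK //.
    by rewrite intr_eq0 denq_neq0.
  - by move=> i i' ia; case: no; exists i.
  - by move=> i i'; rewrite mxE; exact: vge0.
  - by move=> i i' ia; case: no; exists i.
pose q := (m * d)%N; pose t : gr -> gr := iter q (tau gr_iso).
have t_co (x : gr) i : sl i = a ->
    co (t x : M) 0 i = \sum_(l | sl l == a) rmorph_iter s q (co (x : M) 0 l) * twpow s T q l i.
  move=> ia; have -> : piece_val (t x) = ftrunc B (seg_lt a) (iter q (tau M) (x : M)).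
    exact: val_iter_piece_tau.
  have co_it : co (iter q (tau M) (x : M)) = iter q (semilin s T) (co (x : M)).
    exact: co_iter_tau.
  rewrite co_ftrunc /= ia ltxx co_it iter_semilinE mxE.
  rewrite [LHS](bigID (fun l => sl l == a)) /= [X in _ + X]big1 ?addr0; last first.
    by move=> l la; rewrite mxE gr_co0 // rmorph0 mul0r.
  by apply: eq_bigr => l _; rewrite mxE.
have sq_vge x : vge 0 x -> vge 0 (rmorph_iter s q x).
  by move=> x0; elim: (q) => // q' IHq; rewrite rmorph_iterS; apply: s_vge.
have gr_eq (x y : gr) : (forall i, sl i = a -> co (x : M) 0 i = co (y : M) 0 i) -> x = y.
  move=> xy; apply: val_inj; apply: (@co_inj _ _ _ _ B); apply/rowP => i.
  have [/xy //|ia] := eqVneq (sl i) a.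
  exact: etrans (gr_co0 x ia) (esym (gr_co0 y ia)).
exists m, e, gr_lattice; split=> //; apply/seteqP; split=> [x [N [f [y [yL ->]]]]|x [y [l _ <-] <-]].
- have zP (i : 'I_N) : exists l : lat, y i = lmonom 1 e *: lat_emb0 l.
    have [u [l _ <-] <-] := yL i.
    have lP : (lmonom 1 (- e) *: t (lat_emb0 l) : gr) \in lat_pred.
      apply/lat_predP => i'; rewrite lmonom_io piece_valZA coZ mxE.
      have [ia|ia] := eqVneq (sl i') a; last by rewrite gr_co0 // mulr0; exact: vge0.
      rewrite t_co //; apply: (@vge_le _ _ ((- e)%:~R + e%:~R)); first by rewrite -rmorphD addNr.
      apply: vgeM; first exact: vge_lmonom.
      apply: vge_sum => l' /eqP l'a; rewrite -[e%:~R]add0r; apply: vgeM.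
        exact/sq_vge/lat_int.
      exact: Tq_ge.
    exists (Lat lP); rewrite /lat_emb0 /= scalerA lmonomD subrr lmonom0 scale1r.
    by [].
  have [l lE] := boolp.choice zP.
  exists (lat_emb0 (\sum_i f i *: l i)); first by exists (\sum_i f i *: l i).
  rewrite lat_sum scaler_sumr; apply: eq_bigr => i _.
  rewrite lE -[lat_emb0 (f i *: l i)]/(psval (f i) *: lat_emb0 (l i)).
  by rewrite !scalerA mulrC.
(* [W] inverts the block of slope a, so z^e l is the combination of the images of the basis vectors
   with coefficients z^e (coordinates of l) W, which are integral by the bound on [W]. *)
- pose g i : laurent S := \sum_(l' | sl l' == a) co (lat_emb0 l : M) 0 l' * (lmonom 1 e * W l' i).
  have g_int i : vge 0 (g i).
    apply: vge_sum => l' _; rewrite -[0]addr0; apply: vgeM; first exact: lat_int.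
    by rewrite -(subrr e%:~R); apply: vgeM; [exact: vge_lmonom | exact: W_ge].
  exists n, (fun i => powser_map j (PowSer (introT (integralP _) (g_int i)))),
    (fun i => t (lat_emb0 (lat_b i))); split.
    move=> i; exists (lat_emb0 (lat_b i)) => //; by exists (lat_b i).
  apply: gr_eq => i ia; rewrite lmonom_io piece_valZA coZ mxE piece_val_sum co_sum summxE.
  rewrite (eq_bigr (fun l' => if sl l' == a then g l' * twpow s T q l' i else 0)); last first.
    move=> l' _; rewrite -[psval _]/(io (g l')) piece_valZA coZ mxE t_co //.
    have [l'a|l'a] := eqVneq (sl l') a; last first.
      rewrite big1 ?mulr0 // => k _.
      by rewrite /lat_emb0 /= piece_b0 ?gr_in // co0 mxE rmorph0 mul0r.
    rewrite (bigD1 l') ?l'a //= big1 ?addr0.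
      by rewrite /lat_emb0 /= piece_bE ?gr_in ?l'a // co_b mxE !eqxx rmorph1 mul1r.
    move=> k /andP[_ kl]; rewrite /lat_emb0 /= piece_bE ?gr_in ?l'a // co_b mxE eqxx /=.
    by rewrite (negPf kl) rmorph0 mul0r.
  rewrite -big_mkcond /= /g.
  transitivity (\sum_(l' | sl l' == a) \sum_(k | sl k == a)
     (co (lat_emb0 l : M) 0 k * lmonom 1 e) * (W k l' * twpow s T q l' i)); last first.
    apply: eq_bigr => l' _; rewrite mulr_suml; apply: eq_bigr => k _.
    by rewrite !mulrA.
  rewrite exchange_big /= (bigD1 i) ?ia //= [X in _ + X]big1 ?addr0.
    by rewrite -mulr_sumr WT // eqxx mulr1 mulrC.
  by move=> k /andP[/eqP ka ki]; rewrite -mulr_sumr WT // (negPf ki) mulr0.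
Qed.
End Graded.
End SlopeFiltration.

Section SlopeFiltrationExists.
Context (S K : comPzRingType) (j : {rmorphism S -> K}) (r : nat) (w w' : 'I_r -> K).
Context (c : 'I_r -> 'I_r -> 'I_r -> S) (sep : separable_pair j w w' c).
Local Notation io := (laurent_map j).
Context (s : {rmorphism laurent S -> laurent S}) (sK : {rmorphism laurent K -> laurent K}).
Context (sio : forall a, sK (io a) = io (s a)) (sw : forall i, sK (lconst (w i)) = lconst (w i)).
Context (s_vge : forall a x, vge a x -> vge a (s x)).
Context (M : isocrystal sK) (B : fbasis io M).
Local Notation n := (fb_n B).
Local Notation b := (fb_b B).
Local Notation co := (fb_co B).
Local Notation sl := (fb_sl B).
Context (T Z : 'M[laurent S]_n).
Context (tauT : forall i, co (tau M (b i)) = row i T) (ZT : Z *m T = 1%:M).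
Context (triT : triangular sl T) (triZ : triangular sl Z).
Context (intw : forall l i i', sl i = sl i' -> vge 0 (co (lconst (w l) *: b i) 0 i')).
Context (d : nat) (pure_at : forall i0, exists (m : nat) (e : int) (W : 'M[laurent S]_n),
    [/\ (0 < m)%N, m%:R * sl i0 = e%:~R,
        forall i i', sl i = sl i0 -> sl i' = sl i0 -> vge e%:~R (twpow s T (m * d) i i'),
        forall i i', vge (- e%:~R) (W i i') &
        forall i i', sl i = sl i0 -> sl i' = sl i0 ->
          \sum_(l | sl l == sl i0) W i l * twpow s T (m * d) l i' = (i == i')%:R]).


Definition le_iso (a : rat) : isocrystal sK :=
  piece_isocrystal sio (laurent_pair sep) sw tauT ZT triT triZ (seg_le a) seg_none.

Definition le_emb (a : rat) : {linear le_iso a -> M} :=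
  @piece_val _ _ _ _ B (seg_le a) seg_none.

Definition gr_proj (a : rat) : {linear le_iso a -> gr_iso sep sio sw tauT ZT triT triZ a} :=
  @piece_proj _ _ _ _ B (seg_le a) (seg_lt a).

Lemma range_le_embP a x : range (le_emb a) x <-> fsupp B (seg_le a) x.
Proof.
split=> [[y _ <-]|xa]; first exact: piece_supp.
have xP : x \in in_piece B (seg_le a) seg_none.
  by apply/in_pieceP; split=> //; exact: ftrunc_none.
by exists (Piece xP).
Qed.

Lemma range_lt_embP a x :
  (\bigcup_(g in [set g | g < a]) range (le_emb g))%classic x <-> fsupp B (seg_lt a) x.
Proof.
split=> [[g /= ga /range_le_embP xg] i xi|xa]; first exact: le_lt_trans (xg i xi) ga.
have [g ga gP] := slopes_below B a; exists g => //.
by apply/range_le_embP => i /xa /gP.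
Qed.

Lemma slope_filtration_exists : inhabited (slope_filtration d M).
Proof.
constructor; apply: (@SlopeFiltration _ _ d M le_iso le_emb _ _ _ _ _ _ _ gr_proj).
- by move=> a; exact: val_inj.
- move=> a x.
  by rewrite -[LHS]/(ftrunc B seg_none (tau M (le_emb a x))) ftrunc_none.
- move=> a g ag x /range_le_embP xa; apply/range_le_embP => i /xa sa.
  exact: le_trans sa ag.
- apply/seteqP; split=> [x xP|x -> a _]; last by apply/range_le_embP; exact: fsupp0.
  apply: (@co_inj _ _ _ _ B); apply/rowP => i; rewrite co0 mxE; apply/eqP/negPn/negP => xi.
  have /range_le_embP/(_ i xi) := xP (sl i - 1) I.
  by rewrite /= lerBDr gerDl ler10.
- apply/seteqP; split=> // x _; exists (\sum_i `|sl i|) => //.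
  apply/range_le_embP/fsupp_le_all => i; rewrite (bigD1 i) //=.
  have : 0 <= \sum_(i' | i' != i) `|sl i'| by apply: sumr_ge0.
  have := ler_norm (sl i); lra.
- move=> a; apply/seteqP; split=> [x /range_le_embP xa g /= ag|x xP].
    by apply/range_le_embP => i /xa sa; apply: le_trans sa (ltW ag).
  apply/range_le_embP => i xi; rewrite /= leNgt; apply/negP => asl.
  have am : a < (a + sl i) / 2 by lra.
  have /range_le_embP/(_ i xi) /= := xP _ am; lra.
- move=> a y; have yP : piece_val y \in in_piece B (seg_le a) seg_none.
    by apply/in_pieceP; split; [exact: piece_supp | exact: ftrunc_none].
  by exists (Piece yP); apply: val_inj; exact: piece_trunc.
- move=> a x; apply: val_inj.
  rewrite -[LHS]/(ftrunc B (seg_lt a) (ftrunc B seg_none (tau M (le_emb a x)))).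
  rewrite -[RHS]/(ftrunc B (seg_lt a) (tau M (ftrunc B (seg_lt a) (le_emb a x)))).
  by rewrite ftrunc_none ftrunc_stable //; exact: (tau_stable sio tauT triT).
- move=> a x; apply: (iff_trans _ (iff_sym (range_lt_embP a _))); split=> [x0|xa].
    have := @ftrunc_supp _ _ _ _ B (seg_lt a) (le_emb a x).
    by have := congr1 val x0 => /= ->; rewrite subr0.
  by apply: val_inj; exact: ftrunc_eq0.
- by move=> a; exact: gr_pure.
Qed.
End SlopeFiltrationExists.

(** * Coordinates of an isocrystal over the Laurent series over the base *)

Section TensCoord.
Context (Fq : finFieldType) (k : fieldExtType Fq).
Local Notation d := (\dim {:k}).

(* [tb_l] stands for the trace form and [tb_w'] for the basis dual to [tb_w]. *)
Record trace_basis := TraceBasis {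
  tb_w : 'I_d -> k; tb_w' : 'I_d -> k; tb_l : k -> Fq;
  tb_lin : forall a x y, tb_l (a *: x + y) = a * tb_l x + tb_l y;
  tb_wE : forall x, x = \sum_j tb_l (tb_w' j * x) *: tb_w j;
  tb_w'E : forall x, x = \sum_j tb_l (tb_w j * x) *: tb_w' j;
  tb_ww' : \sum_j tb_w j * tb_w' j = 1;
  tb_dual : forall i j, tb_l (tb_w' j * tb_w i) = (i == j)%:R }.

Lemma trace_basis_exists : inhabited trace_basis.
Proof.
have [w [w' [l [l_lin wE w'E ww' dual]]]] := trace_dual_bases k.
by constructor; exists w w' l.
Qed.

Context (tb : trace_basis).
Local Notation w := (tb_w tb).
Local Notation w' := (tb_w' tb).
Local Notation l := (tb_l tb).

Lemma tb_lD x y : l (x + y) = l x + l y.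
Proof. by have := tb_lin tb 1 x y; rewrite scale1r mul1r. Qed.
Lemma tb_l0 : l 0 = 0. Proof. by apply: (addIr (l 0)); rewrite -tb_lD !add0r. Qed.
Lemma tb_lZ a x : l (a *: x) = a * l x.
Proof. by have := tb_lin tb a x 0; rewrite tb_l0 !addr0. Qed.
Lemma tb_l_sum (F : 'I_d -> k) : l (\sum_j F j) = \sum_j l (F j).
Proof. exact: (big_morph l tb_lD tb_l0). Qed.

Definition mulmat (a : k) : 'M[Fq]_d := \matrix_(i, j) l (w' j * (a * w i)).

Lemma mulmatD a b : mulmat (a + b) = mulmat a + mulmat b.
Proof. by apply/matrixP => i j; rewrite !mxE mulrDl mulrDr tb_lD. Qed.

Lemma mulmat1 : mulmat 1 = 1%:M.
Proof. by apply/matrixP => i j; rewrite !mxE mul1r tb_dual. Qed.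

Lemma mulmat_comb a j (f : k) :
  l (w' j * (a * f)) = \sum_m l (w' m * f) * l (w' j * (a * w m)).
Proof.
rewrite {1}(tb_wE tb f) !mulr_sumr tb_l_sum; apply: eq_bigr => m _.
by rewrite -!scalerAr tb_lZ.
Qed.

Lemma mulmatM a b : mulmat (a * b) = mulmat b *m mulmat a.
Proof.
apply/matrixP => i j; rewrite !mxE -mulrA (mulmat_comb a).
by apply: eq_bigr => m _; rewrite !mxE.
Qed.

Section Ring.
Context (S : comNzRingType) (iota : {rmorphism Fq -> S}).
Local Notation K := (k_tens k iota).

(* [k (x) S] in coordinates. *)
Definition krow of {rmorphism Fq -> S} := 'rV[S]_d.
HB.instance Definition _ := GRing.Zmodule.on (krow iota).

Definition krow_scale (a : k) (v : krow iota) : krow iota := v *m map_mx iota (mulmat a).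

Lemma krow_scaleA a b v : krow_scale a (krow_scale b v) = krow_scale (a * b) v.
Proof. by rewrite /krow_scale -mulmxA -map_mxM -mulmatM. Qed.
Lemma krow_scale1 : left_id 1 krow_scale.
Proof. by move=> v; rewrite /krow_scale mulmat1 map_mx1 mulmx1. Qed.
Lemma krow_scaleDr : right_distributive krow_scale +%R.
Proof. by move=> a u v; rewrite /krow_scale mulmxDl. Qed.
Lemma krow_scaleDl v : {morph krow_scale^~ v : a b / a + b}.
Proof. by move=> a b; rewrite /krow_scale mulmatD map_mxD mulmxDr. Qed.

HB.instance Definition _ := GRing.Zmodule_isLmodule.Build k (krow iota)
  krow_scaleA krow_scale1 krow_scaleDr krow_scaleDl.

Definition krow_pure (b : restr iota S^o) : krow iota := \row_j (iota (l (w' j)) * (b : S)).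

Lemma krow_pure_linear : linear_for (in_alg k \; *:%R) krow_pure.
Proof.
move=> c x y; apply/rowP => j; rewrite !mxE.
rewrite -[c *: x + y]/(iota c * (x : S) + (y : S)) mulrDr; congr (_ + _).
rewrite (eq_bigr (fun m => iota (l (w' m * 1) * l (w' j * (c%:A * w m))) * (x : S))).
  rewrite -mulr_suml -rmorph_sum -(mulmat_comb c%:A j 1) mulr1 -scalerAr mulr1 tb_lZ.
  by rewrite rmorphM mulrA [iota c * _]mulrC.
by move=> m _; rewrite !mxE mulr1 rmorphM mulrAC.
Qed.

HB.instance Definition _ := GRing.isLinear.Build Fq (restr iota S^o) (krow iota)
  (in_alg k \; *:%R) krow_pure krow_pure_linear.

(** The coordinates along the basis [tb_w]. The universal property of the tensor product requires a
    k-linear target, which is why [krow] carries a k-structure given by [mulmat]. *)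
Definition tens_coord (x : K) : 'rV[S]_d := ext_lift krow_pure x.

Lemma tens_coord_pure a b :
  tens_coord (tpure (in_alg k) iota a b) = \row_j (iota (l (w' j * a)) * b).
Proof.
rewrite /tens_coord ext_lift_pure -[_ *: _]/(krow_scale a (krow_pure b)).
apply/rowP => j; rewrite !mxE.
rewrite (eq_bigr (fun m => iota (l (w' m * 1) * l (w' j * (a * w m))) * b)).
  by rewrite -mulr_suml -rmorph_sum -(mulmat_comb a j 1) mulr1.
by move=> m _; rewrite !mxE mulr1 rmorphM mulrAC.
Qed.

Lemma tens_coordD x y : tens_coord (x + y) = tens_coord x + tens_coord y.
Proof. by rewrite /tens_coord linearD. Qed.
Lemma tens_coord0 : tens_coord 0 = 0.
Proof. by rewrite /tens_coord linear0. Qed.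

Definition tbase (b : S) : K := tpure (in_alg k) iota 1 b.
Definition tscal (a : k) : K := tpure (in_alg k) iota a 1.

Lemma tbase_zmod : zmod_morphism tbase.
Proof.
by move=> x y; apply: (addIr (tbase y)); rewrite subrK /tbase -tpureDr subrK.
Qed.
Lemma tbase_monoid : monoid_morphism tbase.
Proof. by split=> [//|x y]; rewrite /tbase tpureM mulr1. Qed.
HB.instance Definition _ := GRing.isZmodMorphism.Build S K tbase tbase_zmod.
HB.instance Definition _ := GRing.isMonoidMorphism.Build S K tbase tbase_monoid.

Lemma tscal_zmod : zmod_morphism tscal.
Proof.
by move=> x y; apply: (addIr (tscal y)); rewrite subrK /tscal -[LHS](pureDl (in_alg k) (1 : restr iota S^o)) subrK.
Qed.
Lemma tscal_monoid : monoid_morphism tscal.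
Proof. by split=> [//|x y]; rewrite /tscal tpureM mulr1. Qed.
HB.instance Definition _ := GRing.isZmodMorphism.Build k K tscal tscal_zmod.
HB.instance Definition _ := GRing.isMonoidMorphism.Build k K tscal tscal_monoid.

Lemma tscalZ c a : tscal (c *: a) = tbase (iota c) * tscal a.
Proof.
rewrite /tscal /tbase tpureM mul1r mulr1 -[iota c]mulr1 tpure_bal /=.
by rewrite -scalerAr mulr1.
Qed.

Lemma tpureE a b : tpure (in_alg k) iota a b = tbase b * tscal a.
Proof. by rewrite /tbase /tscal tpureM mul1r mulr1. Qed.

Lemma tens_coordK x : x = \sum_j tbase (tens_coord x 0 j) * tscal (w j).
Proof.
elim/tens_ind: x => [a b||x y IHx IHy].
- rewrite tens_coord_pure tpureE {1}(tb_wE tb a) rmorph_sum mulr_sumr.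
  apply: eq_bigr => j _; rewrite /= mxE tscalZ rmorphM mulrA.
  by rewrite [tbase b * _]mulrC.
- by rewrite tens_coord0 big1 // => j _; rewrite mxE rmorph0 mul0r.
- rewrite tens_coordD {1}IHx {1}IHy -big_split; apply: eq_bigr => j _.
  by rewrite mxE rmorphD mulrDl.
Qed.

Lemma tens_coordM b x : tens_coord (tbase b * x) = b *: tens_coord x.
Proof.
elim/tens_ind: x => [a b'||x y IHx IHy].
- rewrite [tbase b * _]tpureM mul1r !tens_coord_pure; apply/rowP => j; rewrite !mxE.
  by rewrite mulrCA.
- by rewrite mulr0 tens_coord0 scaler0.
- by rewrite mulrDr !tens_coordD IHx IHy scalerDr.
Qed.

Lemma tens_pair : separable_pair tbase (fun j => tscal (w j)) (fun j => tscal (w' j))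
  (fun m j i => iota (l (w' i * (w m * w j)))).
Proof.
split.
- by move=> x; exists (fun j => tens_coord x 0 j); exact: tens_coordK.
- rewrite -[RHS](rmorph1 tscal) -(tb_ww' tb) rmorph_sum.
  by apply: eq_bigr => j _; rewrite rmorphM.
- move=> m j; rewrite -rmorphM {1}(tb_wE tb (w m * w j)) rmorph_sum.
  by apply: eq_bigr => i _; rewrite /= tscalZ.
- move=> m i; rewrite -rmorphM {1}(tb_w'E tb (w' i * w m)) rmorph_sum.
  apply: eq_bigr => j _; rewrite /= tscalZ; congr (tbase (iota (l _)) * _).
  by rewrite mulrC mulrA.
Qed.
End Ring.
End TensCoord.
Arguments tens_coord {Fq k} tb {S} iota x.
Arguments tens_coordD {Fq k} tb {S} iota x y.
Arguments tens_coord0 {Fq k} tb {S} iota.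
Arguments tens_coordK {Fq k} tb {S} iota x.
Arguments tens_coordM {Fq k} tb {S} iota b x.
Arguments tbase {Fq} k {S} iota b.
Arguments tscal {Fq k S} iota a.

Section LaurentCoord.
Context (Fq : finFieldType) (k : fieldExtType Fq) (tb : trace_basis k).
Local Notation d := (\dim {:k}).

Section One.
Context (S : comNzRingType) (iota : {rmorphism Fq -> S}).
Local Notation K := (k_tens k iota).
Local Notation io := (laurent_map (tbase k iota)).
Local Notation wl j := (lconst (tscal iota (tb_w tb j))).

Lemma lcoord_bounded (x : laurent K) i :
  exists N : int, forall n : int, n < N -> tens_coord tb iota (x n) 0 i = 0.
Proof.
by have [N xN] := lcoef_bounded x; exists N => n /xN ->; rewrite tens_coord0 mxE.
Qed.

Definition lcoord i (x : laurent K) : laurent S := Laurent (lcoord_bounded x i).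

Lemma lcoordD i x y : lcoord i (x + y) = lcoord i x + lcoord i y.
Proof. by apply: laurent_eq => n; rewrite /= tens_coordD mxE. Qed.

Lemma lcoordM i a x : lcoord i (io a * x) = a * lcoord i x.
Proof.
apply: laurent_eq => n.
rewrite -[LHS]/(tens_coord tb iota (\sum_(m \in [set: int]) io a m * x (n - m)) 0 i).
rewrite -[RHS]/(\sum_(m \in [set: int]) a m * lcoord i x (n - m)).
have [N aN] := laurent_bound a a; have [N' xN] := laurent_bound x x.
pose m := absz (n + (N + N')%N%:Z + 1).
rewrite (@lmul_window _ (io a) x n (- N%:Z) m); first last.
- by move=> p pm; apply: (xN _ _).1; rewrite /m in pm; lia.
- by move=> p /aN[/= -> _]; rewrite rmorph0.
rewrite (@lmul_window _ a (lcoord i x) n (- N%:Z) m); first last.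
- by move=> p pm /=; rewrite (xN _ _).1 ?tens_coord0 ?mxE //; rewrite /m in pm; lia.
- by move=> p /aN[].
rewrite (big_morph (tens_coord tb iota) (tens_coordD tb iota) (tens_coord0 tb iota)) summxE.
by apply: eq_bigr => p _; rewrite /= tens_coordM mxE.
Qed.

Lemma lcoordK x : x = \sum_i io (lcoord i x) * wl i.
Proof.
apply: laurent_eq => n; rewrite lcoef_sum [LHS](tens_coordK tb iota); apply: eq_bigr => i _.
by rewrite [io _ * _]mulrC lconstM mulrC.
Qed.

Lemma sigma_io a : sigma k iota (io a) = io (laurent_map (frobq_of iota) a).
Proof. by apply: laurent_eq => n /=; rewrite tens_map_pure. Qed.

Lemma sigma_scal c : sigma k iota (lconst (tscal iota c)) = lconst (tscal iota c).
Proof.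
apply: laurent_eq => n /=; case: ifP => _; last by rewrite rmorph0.
by rewrite tens_map_pure /= /frobq_of expr1n.
Qed.
End One.
Arguments lcoord {S} iota i x.

Section Map.
Context (R S : comNzRingType) (iota : {rmorphism Fq -> R}) (h : {rmorphism R -> S}).
Local Notation phi := (E_F_map k iota h).

Lemma tens_coord_map x : tens_coord tb (h \o iota) (tens_map (f := in_alg k) (g' := h \o iota)
  (h := h) (fun=> erefl) x) = map_mx h (tens_coord tb iota x).
Proof.
elim/tens_ind: x => [a b||x y IHx IHy].
- rewrite tens_map_pure !tens_coord_pure; apply/rowP => j; rewrite !mxE.
  by rewrite rmorphM.
- by rewrite rmorph0 !tens_coord0 map_mx0.
- by rewrite rmorphD !tens_coordD IHx IHy map_mxD.
Qed.

Lemma lcoord_map i e : lcoord (h \o iota : {rmorphism Fq -> S}) i (phi e) = laurent_map h (lcoord iota i e).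
Proof. by apply: laurent_eq => n; rewrite /= tens_coord_map mxE. Qed.

Lemma phi_scal c : phi (lconst (tscal iota c)) = lconst (tscal (h \o iota) c).
Proof.
apply: laurent_eq => n /=; case: ifP => _; last by rewrite rmorph0.
by rewrite tens_map_pure rmorph1.
Qed.
End Map.
End LaurentCoord.
Arguments lcoord {Fq k} tb {S} iota i x.

(** * Matrices of an isocrystal in a dual system *)

Section DualSystem.
Context (A E : comPzRingType) (io : {rmorphism A -> E}) (M : lmodType E).

(* The family [ds_y] need not be free: it presents [M] as a direct summand of a free
   [A]-module. *)
Record dual_system := DualSystem {
  ds_n : nat; ds_y : 'I_ds_n -> M; ds_co : M -> 'rV[A]_ds_n;
  ds_lin : forall a x x', ds_co (io a *: x + x') = a *: ds_co x + ds_co x';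
  ds_K : forall x, x = \sum_i io (ds_co x 0 i) *: ds_y i }.
End DualSystem.
Arguments ds_n {A E io M} d.
Arguments ds_y {A E io M} d i.
Arguments ds_co {A E io M} d x.
Arguments ds_lin {A E io M} d a x x'.
Arguments ds_K {A E io M} d x.

Section DualSystemTheory.
Context (A E : comPzRingType) (io : {rmorphism A -> E}) (M : lmodType E).
Context (ds : dual_system io M).
Local Notation co := (ds_co ds).
Local Notation y := (ds_y ds).

Lemma ds_coD x x' : co (x + x') = co x + co x'.
Proof. by rewrite -[x in LHS]scale1r -(rmorph1 io) ds_lin scale1r. Qed.

Lemma ds_co0 : co 0 = 0.
Proof. by apply: (addIr (co 0)); rewrite -ds_coD !add0r. Qed.

Lemma ds_coZ a x : co (io a *: x) = a *: co x.
Proof. by rewrite -[_ *: x]addr0 ds_lin ds_co0 addr0. Qed.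

Lemma ds_co_sum (I : Type) (r : seq I) (P : pred I) (F : I -> M) :
  co (\sum_(i <- r | P i) F i) = \sum_(i <- r | P i) co (F i).
Proof. exact: (big_morph co ds_coD ds_co0). Qed.

Definition ds_mx (f : M -> M) : 'M[A]_(ds_n ds) := \matrix_a co (f (y a)).

Lemma ds_mxP (t : {rmorphism A -> A}) (f : M -> M) :
  (forall x x', f (x + x') = f x + f x') -> (forall a x, f (io a *: x) = io (t a) *: f x) ->
  forall x, co (f x) = map_mx t (co x) *m ds_mx f.
Proof.
move=> fD fZ x; have f0 : f 0 = 0 by apply: (addIr (f 0)); rewrite -fD !add0r.
rewrite [x in LHS](ds_K ds) (big_morph f fD f0) ds_co_sum mulmx_sum_row.
by apply: eq_bigr => i _; rewrite fZ ds_coZ rowK mxE.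
Qed.

Lemma ds_mx_linP (f : M -> M) :
  (forall x x', f (x + x') = f x + f x') -> (forall a x, f (io a *: x) = io a *: f x) ->
  forall x, co (f x) = co x *m ds_mx f.
Proof.
move=> fD fZ x; have f0 : f 0 = 0 by apply: (addIr (f 0)); rewrite -fD !add0r.
rewrite [x in LHS](ds_K ds) (big_morph f fD f0) ds_co_sum mulmx_sum_row.
by apply: eq_bigr => i _; rewrite fZ ds_coZ rowK.
Qed.

Lemma ds_mx_row f a : row a (ds_mx f) = co (f (y a)).
Proof. by rewrite rowK. Qed.
End DualSystemTheory.

Section FunctionalSystem.
Context (Fq : finFieldType) (k : fieldExtType Fq) (tb : trace_basis k).
Context (S : comNzRingType) (iota : {rmorphism Fq -> S}).
Local Notation K := (k_tens k iota).
Local Notation io := (laurent_map (tbase k iota)).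
Context (M : lmodType (laurent K)) (m : nat) (g : 'I_m -> M).
Context (h : 'I_m -> M -> laurent K).
Hypothesis h_lin : forall i e x x', h i (e *: x + x') = e * h i x + h i x'.
Hypothesis hK : forall x, x = \sum_i h i x *: g i.
Local Notation U := ('I_m * 'I_(\dim {:k}))%type.

Definition fsys_y (a : 'I_#|{: U}|) : M :=
  lconst (tscal iota (tb_w tb (enum_val a).2)) *: g (enum_val a).1.
Definition fsys_co (x : M) : 'rV[laurent S]_#|{: U}| :=
  \row_a lcoord tb iota (enum_val a).2 (h (enum_val a).1 x).

Lemma fsys_lin a x x' : fsys_co (io a *: x + x') = a *: fsys_co x + fsys_co x'.
Proof. by apply/rowP => i; rewrite !mxE h_lin lcoordD lcoordM. Qed.

Lemma fsys_K x : x = \sum_i io (fsys_co x 0 i) *: fsys_y i.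
Proof.
pose F (u : U) := io (lcoord tb iota u.2 (h u.1 x)) *: (lconst (tscal iota (tb_w tb u.2)) *: g u.1).
rewrite (eq_bigr (fun i => F (enum_val i))); last by move=> i _; rewrite mxE.
rewrite -(big_enum_val F) -(pair_bigA _ (fun i j => F (i, j))) /=.
rewrite [LHS]hK; apply: eq_bigr => i _.
rewrite {1}[h i x](lcoordK tb) scaler_suml; apply: eq_bigr => j _.
by rewrite -scalerA.
Qed.

End FunctionalSystem.

Section ProjectiveSystem.
Context (E : comPzRingType) (M : lmodType E).

(** The dual basis lemma: a section of a surjection from a free module has the functionals as its
    entries. *)
Lemma projective_functionals : finitely_generated M -> projective M ->
  exists (m : nat) (g : 'I_m -> M) (h : 'I_m -> {linear M -> E^o}),
    forall x, x = \sum_i h i x *: g i.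
Proof.
move=> [m [g gen]] proj; exists m, g.
pose p (v : 'rV[E]_m) : M := \sum_i v 0 i *: g i.
have p_lin : linear p.
  move=> a u v; rewrite /p scaler_sumr -big_split; apply: eq_bigr => i _.
  by rewrite !mxE scalerDl scalerA.
pose pL : {linear 'rV[E]_m -> M} := HB.pack p (GRing.isLinear.Build _ _ _ _ p p_lin).
have p_surj x : exists v, pL v = x.
  have [a ->] := gen x; exists (\row_i a i).
  by apply: eq_bigr => i _; rewrite mxE.
have [h hP] := proj _ _ pL idfun p_surj.
pose hi0 (i : 'I_m) (x : M) : E^o := h x 0 i.
have hi_lin i : linear (hi0 i) by move=> a x y; rewrite /hi0 linearP !mxE.
pose hi (i : 'I_m) : {linear M -> E^o} :=
  HB.pack (hi0 i) (GRing.isLinear.Build E M E^o *:%R (hi0 i) (hi_lin i)).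
exists hi.
by move=> x; rewrite -{1}[x]hP.
Qed.
End ProjectiveSystem.

Section BaseChangeFunctionals.
Context (E E' : comPzRingType) (phi : {rmorphism E -> E'}) (M : lmodType E).
Context (m : nat) (g : 'I_m -> M) (h : 'I_m -> {linear M -> E^o}).
Hypothesis hK : forall x, x = \sum_i h i x *: g i.

Lemma bc_functionals : exists h' : 'I_m -> ext phi M -> E',
  [/\ forall i e x x', h' i (e *: x + x') = e * h' i x + h' i x',
      forall x, x = \sum_i h' i x *: ptensor phi 1 (g i) &
      forall i e x, h' i (ptensor phi e x) = e * phi (h i x)].
Proof.
pose f (i : 'I_m) (x : M) : E'^o := phi (h i x).
have f_lin i : linear_for (phi \; *:%R) (f i).
  by move=> a x y; rewrite /f linearP rmorphD rmorphM.
pose fL (i : 'I_m) : {linear M -> E'^o | phi \; *:%R} :=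
  HB.pack (f i) (GRing.isLinear.Build E M E'^o (phi \; *:%R) (f i) (f_lin i)).
pose h' (i : 'I_m) (x : ext phi M) : E' := ext_lift (fL i) x.
have h'_lin i e x x' : h' i (e *: x + x') = e * h' i x + h' i x' by rewrite /h' linearP.
have h'p i e x : h' i (ptensor phi e x) = e * phi (h i x) by rewrite /h' ext_lift_pure.
exists h'; split=> // x; elim/ext_ind: x => [e x||x y IHx IHy].
- rewrite {1}[x]hK (big_morph (ptensor phi e) (pureDr phi e) (pure0 phi _ e)).
  by apply: eq_bigr => i _; rewrite h'p pureZ scale_pure mulr1.
- by rewrite big1 // => i _; rewrite /h' linear0 scale0r.
- rewrite {1}IHx {1}IHy -big_split; apply: eq_bigr => i _.
  by rewrite -[x in h' i (x + y)]scale1r h'_lin mul1r scalerDl.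
Qed.
End BaseChangeFunctionals.

Section IsocrystalMatrices.
Context (Fq : finFieldType) (k : fieldExtType Fq) (tb : trace_basis k).
Context (S : comNzRingType) (iota : {rmorphism Fq -> S}).
Local Notation K := (k_tens k iota).
Local Notation io := (laurent_map (tbase k iota)).
Local Notation s := (laurent_map (frobq_of iota)).
Context (M : isocrystal_over k iota) (ds : dual_system io M).
Local Notation co := (ds_co ds).
Local Notation y := (ds_y ds).

Definition kact (c : k) (x : M) : M := lconst (tscal iota c) *: x.
(** The family is not assumed free, so the identity is represented by an idempotent that may differ
    from [1%:M]; its row space is the coordinate module of M. *)
Definition idm_mx := ds_mx ds id.
Definition tau_mx := ds_mx ds (tau M).
Definition kact_mx c := ds_mx ds (kact c).


Lemma co_idm x : co x *m idm_mx = co x.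
Proof. by rewrite -(@ds_mx_linP _ _ _ _ ds id). Qed.

Lemma co_tau_mx x : co (tau M x) = map_mx s (co x) *m tau_mx.
Proof.
apply: (@ds_mxP _ _ _ _ ds s (tau M)) => [u v|a u]; first exact: linearD.
by rewrite linearZ /= sigma_io.
Qed.

Lemma co_kact c x : co (kact c x) = co x *m kact_mx c.
Proof.
apply: (@ds_mx_linP _ _ _ _ ds (kact c)) => [u v|a u]; first exact: scalerDr.
by rewrite /kact !scalerA mulrC.
Qed.

Lemma idm_idm : idm_mx *m idm_mx = idm_mx.
Proof. by apply/row_matrixP => a; rewrite row_mul ds_mx_row co_idm. Qed.

Lemma tau_idm : tau_mx *m idm_mx = tau_mx.
Proof. by apply/row_matrixP => a; rewrite row_mul ds_mx_row co_idm. Qed.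

Lemma idm_tau : map_mx s idm_mx *m tau_mx = tau_mx.
Proof. by apply/row_matrixP => a; rewrite row_mul -map_row !ds_mx_row -co_tau_mx. Qed.

Lemma kact_idm c : kact_mx c *m idm_mx = kact_mx c.
Proof. by apply/row_matrixP => a; rewrite row_mul ds_mx_row co_idm. Qed.

Lemma kact_mx1 : kact_mx 1 = idm_mx.
Proof.
apply/row_matrixP => a; rewrite !ds_mx_row /kact.
by rewrite !rmorph1 scale1r.
Qed.

Lemma kact_mxM c c' : kact_mx c *m kact_mx c' = kact_mx (c * c').
Proof.
apply/row_matrixP => a; rewrite row_mul !ds_mx_row -co_kact /kact scalerA.
by rewrite -!rmorphM mulrC.
Qed.

Lemma kact_tau c : map_mx s (kact_mx c) *m tau_mx = tau_mx *m kact_mx c.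
Proof.
apply/row_matrixP => a; rewrite !row_mul -map_row !ds_mx_row -co_tau_mx -co_kact.
by rewrite /kact linearZ /= sigma_scal.
Qed.

(** Surjectivity of the linearization in matrix form. The scalars from k are fixed by [sigma], so
    they can be absorbed into the argument of tau. *)
Lemma tau_generates : exists C, C *m tau_mx = idm_mx.
Proof.
have [v vK Kv] := isocrystal_lin M.
pose gen (x : M) := exists c : 'rV[laurent S]_(ds_n ds), x = \sum_i io (c 0 i) *: tau M (y i).
have genD x x' : gen x -> gen x' -> gen (x + x').
  move=> [c ->] [c' ->]; exists (c + c'); rewrite -big_split; apply: eq_bigr => i _.
  by rewrite mxE rmorphD scalerDl.
have gen0 : gen 0.
  by exists 0; rewrite big1 // => i _; rewrite mxE rmorph0 scale0r.
have gen_sum (I : Type) (r : seq I) (F : I -> M) :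
    (forall i, gen (F i)) -> gen (\sum_(i <- r) F i).
  by move=> FP; elim/big_ind: _.
have genA a x : gen x -> gen (io a *: x).
  move=> [c ->]; exists (a *: c); rewrite scaler_sumr; apply: eq_bigr => i _.
  by rewrite mxE rmorphM scalerA.
have gen_tau x : gen (tau M x).
  exists (map_mx s (co x)); rewrite {1}[x](ds_K ds) linear_sum; apply: eq_bigr => i _.
  by rewrite linearZ /= sigma_io mxE.
have genE e x : gen (e *: tau M x).
  rewrite [e](lcoordK tb) scaler_suml; apply: gen_sum => i; rewrite -scalerA; apply: genA.
  by rewrite -sigma_scal -linearZ; exact: gen_tau.
have gen_all x : gen x.
  rewrite -[x]Kv; elim/ext_ind: (v x) => [e m||u u' IHu IHu'].
  - by rewrite /linearization ext_lift_pure; exact: genE.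
  - by rewrite /linearization linear0.
  - by rewrite /linearization linearD; exact: genD.
have [c cP] := boolp.choice (fun a => gen_all (y a)).
exists (\matrix_a c a); apply/row_matrixP => a.
rewrite row_mul rowK ds_mx_row /= (cP a) ds_co_sum mulmx_sum_row.
by apply: eq_bigr => i _; rewrite ds_coZ ds_mx_row.
Qed.
End IsocrystalMatrices.

(** * The slope form of an isocrystal over the field of series *)

Section FrobeniusGls.
Context (Fq : finFieldType) (R : idomainType) (iota : {rmorphism Fq -> R}).
Local Notation Q := {fraction R}.
Local Notation G := (gls R).

Definition frob_frac : {rmorphism Q -> Q} := frobq_of (@FracField.tofrac R \o iota).

Lemma frob_gls_away (x : G) : laurent_map frob_frac x \in gls_pred R.
Proof.
have [xi xi0 xP] := gls_away x; apply/asboolP; exists xi => // n.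
by rewrite /= /frobq_of rpredX.
Qed.

Definition frob_gls0 (x : G) : G := Gls (frob_gls_away x).

Lemma frob_gls_zmod : zmod_morphism frob_gls0.
Proof. by move=> x y; apply: val_inj; exact: (rmorphB (laurent_map frob_frac)). Qed.

Lemma frob_gls_monoid : monoid_morphism frob_gls0.
Proof.
split=> [|x y]; apply: val_inj; first exact: (rmorph1 (laurent_map frob_frac)).
exact: (rmorphM (laurent_map frob_frac)).
Qed.

HB.instance Definition _ := GRing.isZmodMorphism.Build G G frob_gls0 frob_gls_zmod.
HB.instance Definition _ := GRing.isMonoidMorphism.Build G G frob_gls0 frob_gls_monoid.

Definition frob_gls : {rmorphism G -> G} := frob_gls0.

Lemma frob_coefwise : coefwise frob_gls frob_frac.
Proof. by split=> // xi a aP; rewrite /= /frobq_of rpredX. Qed.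

Lemma gls_of_subproof (x : laurent R) : laurent_map (@FracField.tofrac R) x \in gls_pred R.
Proof.
by apply/asboolP; exists 1; rewrite ?oner_eq0 // => n; exact: away_pred_tofrac.
Qed.

Definition gls_of (x : laurent R) : G := Gls (gls_of_subproof x).

Lemma gls_of_zmod : zmod_morphism gls_of.
Proof. by move=> x y; apply: val_inj; exact: (rmorphB (laurent_map _)). Qed.

Lemma gls_of_monoid : monoid_morphism gls_of.
Proof.
split=> [|x y]; apply: val_inj; first exact: (rmorph1 (laurent_map _)).
exact: (rmorphM (laurent_map _)).
Qed.

HB.instance Definition _ := GRing.isZmodMorphism.Build (laurent R) G gls_of gls_of_zmod.
HB.instance Definition _ := GRing.isMonoidMorphism.Build (laurent R) G gls_of gls_of_monoid.

Lemma gls_of_frob x : gls_of (laurent_map (frobq_of iota) x) = frob_gls (gls_of x).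
Proof. by apply: gls_eq => n; rewrite /= /frobq_of rmorphXn. Qed.
End FrobeniusGls.

(** A rank factorization of e; idempotence, with the outer factors cancelled, says that the two
    factors compose to 1 in the other order. *)
Lemma idempotent_split (F : fieldType) N (e : 'M[F]_N) : e *m e = e ->
  exists n (P : 'M[F]_(n, N)) (Pi : 'M[F]_(N, n)), P *m Pi = 1%:M /\ Pi *m P = e.
Proof.
move=> ee; exists (\rank e), (row_base e), (col_base e); split; last exact: mulmx_base.
have /row_freeP[B rB] := row_base_free e.
have /row_fullP[C Cc] := col_base_full e.
have canc r (cb : 'M_(N, r)) (rb : 'M_(r, N)) C' B' : C' *m cb = 1%:M -> rb *m B' = 1%:M ->
    cb *m rb *m (cb *m rb) = cb *m rb -> rb *m cb = 1%:M.
  move=> Ccb rbB /(congr1 (fun X => C' *m X *m B')).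
  by rewrite /= !mulmxA Ccb !mul1mx -!mulmxA rbB mulmx1.
by apply: canc Cc rB _; rewrite mulmx_base.
Qed.

Section SplitForm.
Context (R : idomainType) (I : finType) (d : nat) (d_gt0 : (0 < d)%N).
Local Notation Q := {fraction R}.
Local Notation G := (gls R).
Context (sG : {rmorphism G -> G}) (s0 : {rmorphism Q -> Q}) (ss0 : coefwise sG s0).

(** On the image of the idempotent, [C *m T = e] becomes invertibility of the matrix of the
    semilinear map. *)
Lemma split_slope_form N (e T C : 'M[G]_N) (H : I -> 'M[G]_N) :
  e *m e = e -> T *m e = T -> map_mx sG e *m T = T -> C *m T = e ->
  (forall i, H i *m e = H i) -> (exists i, H i = e) ->
  (forall i i', exists l, H i *m H i' = H l) ->
  (forall i, map_mx sG (H i) *m T = T *m H i) ->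
  exists n (P : 'M[G]_(n, N)) (Pi : 'M[G]_(N, n)) (T' Z : 'M[G]_n) (H' : I -> 'M[G]_n)
    (sl : 'I_n -> rat),
  [/\ P *m Pi = 1%:M, Pi *m P = e, map_mx sG P *m T *m Pi = T',
      forall i, P *m H i *m Pi = H' i &
      slope_form sG d T' H' 1%:M 1%:M T' Z H' sl].
Proof.
move=> ee Te eT CT He [i1 Hi1] HM HT.
have [n0 [P0 [Pi0 [PP0 PP0e]]]] := idempotent_split ee.
have P0e : P0 *m e = P0 by rewrite -PP0e mulmxA PP0 mul1mx.
have sPP : map_mx sG Pi0 *m map_mx sG P0 = map_mx sG e by rewrite -map_mxM PP0e.
pose T0 := map_mx sG P0 *m T *m Pi0; pose H0 i := P0 *m H i *m Pi0.
have T0_unit : T0 \in unitmx.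
  have : (P0 *m C *m map_mx sG Pi0) *m T0 = 1%:M.
    rewrite /T0 !mulmxA -[_ *m map_mx sG Pi0 *m map_mx sG P0]mulmxA sPP.
    rewrite -[_ *m map_mx sG e *m T]mulmxA eT -[_ *m C *m T]mulmxA.
    by rewrite CT P0e PP0.
  by case/mulmx1_unit.
have monH0 : commuting_monoid sG T0 H0.
  split.
  - by exists i1; rewrite /H0 Hi1 P0e PP0.
  - move=> i i'; have [l Hl] := HM i i'; exists l.
    rewrite /H0 !mulmxA -[_ *m Pi0 *m P0]mulmxA PP0e -[_ *m H i *m e]mulmxA He.
    by rewrite -[_ *m _ *m H i']mulmxA Hl.
  - move=> i; rewrite /H0 /T0 !map_mxM !mulmxA.
    rewrite -[_ *m map_mx sG Pi0 *m map_mx sG P0]mulmxA sPP.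
    rewrite -[_ *m map_mx sG e *m T]mulmxA eT -[_ *m Pi0 *m P0]mulmxA PP0e.
    by rewrite -[_ *m T *m e]mulmxA Te -[_ *m _ *m T]mulmxA HT mulmxA.
have [n [P1 [Pi1 [T' [Z [H' [sl [PP1 PiP1 T'E H'E ZT triT triZ triH intH pure bound]]]]]]]] :=
  slope_form_exists ss0 d_gt0 T0_unit monH0.
exists n, (P1 *m P0), (Pi0 *m Pi1), T', Z, H', sl; split.
- by rewrite mulmxA -(mulmxA P1) PP0 mulmx1.
- by rewrite mulmxA -(mulmxA Pi0) PiP1 mulmx1.
- by rewrite -T'E map_mxM !mulmxA.
- by move=> i; rewrite -H'E !mulmxA.
split=> //.
- by rewrite mulmx1.
- by rewrite mulmx1.
- by rewrite mulmx1 map_mx1 mul1mx.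
- by move=> i; rewrite mulmx1 mul1mx.
- move=> g gT; apply: bound; apply: (bounded_change PP1 PiP1).
  by rewrite T'E.
Qed.
End SplitForm.

Section GenericForm.
Context (Fq : finFieldType) (k : fieldExtType Fq) (tb : trace_basis k).
Context (R : idomainType) (iota : {rmorphism Fq -> R}).
Local Notation G := (gls R).
Local Notation io := (laurent_map (tbase k iota)).
Local Notation s := (laurent_map (frobq_of iota)).
Local Notation sG := (frob_gls iota).
Context (M : isocrystal_over k iota) (ds : dual_system io M).
Local Notation gm X := (map_mx (@gls_of R) X).

Lemma generic_slope_form : exists n (P : 'M[G]_(n, ds_n ds)) (Pi : 'M[G]_(ds_n ds, n))
    (T' Z : 'M[G]_n) (H' : finvect_type k -> 'M[G]_n) (sl : 'I_n -> rat),
  [/\ P *m Pi = 1%:M, Pi *m P = gm (idm_mx ds),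
      map_mx sG P *m gm (tau_mx ds) *m Pi = T',
      forall c, P *m gm (kact_mx ds c) *m Pi = H' c &
      slope_form sG (\dim {:k}) T' H' 1%:M 1%:M T' Z H' sl].
Proof.
have map_s p q (X : 'M[laurent R]_(p, q)) : gm (map_mx s X) = map_mx sG (gm X).
  by apply/matrixP => i j; rewrite !mxE gls_of_frob.
have [C CT] := tau_generates tb ds.
apply: (@split_slope_form R (finvect_type k) (\dim {:k}) (adim_gt0 {:k}%AS) sG _
  (frob_coefwise iota) _ (gm (idm_mx ds)) (gm (tau_mx ds)) (gm C) (fun c => gm (kact_mx ds c))).
- by rewrite -map_mxM idm_idm.
- by rewrite -map_mxM tau_idm.
- by rewrite -map_s -map_mxM idm_tau.
- by rewrite -map_mxM CT.
- by move=> c; rewrite -map_mxM kact_idm.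
- by exists (1 : k); rewrite kact_mx1.
- by move=> c c'; exists ((c : k) * (c' : k)); rewrite -map_mxM kact_mxM.
- by move=> c; rewrite -map_s -!map_mxM kact_tau.
Qed.
End GenericForm.

(** * Descent to a single localization *)

Section AwayMap.
Context (Fq : finFieldType) (R : idomainType) (iota : {rmorphism Fq -> R}) (xi : R).
Local Notation Q := {fraction R}.
Local Notation G := (gls R).
Local Notation S := (away xi).

Definition away_frac : {rmorphism S -> Q} := val.
Definition away_laurent : {rmorphism laurent S -> laurent Q} := laurent_map away_frac.

Lemma away_laurent_inj : injective away_laurent.
Proof.
move=> x y xy; apply: laurent_eq => n; apply: val_inj.
exact: (congr1 (fun z : laurent Q => z n) xy).
Qed.

Lemma away_laurent_vge a x : vge a (away_laurent x) -> vge a x.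
Proof. by move=> xa n na; apply: val_inj; rewrite -[LHS]/(away_laurent x n) xa. Qed.

Lemma away_laurent_frob x : away_laurent (laurent_map (frobq_of (to_away xi \o iota)) x) =
  laurent_map (frob_frac iota) (away_laurent x).
Proof. by apply: laurent_eq => n; exact: (rmorphXn away_frac). Qed.

Lemma away_laurent_to_away x :
  away_laurent (laurent_map (to_away xi) x) = gls_val (gls_of x).
Proof. exact: laurent_eq. Qed.

Lemma away_lift (x : G) : coefs_away xi x -> exists y, away_laurent y = gls_val x.
Proof.
move=> xP; have y_bounded : exists N : int, forall n, n < N -> Away (xP n) = 0 :> S.
  by have [N xN] := lcoef_bounded (gls_val x); exists N => n /xN x0; apply: val_inj.
by exists (Laurent y_bounded); apply: laurent_eq.
Qed.

Lemma away_lift_mx p q (X : 'M[G]_(p, q)) : maway xi X ->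
  exists Y, map_mx away_laurent Y = map_mx (@gls_val R) X.
Proof.
move=> XP; have XP' (u : 'I_p * 'I_q) : exists y, away_laurent y = gls_val (X u.1 u.2).
  exact: away_lift (XP _ _).
have [f fE] := boolp.choice XP'; exists (\matrix_(i, j) f (i, j)).
by apply/matrixP => i j; rewrite !mxE fE.
Qed.

Lemma away_map_frob p q (X : 'M[laurent S]_(p, q)) (Y : 'M[G]_(p, q)) :
  map_mx away_laurent X = map_mx (@gls_val R) Y ->
  map_mx away_laurent (map_mx (laurent_map (frobq_of (to_away xi \o iota))) X) =
  map_mx (@gls_val R) (map_mx (frob_gls iota) Y).
Proof.
move=> XY; apply/matrixP => i j; rewrite !mxE away_laurent_frob.
by have /matrixP/(_ i j) := XY; rewrite !mxE => ->.
Qed.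
End AwayMap.

Section Spread.
Context (Fq : finFieldType) (R : idomainType) (iota : {rmorphism Fq -> R}).
Local Notation Q := {fraction R}.
Local Notation G := (gls R).
Local Notation sG := (frob_gls iota).
Local Notation gv := (map_mx (@gls_val R)).
Context (I : finType) (d N n : nat) (P : 'M[G]_(n, N)) (Pi : 'M[G]_(N, n))
  (e T : 'M[laurent R]_N) (H : I -> 'M[laurent R]_N) (T' Z : 'M[G]_n) (H' : I -> 'M[G]_n)
  (sl : 'I_n -> rat).
Local Notation gm X := (map_mx (@gls_of R) X).
Context (PPi : P *m Pi = 1%:M) (PiP : Pi *m P = gm e)
  (T'E : map_mx sG P *m gm T *m Pi = T') (H'E : forall c, P *m gm (H c) *m Pi = H' c)
  (slf : slope_form sG d T' H' 1%:M 1%:M T' Z H' sl).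

Section Over.
Context (xi : R).
Local Notation S := (away xi).
Local Notation sS := (laurent_map (frobq_of (to_away xi \o iota))).
Local Notation hS X := (map_mx (laurent_map (to_away xi)) X).

Record spread_form (P_S : 'M[laurent S]_(n, N)) (Pi_S : 'M[laurent S]_(N, n))
    (T_S Z_S : 'M[laurent S]_n) (H_S : I -> 'M[laurent S]_n) : Prop := SpreadForm {
  spf_PPi : P_S *m Pi_S = 1%:M;
  spf_PiP : Pi_S *m P_S = hS e;
  spf_T : map_mx sS P_S *m hS T *m Pi_S = T_S;
  spf_H : forall c, P_S *m hS (H c) *m Pi_S = H_S c;
  spf_Z : Z_S *m T_S = 1%:M;
  spf_triT : triangular sl T_S;
  spf_triZ : triangular sl Z_S;
  spf_triH : forall c, triangular sl (H_S c);
  spf_intH : forall c i j, sl i = sl j -> vge 0 (H_S c i j);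
  spf_pure : forall i0, exists (m : nat) (e : int) (W : 'M[laurent S]_n),
    [/\ (0 < m)%N, (m * d)%:R * sl i0 = e%:~R,
        forall i j, sl i = sl i0 -> sl j = sl i0 -> vge e%:~R (twpow sS T_S (m * d) i j),
        forall i j, vge (- e%:~R) (W i j) &
        forall i j, sl i = sl i0 -> sl j = sl i0 ->
          \sum_(l | sl l == sl i0) W i l * twpow sS T_S (m * d) l j = (i == j)%:R] }.
End Over.

(** Laurent series over R[xi^-1] embed in those over the fraction field, so matrix identities and
    bounds descend. Denominators are cleared for [P], [Pi], [Z] and the [W]; [T_S] and [H_S] are
    defined by conjugation and automatically descend [T'] and [H']. *)
Lemma spread_form_exists : exists2 xi : R, xi != 0 &
  exists P_S Pi_S T_S Z_S H_S, @spread_form xi P_S Pi_S T_S Z_S H_S.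
Proof.
have [_ _ _ _ ZT triT triZ triH intH pure _] := slf.
have [m {}pure] := boolp.choice pure; have [e' {}pure] := boolp.choice pure.
have [W {}pure] := boolp.choice pure.
have [xP xP0 P_away] := mx_away_family P; have [xPi xPi0 Pi_away] := mx_away_family Pi.
have [xZ xZ0 Z_away] := mx_away_family Z.
have [xW xW0 W_away] := gls_away_family (fun u : 'I_n * 'I_n * 'I_n => W u.1.1 u.1.2 u.2).
pose xi := xP * xPi * xZ * xW; have xi0 : xi != 0 by rewrite !mulf_neq0.
exists xi => //.
pose S := away xi; pose psi := away_laurent xi.
have psiM p q (X Y : 'M[laurent S]_(p, q)) : map_mx psi X = map_mx psi Y -> X = Y.
  move=> /matrixP XY; apply/matrixP => i j; apply: (@away_laurent_inj R xi).
  by have := XY i j; rewrite !mxE.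
have [P_S PE] : exists Y, map_mx psi Y = gv P.
  by apply: away_lift_mx => i j; rewrite /xi -!mulrA; apply: coefs_away_dvd; rewrite ?mulf_neq0.
have [Pi_S PiE] : exists Y, map_mx psi Y = gv Pi.
  apply: away_lift_mx => i j; rewrite /xi [xP * xPi]mulrC -!mulrA.
  by apply: coefs_away_dvd; rewrite ?mulf_neq0.
have [Z_S ZE] : exists Y, map_mx psi Y = gv Z.
  apply: away_lift_mx => i j; rewrite /xi [_ * xZ]mulrC -!mulrA.
  by apply: coefs_away_dvd; rewrite ?mulf_neq0.
have W_S i0 : exists Y, map_mx psi Y = gv (W i0).
  apply: away_lift_mx => i j; rewrite /xi [_ * xW]mulrC; apply: coefs_away_dvd.
    by rewrite ?mulf_neq0.
  exact: W_away (i0, i, j).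
have hSE p q (X : 'M[laurent R]_(p, q)) :
    map_mx psi (map_mx (laurent_map (to_away xi)) X) = gv (gm X).
  by apply/matrixP => i j; rewrite !mxE away_laurent_to_away.
pose sS : {rmorphism laurent S -> laurent S} := laurent_map (frobq_of (to_away xi \o iota)).
pose T_S := map_mx sS P_S *m map_mx (laurent_map (to_away xi)) T *m Pi_S.
pose H_S c := P_S *m map_mx (laurent_map (to_away xi)) (H c) *m Pi_S.
have TE : map_mx psi T_S = gv T'.
  by rewrite !map_mxM (away_map_frob iota PE) hSE PiE -!map_mxM T'E.
have HE c : map_mx psi (H_S c) = gv (H' c).
  by rewrite !map_mxM PE hSE PiE -!map_mxM H'E.
have TqE q : map_mx psi (twpow sS T_S q) = gv (twpow sG T' q).
  rewrite (twpow_map (t := laurent_map (frob_frac iota))) ?TE; last exact: away_laurent_frob.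
  by rewrite -(twpow_map (s := sG)).
have entry p q (X : 'M[laurent S]_(p, q)) (Y : 'M[G]_(p, q)) : map_mx psi X = gv Y ->
    forall i j, psi (X i j) = gls_val (Y i j).
  by move=> /matrixP XY i j; have := XY i j; rewrite !mxE.
have tri (X : 'M[laurent S]_n) Y : map_mx psi X = gv Y -> triangular sl Y -> triangular sl X.
  move=> XY triY i j Xij; apply: triY => Yij; apply: Xij.
  by apply: (@away_laurent_inj R xi); rewrite -/psi (entry _ _ _ _ XY) Yij !rmorph0.
exists P_S, Pi_S, T_S, Z_S, H_S; split=> //.
- by apply: psiM; rewrite map_mxM PE PiE -map_mxM PPi !map_mx1.
- by apply: psiM; rewrite map_mxM PE PiE -map_mxM PiP hSE.
- by apply: psiM; rewrite map_mxM ZE TE -map_mxM ZT !map_mx1.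
- exact: tri TE triT.
- exact: tri ZE triZ.
- by move=> c; exact: tri (HE c) (triH c).
- move=> c i j sij; apply: away_laurent_vge; rewrite -/psi (entry _ _ _ _ (HE c)).
  exact: intH.
- move=> i0; have [m0 me Tq_ge W_ge WT] := pure i0; have [Wi WiE] := W_S i0.
  exists (m i0), (e' i0), Wi; split=> //.
  + move=> i j si sj; apply: away_laurent_vge; rewrite -/psi (entry _ _ _ _ (TqE _)).
    exact: Tq_ge.
  + by move=> i j; apply: away_laurent_vge; rewrite -/psi (entry _ _ _ _ WiE); exact: W_ge.
  + move=> i j si sj; apply: (@away_laurent_inj R xi); rewrite -/psi rmorph_sum.
    have := congr1 (@gls_val R) (WT i j si sj); rewrite gls_val_sum rmorph_nat => E.
    rewrite [RHS]rmorph_nat -[RHS]E; apply: eq_bigr => l _.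
    by rewrite rmorphM (entry _ _ _ _ WiE) (entry _ _ _ _ (TqE _)).
Qed.
End Spread.

(** * The slope filtration over the localization *)

Section Conclusion.
Context (Fq : finFieldType) (k : fieldExtType Fq) (tb : trace_basis k).
Context (S : comNzRingType) (iota : {rmorphism Fq -> S}).
Local Notation K := (k_tens k iota).
Local Notation io := (laurent_map (tbase k iota)).
Local Notation s := (laurent_map (frobq_of iota)).
Local Notation q := (\dim {:k}).
Context (M : isocrystal_over k iota) (ds : dual_system io M) (n : nat).
Context (P : 'M[laurent S]_(n, ds_n ds)) (Pi : 'M[laurent S]_(ds_n ds, n))
  (T Z : 'M[laurent S]_n) (H : k -> 'M[laurent S]_n) (sl : 'I_n -> rat).
Context (PPi : P *m Pi = 1%:M) (PiP : Pi *m P = idm_mx ds)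
  (TE : map_mx s P *m tau_mx ds *m Pi = T)
  (HE : forall c, P *m kact_mx ds c *m Pi = H c).
Context (ZT : Z *m T = 1%:M) (triT : triangular sl T) (triZ : triangular sl Z)
  (triH : forall c, triangular sl (H c))
  (intH : forall c i j, sl i = sl j -> vge 0 (H c i j)).
Context (pure : forall i0, exists (m : nat) (e : int) (W : 'M[laurent S]_n),
    [/\ (0 < m)%N, (m * q)%:R * sl i0 = e%:~R,
        forall i j, sl i = sl i0 -> sl j = sl i0 -> vge e%:~R (twpow s T (m * q) i j),
        forall i j, vge (- e%:~R) (W i j) &
        forall i j, sl i = sl i0 -> sl j = sl i0 ->
          \sum_(l | sl l == sl i0) W i l * twpow s T (m * q) l j = (i == j)%:R]).

(** Although the dual system need not be free, these vectors form a basis over the Laurent series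
    over S: [PPi] and [PiP] make [form_co] inverse to taking combinations. *)
Definition form_b (i : 'I_n) : M := \sum_a io (P i a) *: ds_y ds a.
Definition form_co (x : M) : 'rV[laurent S]_n := ds_co ds x *m Pi.
(* [sl] is normalized by powers of [tau], the slopes of a filtration by powers of
   [tau ^ q]. *)
Definition form_sl (i : 'I_n) : rat := q%:R * sl i.

Lemma ds_co_comb (v : 'rV_(ds_n ds)) : ds_co ds (\sum_a io (v 0 a) *: ds_y ds a) = v *m idm_mx ds.
Proof.
rewrite ds_co_sum mulmx_sum_row; apply: eq_bigr => a _.
by rewrite ds_coZ ds_mx_row.
Qed.

Lemma form_comb (v : 'rV_n) : \sum_i io (v 0 i) *: form_b i =
  \sum_a io ((v *m P) 0 a) *: ds_y ds a.
Proof.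
under eq_bigr => i _ do rewrite scaler_sumr.
rewrite exchange_big; apply: eq_bigr => a _ /=.
rewrite mxE rmorph_sum scaler_suml; apply: eq_bigr => i _.
by rewrite rmorphM scalerA.
Qed.

Lemma P_idm : P *m idm_mx ds = P.
Proof. by rewrite -PiP mulmxA PPi mul1mx. Qed.

Lemma ds_co_b i : ds_co ds (form_b i) = row i P.
Proof.
have -> : form_b i = \sum_a io (row i P 0 a) *: ds_y ds a.
  by apply: eq_bigr => a _; rewrite mxE.
by rewrite ds_co_comb -row_mul P_idm.
Qed.

Lemma form_lin a x y : form_co (io a *: x + y) = a *: form_co x + form_co y.
Proof. by rewrite /form_co ds_lin mulmxDl scalemxAl. Qed.

Lemma form_K x : x = \sum_i io (form_co x 0 i) *: form_b i.
Proof. by rewrite form_comb /form_co -mulmxA PiP co_idm -ds_K. Qed.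

Lemma form_bK (v : 'rV[laurent S]_n) : form_co (\sum_i io (v 0 i) *: form_b i) = v.
Proof. by rewrite form_comb /form_co ds_co_comb -[v *m P *m _]mulmxA P_idm -mulmxA PPi mulmx1. Qed.

Lemma form_kact c i : form_co (kact c (form_b i)) = row i (H c).
Proof. by rewrite /form_co co_kact ds_co_b -HE !row_mul. Qed.

Lemma form_q0 : 0 < q%:R :> rat.
Proof. by rewrite ltr0n adim_gt0. Qed.

Lemma form_sl_le i j : (form_sl i <= form_sl j) = (sl i <= sl j).
Proof. by rewrite /form_sl ler_pM2l // form_q0. Qed.

Lemma form_sl_inj i j : form_sl i = form_sl j -> sl i = sl j.
Proof. by move=> E; apply/le_anti; rewrite -!form_sl_le E lexx. Qed.

(** The constants [tb_w] span the scalars, so a nonzero coordinate of e b_i already shows in one of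
    the matrices of the k-action, which are triangular. *)
Lemma form_tri e i l : form_co (e *: form_b i) 0 l != 0 -> form_sl l <= form_sl i.
Proof.
rewrite form_sl_le [e](lcoordK tb) scaler_suml => el.
have [j jl] : exists j, H (tb_w tb j) i l != 0.
  apply: contrapT => /forallNP H0; case/eqP: el.
  rewrite /form_co ds_co_sum mulmx_suml summxE big1 // => j _.
  rewrite -scalerA ds_coZ -scalemxAl mxE.
  have := form_kact (tb_w tb j) i; rewrite /form_co /kact => ->.
  by have /negP := H0 j; rewrite negbK mxE => /eqP ->; rewrite mulr0.
by apply: (triH (c := tb_w tb j)); apply/eqP.
Qed.

Definition form_fbasis : fbasis io M := FBasis form_lin form_K form_bK form_tri.

Lemma form_slope_filtration : inhabited (slope_filtration q M).
Proof.
apply: (@slope_filtration_exists S K (tbase k iota) q _ _ _ (tens_pair tb iota) s (sigma k iota)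
  (@sigma_io _ _ _ _) _ _ M form_fbasis T Z).
- by move=> i; exact: sigma_scal.
- by move=> a x; exact: laurent_map_vge.
- move=> i; rewrite -[LHS]/(form_co (tau M (form_b i))).
  by rewrite /form_co co_tau_mx ds_co_b map_row -TE !row_mul.
- exact: ZT.
- by move=> i j /triT; rewrite /= form_sl_le.
- by move=> i j /triZ; rewrite /= form_sl_le.
- move=> l i i' /form_sl_inj sii'; change (vge 0 (form_co (kact (tb_w tb l) (form_b i)) 0 i')).
  by rewrite form_kact mxE; exact: intH.
- move=> i0; have [m [e [W [m0 me Tq_ge W_ge WT]]]] := pure i0; exists m, e, W; split=> //.
  + by rewrite /= /form_sl mulrA -natrM.
  + by move=> i j /form_sl_inj si /form_sl_inj sj; exact: Tq_ge.
  + move=> i j /form_sl_inj si /form_sl_inj sj; rewrite -WT //; apply: eq_bigl => l.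
    by rewrite /= /form_sl; apply/eqP/eqP => [/form_sl_inj //|->].
Qed.
End Conclusion.

Section BaseChangeSystem.
Context (Fq : finFieldType) (k : fieldExtType Fq) (tb : trace_basis k).
Context (R : idomainType) (iota : {rmorphism Fq -> R}) (M : isocrystal_over k iota).

(** The system is chosen before xi, and its base change has the same size, so the matrices over
    R[xi^-1] are the images of fixed matrices over R((z)). *)
Lemma base_change_system : exists N (y : 'I_N -> M) co colin coK, forall xi : R,
  exists y' co' colin' coK',
  let ds : dual_system (laurent_map (tbase k iota)) M := @DualSystem _ _ _ M N y co colin coK in
  let ds' : dual_system (laurent_map (tbase k (to_away xi \o iota : {rmorphism Fq -> away xi})))
    (isocrystal_base_change (to_away xi) M) := @DualSystem _ _ _ _ N y' co' colin' coK' in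
  [/\ idm_mx ds' = map_mx (laurent_map (to_away xi)) (idm_mx ds),
      tau_mx ds' = map_mx (laurent_map (to_away xi)) (tau_mx ds) &
      forall c, kact_mx ds' c = map_mx (laurent_map (to_away xi)) (kact_mx ds c)].
Proof.
have [m [g [f fK]]] := projective_functionals (isocrystal_fg M) (@isocrystal_proj _ _ M).
have f_lin i e (x x' : M) : f i (e *: x + x') = e * f i x + f i x' by rewrite linearP.
exists _, (fsys_y tb g), (fsys_co tb (fun i => f i)), (fsys_lin tb f_lin), (fsys_K tb fK) => xi.
pose h : {rmorphism R -> away xi} := to_away xi; pose phi := E_F_map k iota h.
pose M' := isocrystal_base_change h M.
have [f' [f'_lin f'K f'p]] := bc_functionals phi fK.
exists (fsys_y tb (fun i => ptensor phi 1 (g i) : M')), (fsys_co tb f'),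
  (fsys_lin tb f'_lin), (fsys_K tb f'K).
have y'E a : fsys_y tb (fun i => ptensor phi 1 (g i) : M') a = ptensor phi 1 (fsys_y tb g a).
  by rewrite /fsys_y scale_pure mulr1 pureZ mul1r phi_scal.
have co'E x : fsys_co tb f' (ptensor phi 1 x) = map_mx (laurent_map h) (fsys_co tb (fun i => f i) x).
  by apply/rowP => a; rewrite !mxE f'p mul1r lcoord_map.
move=> ds ds'.
have mxP (u : M -> M) (u' : M' -> M') : (forall x, u' (ptensor phi 1 x) = ptensor phi 1 (u x)) ->
    ds_mx ds' u' = map_mx (laurent_map h) (ds_mx ds u).
  move=> uu; apply/row_matrixP => a; rewrite -map_row !rowK -[ds_y ds' a]/(fsys_y _ _ a) y'E uu.
  exact: co'E.
split=> [||c]; apply: mxP => x //.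
- by rewrite [LHS]bc_tau_pure rmorph1.
- by rewrite /kact scale_pure mulr1 pureZ mul1r phi_scal.
Qed.
End BaseChangeSystem.

Theorem theorem10p14 (Fq : finFieldType) (k : fieldExtType Fq)
    (R : idomainType) (iota : {rmorphism Fq -> R})
    (M : isocrystal_over k iota) :
  noetherian R ->
  exists xi : R, xi != 0 /\
    inhabited (slope_filtration (\dim {:k})
      (isocrystal_base_change (to_away xi) M)).
Proof.
move=> _; have [tb] := trace_basis_exists k.
have [N [y [co [colin [coK sys]]]]] := base_change_system tb M.
pose ds : dual_system (laurent_map (tbase k iota)) M := @DualSystem _ _ _ M N y co colin coK.
have [n [P [Pi [T' [Z [H' [sl [PPi PiP T'E H'E slf]]]]]]]] := generic_slope_form tb ds.
have [xi xi0 [P_S [Pi_S [T_S [Z_S [H_S [PPiS PiPS TE HE ZT triT triZ triH intH pure]]]]]]] :=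
  spread_form_exists (I := finvect_type k) (H := fun c => kact_mx ds c) PPi PiP T'E H'E slf.
exists xi; split=> //.
have [y' [co' [colin' [coK' [idE tauE kactE]]]]] := sys xi.
apply: (form_slope_filtration tb (ds := @DualSystem _ _ _ _ N y' co' colin' coK')
  (P := P_S) (Pi := Pi_S) (T := T_S) (Z := Z_S) (H := H_S) (sl := sl)) => //.
- by rewrite idE.
- by rewrite tauE.
- by move=> c; rewrite kactE.
Qed.
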